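(* For every formed space $E$ and every $U\in\mathcal{P}^\omega(E)$, the poset $\mathcal{P}^\omega(E,U)$ is Cohen–Macaulay.
   Context: Formed spaces over a field $\mathbb{F}$ with involution $\sigma$ ($\bar c=\sigma(c)$), $\varepsilon$ ($\varepsilon\bar\varepsilon=1$) and additive subgroup $\Lambda$ with $\{c-\varepsilon\bar c\}\le\Lambda\le\{c:c+\varepsilon\bar c=0\}$: a form on a finite-dimensional $E$ is a sesquilinear $f$ ($f(av,bw)=\bar af(v,w)b$) modulo those with $f(v,v)\in\Lambda$, $f(w,v)=-\varepsilon\overline{f(v,w)}$. $\omega_q(v,w)=q(v,w)+\varepsilon\overline{q(w,v)}$, $Q_q(v)=q(v,v)+\Lambda$; $K(E)=\{v:\omega_q(E,v)=0\}$, radical $R(E)=\{v\in K(E):Q_q(v)=0\}$; $U^\perp=\{v:\omega_q(v,U)=0\}$; isotropic means $\omega_q,Q_q$ vanish on the subspace. $\mathcal{P}^\omega(E)$ is the poset (inclusion) of isotropic $W$ with $R(E)<W<E$, and $\mathcal{P}^\omega(E,U)=\{W\in\mathcal{P}^\omega(E):W+U^\perp=E\}$. A graded poset is Cohen–Macaulay if for all $-\infty\le x\le y\le\infty$ the interval $(x,y)=\{z:x<z<y\}$ has $(\dim(x,y)-1)$-connected realization, $\dim$ being maximal chain length. *)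

(* Defs.v *)
From HB Require Import structures.
From mathcomp Require Import all_boot all_order all_algebra.
From mathcomp Require Import all_classical all_reals all_analysis.
From mathcomp Require Import Rstruct Rstruct_topology.

Set Implicit Arguments.
Unset Strict Implicit.
Unset Printing Implicit Defensive.

Import Order.TTheory GRing.Theory Num.Theory.
Local Open Scope ring_scope.
Local Open Scope classical_set_scope.

(* A poset is given by a carrier T, an order relation le on T, and a   *)
(* subset S of T (the elements of the poset).                          *)

Notation RR := Rdefinitions.R.

Section Posets.
Variables (T : eqType) (le : rel T).

Definition plt (a b : T) : bool := le a b && (a != b).

(* a chain of the poset S : a strictly increasing finite sequence in S;
   its length (as a chain) is size c - 1. *)
Definition is_chain (S : set T) (c : seq T) : Prop :=
  sorted plt c /\ (forall t, t \in c -> S t).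

Definition is_maxchain (S : set T) (c : seq T) : Prop :=
  is_chain S c /\
  (forall c', is_chain S c' -> {subset c <= c'} -> {subset c' <= c}).

(* dim S = d : maximal length of a chain (d = -1 for the empty poset) *)
Definition has_dim (S : set T) (d : int) : Prop :=
  (exists c, is_chain S c /\ (size c)%:Z = d + 1) /\
  (forall c, is_chain S c -> (size c)%:Z <= d + 1).

Definition graded (S : set T) : Prop :=
  exists d, has_dim S d /\ forall c, is_maxchain S c -> (size c)%:Z = d + 1.

(* Geometric realization of the order complex of S: points are
   functions alpha : T -> R, nonnegative, supported on a chain of S,
   with coordinates summing to 1. *)
Definition realization (S : set T) : set (T -> RR) :=
  [set alpha | exists c, [/\ is_chain S c,
     forall t, t \notin c -> alpha t = 0,
     forall t, 0 <= alpha t & \sum_(t <- c) alpha t = 1]].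

Definition std_simplex (n : nat) : set 'rV[RR]_n :=
  [set l | (forall i, 0 <= l ord0 i) /\ \sum_(i < n) l ord0 i = 1].
Arguments std_simplex n : clear implicits.

(* the characteristic (barycentric) map of the simplex spanned by c *)
Definition bary (c : seq T) (l : 'rV[RR]_(size c)) : T -> RR :=
  fun t => \sum_(i < size c | nth t c i == t) l ord0 i.
Arguments bary c l : clear implicits.

(* coherent (weak) topology on the realization: O is open iff its trace
   on every closed simplex is open in that simplex *)
Definition coh_open (S : set T) (O : set (T -> RR)) : Prop :=
  forall c, is_chain S c ->
    exists V : set 'rV[RR]_(size c), open V /\
      std_simplex (size c) `&` (bary c @^-1` O) = std_simplex (size c) `&` V.

Definition cont_into (S : set T) (m : nat) (A : set 'rV[RR]_m)
  (f : 'rV[RR]_m -> T -> RR) : Prop :=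
  (forall x, A x -> realization S (f x)) /\
  (forall O, coh_open S O ->
     exists V : set 'rV[RR]_m, open V /\ A `&` (f @^-1` O) = A `&` V).

Definition sphere (n : nat) : set 'rV[RR]_n.+1 :=
  [set x | \sum_(i < n.+1) x ord0 i ^+ 2 = 1].
Definition ball_closed (n : nat) : set 'rV[RR]_n.+1 :=
  [set x | \sum_(i < n.+1) x ord0 i ^+ 2 <= 1].
Arguments sphere n : clear implicits.
Arguments ball_closed n : clear implicits.

(* |S| is k-connected (k : int, k >= -1 meaningful): nonempty if
   k >= -1, and every continuous map S^n -> |S| with n <= k extends
   to a continuous map D^(n+1) -> |S|.  For k <= -2 no condition. *)
Definition k_connected (S : set T) (k : int) : Prop :=
  (-1 <= k -> exists alpha, realization S alpha) /\
  (forall n : nat, (n%:Z <= k) ->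
     forall f, cont_into S (sphere n) f ->
       exists g, cont_into S (ball_closed n) g /\
                 (forall x, sphere n x -> g x = f x)).

Inductive ext := Bot | Mid of T | Top.

Definition ext_le (x y : ext) : Prop :=
  match x, y with
  | Bot, _ => True
  | _, Top => True
  | Mid a, Mid b => le a b
  | _, _ => False
  end.

Definition ext_lt (x y : ext) : Prop := ext_le x y /\ x <> y.

Definition in_ext (S : set T) (x : ext) : Prop :=
  match x with Mid a => S a | _ => True end.

Definition open_interval (S : set T) (x y : ext) : set T :=
  [set z | S z /\ ext_lt x (Mid z) /\ ext_lt (Mid z) y].

Definition cohen_macaulay (S : set T) : Prop :=
  graded S /\
  forall x y : ext, in_ext S x -> in_ext S y -> ext_le x y ->
    exists d, has_dim (open_interval S x y) d /\
              k_connected (open_interval S x y) (d - 1).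

End Posets.

Section Formed.
Variables (F : fieldType) (E : vectType F).
Variables (sigma : {rmorphism F -> F}) (eps : F) (Lambda : pred F).

Definition form_parameters : Prop :=
  [/\ involutive sigma, eps * sigma eps = 1,
      (forall a b, a \in Lambda -> b \in Lambda -> a - b \in Lambda),
      (forall c, c - eps * sigma c \in Lambda) &
      (forall c, c \in Lambda -> c + eps * sigma c = 0)].

Definition sesquilinear (q : E -> E -> F) : Prop :=
  [/\ forall v v' w, q (v + v') w = q v w + q v' w,
      forall v w w', q v (w + w') = q v w + q v w' &
      forall a b v w, q (a *: v) (b *: w) = sigma a * q v w * b].

Variable q : E -> E -> F.

Definition omega (v w : E) : F := q v w + eps * sigma (q w v).

(* Q_q(v) = 0 in F / Lambda *)
Definition Qzero (v : E) : Prop := q v v \in Lambda.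

Definition Kset (v : E) : Prop := forall u, omega u v = 0.
Definition Rad (v : E) : Prop := Kset v /\ Qzero v.

Definition perp (U : {vspace E}) (v : E) : Prop :=
  forall u, u \in U -> omega v u = 0.

Definition isotropic (W : {vspace E}) : Prop :=
  (forall v w, v \in W -> w \in W -> omega v w = 0) /\
  (forall v, v \in W -> Qzero v).

Definition Pomega (W : {vspace E}) : Prop :=
  [/\ isotropic W,
      (forall v, Rad v -> v \in W),
      (exists2 w, w \in W & ~ Rad w) &
      W <> fullv].

Definition PomegaU (U : {vspace E}) (W : {vspace E}) : Prop :=
  Pomega W /\
  forall e : E, exists w x, [/\ w \in W, perp U x & e = w + x].

End Formed.

Definition vsub_le (F : fieldType) (E : vectType F) : rel {vspace E} :=
  fun A B => (A <= B)%VS.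

(* Main.v *)
Require Import Defs.
From HB Require Import structures.
From mathcomp Require Import all_boot all_order all_algebra.
From mathcomp Require Import all_classical all_reals all_analysis.
From mathcomp Require Import Rstruct Rstruct_topology zify ring lra.

(** Attaching to a complex [X] cones over [(k - 1)]-connected subcomplexes preserves
    [k]-connectivity: a map of a sphere of dimension at most [k] is pushed off each cone point
    cell by cell, on a fine cubical grid. All intervals of the poset are built in this way from
    contractible pieces.

    An isotropic [W] containing the radical belongs to the poset iff no nonzero vector of [Z], a
    complement of the radical in [U], is orthogonal to [W]. Induct on [dim Z]: write
    [Z = Z' + <z>] and choose a singular [w] orthogonal to [Z'] with [omega z w <> 0]. The [W]
    containing [w] form the poset of [Z'] in [w^perp / w]. The [W] such that [W :&: w^perp] is still
    in the poset deform to them. For any other [W] there is a unique [x] in [Z] with [w - x]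
    orthogonal to [W]. These [W] are attached in two rounds: first, by increasing dimension, those
    which do not contain [w - x] modulo the kernel of [omega], along the join of the [W'] below [W]
    (supplements of [W :&: Z^perp] in [W]) with the [W'] above [W] which are not orthogonal to
    [w - x], an instance of the same problem for a single, possibly anisotropic, vector; then, by
    decreasing dimension, those which contain [w - x], along the join of the supplements avoiding
    [w - x] with all isotropic subspaces above [W]. *)

Set Implicit Arguments.
Unset Strict Implicit.
Unset Printing Implicit Defensive.

Import Order.TTheory GRing.Theory Num.Theory numFieldNormedType.Exports.
Local Open Scope ring_scope.
Local Open Scope classical_set_scope.

(** * Maps to flag complexes *)

Lemma within_continuous_near (X Y : topologicalType) (A : set X) (f : X -> Y) x (V : set Y) :
  {within A, continuous f} -> A x -> nbhs (f x) V -> \forall y \near x, A y -> V (f y).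
Proof. by move=> /subspace_continuousP fc Ax; exact: fc. Qed.

Lemma within_continuous_comp (X Y Z : topologicalType) (A : set X) (B : set Y)
    (u : X -> Y) (f : Y -> Z) :
  A `<=` u @^-1` B -> {within A, continuous u} -> {within B, continuous f} ->
  {within A, continuous (f \o u)}.
Proof.
move=> AB cu cf; apply/subspace_continuousP => x Ax V fuxV.
have := within_continuous_near cu Ax (within_continuous_near cf (AB _ Ax) fuxV).
by apply: filterS => y fV Ay; exact: fV Ay (AB _ Ay).
Qed.

Lemma within_continuous_closed_cover (X Y : topologicalType) (I : finType) (P : pred I)
    (C : I -> set X) (A : set X) (f : X -> Y) :
  (forall i, P i -> closed (C i)) -> (forall x, A x -> exists2 i, P i & C i x) ->
  (forall i, P i -> {within A `&` C i, continuous f}) -> {within A, continuous f}.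
Proof.
move=> closedC cover cf; apply/subspace_continuousP => x Ax V fxV.
suff near_C i : \forall y \near x, P i -> A y -> C i y -> V (f y).
  have : \forall y \near x, forall i, P i -> A y -> C i y -> V (f y) by exact: filter_forall.
  apply: filterS => y VC Ay.
  by have [i Pi Cy] := cover y Ay; exact: VC Cy.
have [Pi|nPi] := boolP (P i); last by apply: nearW.
have [Cx|nCx] := pselect (C i x).
  have := within_continuous_near (cf i Pi) (conj Ax Cx) fxV.
  by apply: filterS => y VAC _ Ay Cy; exact: VAC.
have : nbhs x (~` C i) by apply: open_nbhs_nbhs; split => //; exact/closed_openC/closedC.
by apply: filterS => y nCy _ _ /nCy.
Qed.

Lemma within_continuous_max (R : realType) (X : topologicalType) (A : set X)
    (f g : X -> R) :
  {within A, continuous f} -> {within A, continuous g} ->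
  {within A, continuous (fun x => Num.max (f x) (g x))}.
Proof. by move=> cf cg x; apply: continuous_max; [exact: cf|exact: cg]. Qed.

Lemma within_continuous_row (R : numFieldType) (X : topologicalType) (A : set X) n
    (f : X -> 'rV[R]_n) :
  (forall i, {within A, continuous (fun x => f x ord0 i)}) -> {within A, continuous f}.
Proof.
move=> fc; apply/subspace_continuousP => x Ax V [P nP PV].
have : \forall y \near x, forall i, A y -> P ord0 i (f y ord0 i).
  by apply: filter_forall => i; exact: within_continuous_near (fc i) Ax (nP ord0 i).
by apply: filterS => y Py Ay; apply: PV => i j; rewrite (ord1 i); exact: Py.
Qed.

Lemma compact_uniformly_continuous (R : realType) (X Y : pseudoMetricType R) (K : set X)
    (f : X -> Y) (e : R) :
  compact K -> {within K, continuous f} -> 0 < e ->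
  exists2 d, 0 < d & forall x y, K x -> K y -> ball x d y -> ball (f x) e (f y).
Proof.
move=> /compact_near_coveringP/near_covering_withinP cK cf e_gt0.
have : \forall d \near 0^'+, K `<=` [set x | forall y, K y -> ball x d y -> ball (f x) e (f y)].
  apply: cK => x Kx.
  have e2_gt0 : 0 < e / 2 by rewrite divr_gt0.
  have /nbhs_ballP[/= r r_gt0 fxr] := within_continuous_near cf Kx (nbhsx_ballx (f x) _ e2_gt0).
  have fx y : K y -> ball x r y -> ball (f x) (e / 2) (f y) by move=> Ky xy; exact: fxr xy Ky.
  near=> x' d.
  have xx' : ball x (r / 2) x' by near: x'; apply: nbhsx_ballx; rewrite divr_gt0.
  have d_le : d <= r / 2 by near: d; apply: nbhs_right_ltW; rewrite divr_gt0.
  move=> Kx' y Ky x'y; apply: (ball_splitr (z := f x)).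
    by apply: fx => //; apply: le_ball xx'; lra.
  by apply: fx => //; rewrite [r]splitr; apply: ball_triangle xx' (le_ball d_le x'y).
move=> /(filterI (nbhs_right_gt 0))/filter_ex[d [d_gt0 unif]].
by exists d => // x y Kx Ky; exact: unif.
Unshelve. all: by end_near. Qed.

Section FlagMaps.
Variables (R : realType) (T : eqType) (cmp : rel T).
Hypotheses (cmp_refl : reflexive cmp) (cmp_sym : symmetric cmp).
Implicit Types (S : set T) (ts : seq T) (a b : T -> R).

Definition flag_points S ts : set (T -> R) :=
  [set a | [/\ forall t, 0 <= a t, forall t, t \notin ts -> a t = 0,
     forall t, a t != 0 -> S t, forall s t, a s != 0 -> a t != 0 -> cmp s t &
     \sum_(t <- ts) a t = 1]].

Lemma sum_sub_uniq ts ts' a : uniq ts -> uniq ts' -> {subset ts <= ts'} ->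
  (forall t, t \notin ts -> a t = 0) -> \sum_(t <- ts') a t = \sum_(t <- ts) a t.
Proof.
move=> uts uts' sub a0; rewrite (bigID (mem ts)) /= [X in _ + X]big1 ?addr0 => [|t /a0 //].
rewrite -big_filter; apply/perm_big/uniq_perm; rewrite ?filter_uniq // => t.
by rewrite mem_filter /=; case: (boolP (t \in ts)) => // /sub ->.
Qed.

Lemma flag_pointsW S S' ts ts' a : S `<=` S' -> uniq ts -> uniq ts' -> {subset ts <= ts'} ->
  flag_points S ts a -> flag_points S' ts' a.
Proof.
move=> SS' uts uts' sub [a_ge0 a0 aS acmp a1]; split=> //.
- by move=> t t_ts'; apply/a0/(contra _ t_ts')/sub.
- by move=> t /aS/SS'.
- by rewrite (sum_sub_uniq uts).
Qed.

Lemma flag_points_vertex S ts v : uniq ts -> v \in ts -> S v ->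
  flag_points S ts (fun t => (t == v)%:R).
Proof.
move=> uts v_ts Sv; split.
- by move=> t; rewrite ler0n.
- by move=> t; case: (eqVneq t v) => // ->; rewrite v_ts.
- by move=> t; case: (eqVneq t v) => [->|_]; rewrite ?eqxx.
- by move=> s t; case: (eqVneq s v) => [->|_]; case: (eqVneq t v) => [->|_]; rewrite ?eqxx.
- rewrite (big_rem v) //= eqxx big_seq big1 ?addr0 // => t.
  by rewrite mem_rem_uniq // inE => /andP[/negPf->].
Qed.

Lemma flag_points_conv S ts a b (l : R) : 0 <= l <= 1 ->
  flag_points S ts a -> flag_points S ts b ->
  (forall s t, a s != 0 -> b t != 0 -> cmp s t) ->
  flag_points S ts (fun t => (1 - l) * a t + l * b t).
Proof.
move=> /andP[l_ge0 l_le1] [a_ge0 a0 aS acmp a1] [b_ge0 b0 bS bcmp b1] abcmp.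
have supp t : (1 - l) * a t + l * b t != 0 -> a t != 0 \/ b t != 0.
  case: (eqVneq (a t) 0) => [->|]; last by left.
  by case: (eqVneq (b t) 0) => [->|]; [rewrite !mulr0 addr0 eqxx|right].
split.
- by move=> t; rewrite addr_ge0 // mulr_ge0 // subr_ge0.
- by move=> t t_ts; rewrite a0 // b0 // !mulr0 addr0.
- by move=> t /supp[/aS|/bS].
- by move=> s t /supp[as0|bs0] /supp[at0|bt0]; rewrite 1?cmp_sym; auto; rewrite cmp_sym; auto.
- by rewrite big_split /= -!mulr_sumr a1 b1; ring.
Qed.

(* The common part of [a] and [b], the missing mass being put on [v]: a point of the
   star of [v] joined by segments to both [a] and [b]. *)
Definition flag_meet ts v a b : T -> R := fun t =>
  Num.min (a t) (b t) + (1 - \sum_(s <- ts) Num.min (a s) (b s)) * (t == v)%:R.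

Lemma flag_meetC ts v a b : flag_meet ts v a b = flag_meet ts v b a.
Proof.
apply/funext => t; rewrite /flag_meet minC; congr (_ + (1 - _) * _).
by apply: eq_bigr => s _; rewrite minC.
Qed.

Lemma flag_meet_supp S ts v a b t : flag_points S ts a -> flag_points S ts b ->
  (a <> b -> forall s, a s != 0 -> cmp s v) -> flag_meet ts v a b t != 0 ->
  a t != 0 \/ t = v /\ forall s, a s != 0 -> cmp s v.
Proof.
move=> [a_ge0 a0 _ _ a1] [b_ge0 b0 _ _ b1] av.
have [at0|] := eqVneq (a t) 0; last by left.
have [ab|/av av'] := pselect (a = b); rewrite /flag_meet at0.
  by rewrite -ab at0 minxx; under eq_bigr do rewrite minxx; rewrite a1 subrr mul0r addr0 eqxx.
rewrite (min_idPl (b_ge0 t)) add0r; have [->|_] := eqVneq t v; first by right.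
by rewrite mulr0 eqxx.
Qed.

Lemma flag_points_meet S ts v a b : uniq ts -> v \in ts -> S v ->
  flag_points S ts a -> flag_points S ts b -> (a <> b -> forall s, a s != 0 -> cmp s v) ->
  flag_points S ts (flag_meet ts v a b).
Proof.
move=> uts v_ts Sv pa pb av; have supp t := flag_meet_supp (t := t) pa pb av.
have [a_ge0 a0 aS acmp a1] := pa; have [b_ge0 b0 bS bcmp b1] := pb.
split.
- move=> t; rewrite /flag_meet addr_ge0 ?le_min ?a_ge0 ?b_ge0 // mulr_ge0 ?ler0n // subr_ge0 -a1.
  by apply: ler_sum => s _; rewrite ge_min lexx.
- move=> t t_ts; apply/eqP; apply: contraT => /supp[|[tv _]]; first by rewrite a0 ?eqxx.
  by rewrite tv v_ts in t_ts.
- by move=> t /supp[/aS|[->]].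
- move=> s t /supp[as0|[-> av']] /supp[at0|[-> av'']].
  + exact: acmp.
  + exact: av''.
  + by rewrite cmp_sym; exact: av'.
  + exact: cmp_refl.
- have := flag_points_vertex uts v_ts Sv => -[_ _ _ _ v1].
  by rewrite big_split /= -mulr_sumr v1 mulr1 addrC subrK.
Qed.

Section Maps.
Variable X : topologicalType.
Implicit Types (A : set X) (f g : X -> T -> R).

Definition flag_map S A f :=
  exists2 ts, uniq ts &
    (forall x, A x -> flag_points S ts (f x)) /\ forall t, {within A, continuous f^~ t}.

Lemma flag_mapW S S' A A' f : S `<=` S' -> A' `<=` A -> flag_map S A f -> flag_map S' A' f.
Proof.
move=> SS' AA' [ts uts [fS fc]]; exists ts => //; split=> [x /AA'/fS|t].
  exact: flag_pointsW.
exact: continuous_subspaceW (fc t).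
Qed.

Lemma eq_flag_map S A f g : (forall x, A x -> f x = g x) -> flag_map S A f -> flag_map S A g.
Proof.
move=> fg [ts uts [fS fc]]; exists ts => //; split=> [x Ax|t]; first by rewrite -fg //; exact: fS.
by apply: subspace_eq_continuous (fc t) => x /set_mem/fg fgx; rewrite /from_subspace fgx.
Qed.

Lemma flag_map_common_support S A f g : flag_map S A f -> flag_map S A g ->
  exists2 ts, uniq ts & [/\ forall x, A x -> flag_points S ts (f x),
    forall x, A x -> flag_points S ts (g x),
    forall t, {within A, continuous f^~ t} & forall t, {within A, continuous g^~ t}].
Proof.
move=> [ts uts [fS fc]] [ts' uts' [gS gc]]; exists (undup (ts ++ ts')); first exact: undup_uniq.
split=> // x Ax; [apply: flag_pointsW (fS x Ax)|apply: flag_pointsW (gS x Ax)];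
  by rewrite ?undup_uniq // => t t_ts; rewrite mem_undup mem_cat t_ts ?orbT.
Qed.

Lemma flag_map_conv S A f g (l : X -> R) :
  flag_map S A f -> flag_map S A g -> {within A, continuous l} ->
  (forall x, A x -> 0 <= l x <= 1) ->
  (forall x s t, A x -> f x s != 0 -> g x t != 0 -> cmp s t) ->
  flag_map S A (fun x t => (1 - l x) * f x t + l x * g x t).
Proof.
move=> mf mg lc l01 fg; have [ts uts [fS gS fc gc]] := flag_map_common_support mf mg.
exists ts => //; split=> [x Ax|t x].
  by apply: flag_points_conv => [||| s t]; [exact: l01|exact: fS|exact: gS|exact: fg].
apply: cvgD; apply: cvgM; [|exact: fc|exact: lc|exact: gc].
by apply: cvgB; [exact: cvg_cst|exact: lc].
Qed.

Lemma flag_map_meet S A v f g : S v -> flag_map S A f -> flag_map S A g ->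
  (forall x, A x -> f x <> g x -> forall t, f x t != 0 -> cmp t v) ->
  exists ts, [/\ uniq ts, forall x, A x -> flag_points S ts (f x),
    forall x, A x -> flag_points S ts (g x) &
    flag_map S A (fun x => flag_meet ts v (f x) (g x))].
Proof.
move=> Sv mf mg fv; have [ts0 uts0 [fS gS fc gc]] := flag_map_common_support mf mg.
pose ts := undup (v :: ts0); have uts : uniq ts := undup_uniq _.
have ts0S : {subset ts0 <= ts} by move=> t t_ts; rewrite mem_undup inE t_ts orbT.
have {}fS x : A x -> flag_points S ts (f x) by move=> /fS; exact: flag_pointsW.
have {}gS x : A x -> flag_points S ts (g x) by move=> /gS; exact: flag_pointsW.
exists ts; split=> //; exists ts => //; split=> [x Ax|t x].
  by apply: flag_points_meet; rewrite ?mem_undup ?mem_head //; [exact: fS|exact: gS|exact: fv].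
have minc s : {within A, continuous (fun x => Num.min (f x s) (g x s))}.
  by move=> y; apply: continuous_min; [exact: fc|exact: gc].
apply: cvgD; first exact: minc.
apply: cvgM; last exact: cvg_cst.
apply: cvgB; first exact: cvg_cst.
by apply: cvg_big => [|s _]; [exact: add_continuous|exact: minc].
Qed.

Lemma flag_map_closed_cover S A (I : finType) (P : pred I) (C : I -> set X) f :
  (forall i, P i -> closed (C i)) -> (forall x, A x -> exists2 i, P i & C i x) ->
  (forall i, P i -> flag_map S (A `&` C i) f) -> flag_map S A f.
Proof.
move=> closedC cover mf.
have /choice[ts tsP] i : exists ts,
    P i -> uniq ts /\ forall x, A x -> C i x -> flag_points S ts (f x).
  have [Pi|nPi] := boolP (P i); last by exists [::].
  by have [ts uts [fS _]] := mf i Pi; exists ts => _; split=> // x Ax Cx; exact: fS.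
exists (undup (flatten [seq ts i | i <- enum I])); first exact: undup_uniq.
split=> [x Ax|t].
  have [i Pi Cx] := cover x Ax; have [utsi fS] := tsP i Pi.
  apply: flag_pointsW (fS x Ax Cx) => //; first exact: undup_uniq.
  move=> t t_ts; rewrite mem_undup; apply/flattenP; exists (ts i) => //.
  by rewrite map_f ?mem_enum.
by apply: within_continuous_closed_cover closedC cover _ => i Pi; have [? ? [_]] := mf i Pi; exact.
Qed.

End Maps.

Lemma flag_map_comp S (X Y : topologicalType) (A : set X) (B : set Y) (u : X -> Y) f :
  A `<=` u @^-1` B -> {within A, continuous u} -> flag_map S B f -> flag_map S A (f \o u).
Proof.
move=> AB uc [ts uts [fS fc]]; exists ts => //; split=> [x /AB/fS //|t].
exact: within_continuous_comp AB uc (fc t).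
Qed.

End FlagMaps.

(** * Filling cubes *)

Section RowNorm.
Variables (R : realType) (n : nat).
Implicit Types x : 'rV[R]_n.

Lemma coord_le_norm x i : `|x ord0 i| <= `|x|.
Proof.
rewrite [leRHS]/Num.norm /= mx_normrE.
by apply/bigmax_geP; right; exists (ord0, i).
Qed.

Lemma row_norm_le x r : 0 <= r -> (forall i, `|x ord0 i| <= r) -> `|x| <= r.
Proof.
move=> r_ge0 xr; rewrite [leLHS]/Num.norm /= mx_normrE; apply/bigmax_leP; split=> // -[j i] _ /=.
by rewrite (ord1 j).
Qed.

Lemma row_norm_attained x : x != 0 -> exists i, `|x ord0 i| = `|x|.
Proof.
rewrite -normr_eq0 => /mx_norm_neq0[[j i] /= ex]; exists i.
by rewrite [RHS]/Num.norm /= ex (ord1 j).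
Qed.

Lemma continuous_sum_coord (P : pred 'I_n) :
  continuous (fun x : 'rV[R]_n => \sum_(i < n | P i) x ord0 i).
Proof.
by apply: continuous_big => [|i _]; [exact: add_continuous|exact: coord_continuous].
Qed.

End RowNorm.

Section Cubes.
Variables (R : realType) (n : nat).
Implicit Types (D : {set 'I_n}) (c x : 'rV[R]_n) (rho : R).

Definition cube D c rho : set 'rV[R]_n :=
  [set x | `|x - c| <= rho /\ forall i, i \notin D -> x ord0 i = c ord0 i].

Definition cube_boundary D c rho : set 'rV[R]_n :=
  [set x | cube D c rho x /\ `|x - c| = rho].

Lemma continuous_subr c : continuous (fun x : 'rV[R]_n => x - c).
Proof. by move=> x; apply: (@continuousB _ _ _ id (fun=> c)); [by []|exact: cst_continuous]. Qed.

Lemma cube_coordP D c rho x : 0 <= rho ->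
  cube D c rho x <-> forall i, `|x ord0 i - c ord0 i| <= if i \in D then rho else 0.
Proof.
move=> rho_ge0; split=> [[xc xD] i|xc].
  case: ifPn => [_|/xD ->]; last by rewrite subrr normr0.
  by apply: le_trans xc; have := coord_le_norm (x - c) i; rewrite !mxE.
split=> [|i /negPf iD].
  apply: row_norm_le => // i; rewrite !mxE; apply: le_trans (xc i) _.
  by case: ifP.
by have := xc i; rewrite iD normr_le0 subr_eq0 => /eqP.
Qed.

Lemma cube_center D c rho : 0 <= rho -> cube D c rho c.
Proof. by move=> rho_ge0; split; rewrite // subrr normr0. Qed.

Lemma continuous_dist c : continuous (fun x : 'rV[R]_n => `|x - c|).
Proof. by move=> x; apply: continuous_comp; [exact: continuous_subr|exact: norm_continuous]. Qed.

Lemma closed_cube D c rho : closed (cube D c rho).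
Proof.
have -> : cube D c rho = [set x | `|x - c| <= rho] `&`
    \bigcap_(i in [set i | i \notin D]) [set x | x ord0 i = c ord0 i].
  by apply/seteqP; split=> x [].
apply: closedI; [|apply: closed_bigI => i _].
  exact: preimage_closed (fun x _ => @continuous_dist c x) (@closed_le _ _).
exact: preimage_closed (fun x _ => @coord_continuous _ _ _ ord0 i x) (@closed_eq _ _).
Qed.

Lemma closed_cube_boundary D c rho : closed (cube_boundary D c rho).
Proof.
apply: closedI; first exact: closed_cube.
exact: preimage_closed (fun x _ => @continuous_dist c x) (@closed_eq _ _).
Qed.

Lemma compact_cube_boundary D c rho : compact (cube_boundary D c rho).
Proof.
apply: bounded_closed_compact (@closed_cube_boundary D c rho).
exists (rho + `|c|); split; first exact: num_real.
move=> r r_gt x [_ xc] /=; apply: ltW; apply: le_lt_trans r_gt.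
by rewrite -xc -{1}(subrK c x) ler_normD.
Qed.

Definition radial c rho x : 'rV[R]_n := c + (rho / `|x - c|) *: (x - c).

Lemma radial_boundary D c rho x : 0 <= rho -> cube D c rho x -> x != c ->
  cube_boundary D c rho (radial c rho x).
Proof.
move=> rho_ge0 [xc xD] x_neq_c.
have radial_norm : `|radial c rho x - c| = rho.
  rewrite /radial addrAC subrr add0r normrZ ger0_norm ?divr_ge0 //.
  by rewrite divfK // normr_eq0 subr_eq0.
split=> //; split=> [|i /xD xi]; first by rewrite radial_norm.
by rewrite !mxE xi subrr mulr0 addr0.
Qed.

Lemma radial_id c rho x : rho != 0 -> `|x - c| = rho -> radial c rho x = x.
Proof. by move=> rho0 xc; rewrite /radial xc divff // scale1r addrC subrK. Qed.

Lemma continuous_radial c rho x : x != c -> {for x, continuous (radial c rho)}.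
Proof.
move=> x_neq_c; apply: (@continuousD _ _ _ (fun=> c)); first exact: cst_continuous.
apply: continuousZ; last exact: continuous_subr.
apply: (@continuousM _ _ (fun=> rho)); first exact: cst_continuous.
by apply: continuousV; [rewrite normr_eq0 subr_eq0|exact: continuous_dist].
Qed.

End Cubes.

Section CubeExtension.
Variables (R : realType) (T : eqType) (cmp : rel T).
Hypotheses (cmp_refl : reflexive cmp) (cmp_sym : symmetric cmp).
Implicit Types (S : set T) (v : T).

Definition link S v : set T := [set s | S s /\ cmp s v].

Definition extends_to_cube S n (D : {set 'I_n}) (c : 'rV[R]_n) (rho : R) (f : 'rV[R]_n -> T -> R) :=
  exists2 g, flag_map cmp S (cube D c rho) g & forall x, cube_boundary D c rho x -> g x = f x.

Definition fillable j S :=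
  forall n (D : {set 'I_n}) (c : 'rV[R]_n) (rho : R) (f : 'rV[R]_n -> T -> R),
  #|D| = j -> 0 < rho -> flag_map cmp S (cube_boundary D c rho) f -> extends_to_cube S D c rho f.

Section OneCube.
Variables (n : nat) (D : {set 'I_n}) (c : 'rV[R]_n) (rho : R).
Hypothesis rho_gt0 : 0 < rho.
Implicit Types f g : 'rV[R]_n -> T -> R.

Lemma extends_to_cubeW S S' f : S `<=` S' ->
  extends_to_cube S D c rho f -> extends_to_cube S' D c rho f.
Proof. by move=> SS' [g mg gf]; exists g => //; exact: flag_mapW mg. Qed.

Lemma flag_map_radial S A f : A `<=` cube D c rho -> (forall x, A x -> x != c) ->
  flag_map cmp S (cube_boundary D c rho) f -> flag_map cmp S A (f \o radial c rho).
Proof.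
move=> sub_cube A_neq_c; apply: flag_map_comp => [x Ax|].
  exact: radial_boundary (ltW rho_gt0) (sub_cube x Ax) (A_neq_c x Ax).
by apply: continuous_in_subspaceT => x /set_mem/A_neq_c; exact: continuous_radial.
Qed.

Lemma flag_map_double S g : flag_map cmp S (cube D c rho) g ->
  flag_map cmp S (cube D c rho `&` [set x | `|x - c| / rho <= 2^-1])
    (fun x => g (c + 2%:R *: (x - c))).
Proof.
apply: flag_map_comp => [x [[_ xD] /= xc]|].
  split=> [|i /xD xi]; last by rewrite !mxE xi subrr mulr0 addr0.
  rewrite addrAC subrr add0r normrZ ger0_norm //.
  by move: xc; rewrite ler_pdivrMr //; lra.
apply: continuous_subspaceT => x.
exact: continuousD (@cst_continuous _ _ c x) (continuousZl_tmp (@continuous_subr _ _ c x)).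
Qed.

(* A collar: the outer half of the cube carries the homotopy from [f] to [g], the
   inner half the extension of [g]. *)
Lemma extends_linear_homotopy S f g :
  flag_map cmp S (cube_boundary D c rho) f -> flag_map cmp S (cube_boundary D c rho) g ->
  (forall x s t, cube_boundary D c rho x -> f x s != 0 -> g x t != 0 -> cmp s t) ->
  extends_to_cube S D c rho g -> extends_to_cube S D c rho f.
Proof.
move=> mf mg fg [G mG Gg]; have rho0 : rho != 0 by rewrite gt_eqF.
pose s x : R := `|x - c| / rho; pose r := radial c rho.
pose outer x t := (1 - (2 - 2 * s x)) * f (r x) t + (2 - 2 * s x) * g (r x) t.
pose inner x := G (c + 2%:R *: (x - c)).
have s_cont : continuous s.
  by move=> x; exact: continuousM (@continuous_dist _ _ c x) (@cst_continuous _ _ rho^-1 x).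
have s_gt0 x : 2^-1 <= s x -> x != c.
  by apply: contraTneq => ->; rewrite /s subrr normr0 mul0r; lra.
have s_le1 x : cube D c rho x -> s x <= 1 by move=> [xc _]; rewrite ler_pdivrMr ?mul1r.
exists (fun x => if 2^-1 <= s x then outer x else inner x); last first.
  move=> x [_ xc]; apply/funext => t.
  by rewrite /outer /r radial_id // /s xc divff // ifT; [ring|lra].
pose C (b : bool) := if b then [set x | 2^-1 <= s x] else [set x | s x <= 2^-1].
apply: (@flag_map_closed_cover _ _ _ _ S _ bool xpredT C) => //.
- case=> _; first exact: preimage_closed (fun x _ => s_cont x) (@closed_ge _ _).
  exact: preimage_closed (fun x _ => s_cont x) (@closed_le _ _).
- by move=> x _; case: (leP 2^-1 (s x)) => [?|/ltW ?]; [exists true|exists false].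
case=> _.
  apply: (@eq_flag_map _ _ _ _ _ _ outer) => [x [_ /= ->] //|].
  have nc x : (cube D c rho `&` C true) x -> x != c by move=> [_ /s_gt0].
  apply: (flag_map_conv cmp_sym (flag_map_radial _ nc mf) (flag_map_radial _ nc mg)) => //.
  + move=> x; apply: cvgB; first exact: cvg_cst.
    apply: cvgM; first exact: cvg_cst.
    by have := continuous_subspaceT s_cont; exact.
  + by move=> x [/s_le1 sx /= sx']; apply/andP; split; lra.
  + by move=> x a b [cx /s_gt0 xc]; exact: fg (radial_boundary (ltW rho_gt0) cx xc).
apply: (@eq_flag_map _ _ _ _ _ _ inner) (flag_map_double mG) => x [cx /= sx].
case: leP => // sx'; have {sx sx'} sx : s x = 2^-1 by apply/eqP; rewrite eq_le sx.
have xc : x != c by apply: s_gt0; rewrite sx.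
have -> : inner x = G (r x) by rewrite /inner /r /radial -[2]invrK -sx /s invf_div.
rewrite Gg; last exact: radial_boundary (ltW rho_gt0) cx xc.
by apply/funext => t; rewrite /outer sx; field.
Qed.

Lemma extends_in_star S v f g : S v ->
  flag_map cmp S (cube_boundary D c rho) f -> flag_map cmp S (cube_boundary D c rho) g ->
  (forall x t, cube_boundary D c rho x -> f x <> g x -> f x t != 0 -> cmp t v) ->
  (forall x t, cube_boundary D c rho x -> f x <> g x -> g x t != 0 -> cmp t v) ->
  extends_to_cube S D c rho g -> extends_to_cube S D c rho f.
Proof.
move=> Sv mf mg fv gv ext_g.
have [|ts [uts fS gS mm]] := flag_map_meet cmp_refl cmp_sym Sv mf mg.
  by move=> x bx fgx t; exact: fv.
apply: (extends_linear_homotopy mf mm) => [x a b bx fa|].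
  have fvx : f x <> g x -> forall t, f x t != 0 -> cmp t v by move=> ? t; exact: fv.
  have [_ _ _ fcmp _] := fS x bx.
  by case/(flag_meet_supp (fS x bx) (gS x bx) fvx) => [|[-> ?]]; auto.
apply: (extends_linear_homotopy mm mg _ ext_g) => x a b bx; rewrite flag_meetC => + gb.
have gvx : g x <> f x -> forall t, g x t != 0 -> cmp t v by move=> /nesym ? t; exact: gv.
have [_ _ _ gcmp _] := gS x bx; rewrite cmp_sym.
by case/(flag_meet_supp (gS x bx) (fS x bx) gvx) => [|[-> ?]]; auto.
Qed.

End OneCube.

Lemma cone_fillable j S v : S v -> (forall s, S s -> cmp s v) -> fillable j S.
Proof.
move=> Sv hv n D c rho f _ rho_gt0 mf.
have mv (X : topologicalType) (A : set X) : flag_map cmp S A (fun=> fun t : T => (t == v)%:R : R).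
  exists [:: v] => //; split=> [x _|t]; first by apply: flag_points_vertex; rewrite ?inE.
  by apply: continuous_subspaceT; exact: cst_continuous.
apply: (extends_linear_homotopy rho_gt0 mf (mv _ _)) => [x s t bx fs|].
  case: (eqVneq t v) => [-> _|_]; last by rewrite eqxx.
  by have [ts _ [/(_ x bx)[_ _ fS _ _] _]] := mf; exact/hv/fS.
by exists (fun=> fun t : T => (t == v)%:R).
Qed.

End CubeExtension.

(** * Attaching a cone *)

Section Grid.
Variables (R : realType) (n K : nat) (origin : 'rV[R]_n) (eta : R).
Hypothesis eta_gt0 : 0 < eta.

(* A cell of the cubical grid of mesh [2 * eta] is encoded by the coordinates of its center
   in the grid of mesh [eta]: an odd [m i] is the midpoint of a free edge, an even [m i] a
   fixed coordinate. *)
Local Notation cell := {ffun 'I_n -> 'I_K.+1}.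
Implicit Types (k m : cell) (x : 'rV[R]_n).

Definition cell_center m : 'rV[R]_n := \row_i (origin ord0 i + eta * (m i)%:R).
Definition free_coords m : {set 'I_n} := [set i | odd (m i)]%SET.
Definition cell_cube m := cube (free_coords m) (cell_center m) eta.
Definition cell_boundary m := cube_boundary (free_coords m) (cell_center m) eta.

Definition face k m := [forall i, (k i == m i) ||
  odd (m i) && ((k i == (m i).+1 :> nat) || (m i == (k i).+1 :> nat))].

Lemma faceP k m i : face k m ->
  k i = m i \/ odd (m i) /\ (k i = (m i).+1 :> nat \/ m i = (k i).+1 :> nat).
Proof.
by move/forallP/(_ i)/orP => [/eqP|/andP[oddm /orP[] /eqP]]; [left|right; auto|right; auto].
Qed.

Lemma face_refl m : face m m.
Proof. by apply/forallP => i; rewrite eqxx. Qed.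

Definition grid_coord x i : R := (x ord0 i - origin ord0 i) / eta.

Lemma grid_coord_dist x m i :
  `|x ord0 i - cell_center m ord0 i| = eta * `|grid_coord x i - (m i)%:R|.
Proof.
rewrite /cell_center mxE /grid_coord -{2}[eta]gtr0_norm // -normrM; congr `|_|.
by field; rewrite gt_eqF.
Qed.

Lemma cell_cubeP x m :
  cell_cube m x <-> forall i, `|grid_coord x i - (m i)%:R| <= (odd (m i))%:R.
Proof.
have scale i : (`|x ord0 i - cell_center m ord0 i| <= if i \in free_coords m then eta else 0) =
    (`|grid_coord x i - (m i)%:R| <= (odd (m i))%:R).
  rewrite grid_coord_dist inE -[leRHS](_ : eta * (odd (m i))%:R = _) ?ler_pM2l //.
  by case: odd; rewrite ?mulr1 ?mulr0.
by split=> [/(cube_coordP _ _ _ (ltW eta_gt0)) xm i|xm]; [rewrite -scale|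
  apply/(cube_coordP _ _ _ (ltW eta_gt0)) => i; rewrite scale].
Qed.

Lemma cell_boundaryP x m : cell_boundary m x <->
  cell_cube m x /\ exists2 i, odd (m i) & `|grid_coord x i - (m i)%:R| = 1.
Proof.
have coordE i : `|(x - cell_center m) ord0 i| = eta * `|grid_coord x i - (m i)%:R|.
  by rewrite -grid_coord_dist !mxE.
split=> [[xm norm_eta]|[xm [i _ xi]]]; split=> //.
  have [|i] := @row_norm_attained _ _ (x - cell_center m).
    by rewrite -normr_eq0 norm_eta gt_eqF.
  rewrite norm_eta coordE -[RHS]mulr1 => /(mulfI (lt0r_neq0 eta_gt0)) xi; exists i => //.
  by have /cell_cubeP/(_ i) := xm; rewrite xi; case: odd; rewrite // ler10.
apply/eqP; rewrite eq_le (proj1 xm) -{1}[eta]mulr1 -xi -coordE.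
exact: coord_le_norm.
Qed.

Lemma natr_dist_lt (p q d : nat) : `|p%:R - q%:R| < d%:R :> R -> (p < q + d)%N /\ (q < p + d)%N.
Proof. by rewrite ltr_norml => /andP[? ?]; split; rewrite -(ltr_nat R) natrD; lra. Qed.

Lemma face_cell_cube k m : face k m -> cell_cube k `<=` cell_cube m.
Proof.
move=> km x /cell_cubeP xk; apply/cell_cubeP => i; have := xk i.
have [-> //|[oddm km1]] := faceP i km.
have -> : odd (k i) = false by case: km1; lia.
rewrite oddm normr_le0 subr_eq0 => /eqP ->.
by rewrite [leRHS]mulr1n; case: km1 => ->; rewrite -natr1 ler_norml; apply/andP; split; lra.
Qed.

Lemma interior_face k m x : cell_cube k x -> ~ cell_boundary k x -> cell_cube m x -> face k m.
Proof.
move=> xk nxk /cell_cubeP xm; apply/forallP => i.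
have yk : odd (k i) -> `|grid_coord x i - (k i)%:R| < 1.
  have /cell_cubeP/(_ i) := xk; rewrite le_eqVlt => + oddk; rewrite oddk => /orP[/eqP yk|//].
  by case: nxk; apply/cell_boundaryP; split=> //; exists i.
have /cell_cubeP/(_ i) := xk; have := xm i; move: yk.
set y := grid_coord x i; rewrite -val_eqE /=.
move: (k i : nat) (m i : nat) => p q; case oddp: (odd p); case oddq: (odd q) => /= yp yq yp'.
- have := yp isT; rewrite ltr_norml => /andP[? ?].
  suff /natr_dist_lt[? ?] : `|p%:R - q%:R| < 2%:R :> R by lia.
  by move: yq; rewrite ler_norml ltr_norml => /andP[? ?]; apply/andP; split; lra.
- move: yq; rewrite normr_le0 subr_eq0 => /eqP yq.
  by have := yp isT; rewrite yq distrC => /(natr_dist_lt (d := 1))[? ?]; lia.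
- move: yp'; rewrite normr_le0 subr_eq0 => /eqP yp'; move: yq; rewrite yp' => pq.
  suff /natr_dist_lt[? ?] : `|p%:R - q%:R| < 2%:R :> R by lia.
  by apply: le_lt_trans pq _; rewrite ltr1n.
- move: yp' yq; rewrite !normr_le0 !subr_eq0 => /eqP -> /eqP/(mulrIn (oner_neq0 R)) ->.
  by rewrite eqxx.
Qed.

Lemma face_dim k m : face k m -> k != m -> (#|free_coords k| < #|free_coords m|)%N.
Proof.
move=> km k_neq_m; have [i ki] : exists i, k i != m i.
  by apply/existsP; apply: contraNT k_neq_m; rewrite negb_exists => /forallP km';
     apply/eqP/ffunP => i; apply/eqP; have := km' i; rewrite negbK.
apply/proper_card/properP; split.
  by apply/fintype.subsetP => j; rewrite !inE; case: (faceP j km) => [->|[]].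
have [/eqP|[oddm km1]] := faceP i km; first by rewrite (negPf ki).
by exists i; rewrite inE //; case: km1; lia.
Qed.

Lemma closed_cell_cube m : closed (cell_cube m).
Proof. exact: closed_cube. Qed.

Lemma cell_cube_dist m x y : cell_cube m x -> cell_cube m y -> `|x - y| <= 2 * eta.
Proof.
move=> [xm _] [ym _]; rewrite -(subrK (cell_center m) x) -addrA.
apply: le_trans (ler_normD _ _) _; rewrite distrC in ym.
by rewrite mulrDl mul1r lerD.
Qed.

Hypothesis evenK : ~~ odd K.

Lemma boundary_face m x : cell_boundary m x -> exists2 k, face k m && (k != m) & cell_cube k x.
Proof.
move=> /cell_boundaryP[/cell_cubeP xm [i oddm yi]]; set y := grid_coord x i in yi.
pose k0 := if 0 <= y - (m i)%:R then (m i).+1 else (m i).-1.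
have m0 : (0 < m i)%N by rewrite odd_gt0.
have k0K : (k0 < K.+1)%N by rewrite /k0; case: ifP => _; have := ltn_ord (m i); lia.
have k0m : k0 = (m i).+1 \/ m i = k0.+1 :> nat.
  by rewrite /k0; case: ifP => _; [left|right; rewrite prednK].
have yk0 : y = k0%:R.
  rewrite /k0; case: ifP yi => [y_ge|/negbT]; first by rewrite ger0_norm // -natr1; lra.
  by rewrite -ltNge => y_lt; rewrite ltr0_norm // -subn1 natrB //; lra.
pose k : cell := [ffun j => if j == i then Ordinal k0K else m j].
exists k; last first.
  apply/cell_cubeP => j; rewrite /k ffunE; case: eqVneq => [->|_] //=.
  by rewrite -/y yk0 subrr normr0.
apply/andP; split.
  apply/forallP => j; rewrite /k ffunE; case: (eqVneq j i) => [->|_]; last by rewrite eqxx.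
  by apply/orP; right; rewrite oddm /=; case: k0m => [->|<-]; rewrite eqxx ?orbT.
apply/eqP => /ffunP/(_ i)/(congr1 val); rewrite /k ffunE eqxx /=.
by case: k0m; lia.
Qed.

Section Extension.
Variables (T : eqType) (cmp : rel T) (C : set T).
Implicit Types (L : set cell) (f g : 'rV[R]_n -> T -> R) (s : seq cell).

Definition face_closed L := forall k m, L m -> face k m -> L k.

Lemma extend_over_cell L m f : face_closed L -> ~ L m ->
  fillable R cmp #|free_coords m| C ->
  (forall k, face k m -> k != m -> flag_map cmp C (cell_cube k) f) ->
  exists2 g, (forall k x, L k -> cell_cube k x -> g x = f x) & flag_map cmp C (cell_cube m) g.
Proof.
move=> Lface nLm fillm mf.
have [|h mh hf] := fillm n (free_coords m) (cell_center m) eta f erefl eta_gt0.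
  apply: (@flag_map_closed_cover _ _ _ _ _ _ _ (fun k => face k m && (k != m)) cell_cube).
  - by move=> k _; exact: closed_cell_cube.
  - exact: boundary_face.
  - by move=> k /andP[km k_neq_m]; apply: flag_mapW (mf k km k_neq_m) => // x [].
exists (fun x => if pselect (cell_cube m x) then h x else f x).
  move=> k x Lk xk; case: pselect => //= xm; apply: hf; apply: contrapT => nxm.
  exact/nLm/(Lface _ _ Lk)/(interior_face xm nxm xk).
by apply: eq_flag_map mh => x xm; case: pselect.
Qed.

Lemma extend_over_cells s L f : sorted (relpre (fun m => #|free_coords m|) leq) s ->
  face_closed L -> (forall k m, m \in s -> face k m -> L k \/ k \in s) ->
  (forall m, m \in s -> fillable R cmp #|free_coords m| C) ->
  (forall k m, m \in s -> face k m -> L k -> flag_map cmp C (cell_cube k) f) ->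
  exists2 g, (forall k x, L k -> cell_cube k x -> g x = f x) &
    forall m, m \in s -> flag_map cmp C (cell_cube m) g.
Proof.
elim: s L f => [|m s IH] L f sorted_s Lface s_face fills mf; first by exists f.
have dim_min k : k \in s -> (#|free_coords m| <= #|free_coords k|)%N.
  have /allP := order_path_min (fun _ _ _ => @leq_trans _ _ _) sorted_s; exact.
have m_face k : face k m -> k != m -> L k.
  move=> km k_neq_m; have [//|] := s_face k m (mem_head _ _) km.
  rewrite inE (negPf k_neq_m) /= => /dim_min.
  by rewrite leqNgt face_dim.
have [f1 f1f mf1] : exists2 f1, (forall k x, L k -> cell_cube k x -> f1 x = f x) &
    flag_map cmp C (cell_cube m) f1.
  have [Lm|nLm] := pselect (L m).
    by exists f => //; apply: mf Lm; [exact: mem_head|exact: face_refl].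
  apply: extend_over_cell => //; first exact/fills/mem_head.
  by move=> k km k_neq_m; apply: mf (km) (m_face k km k_neq_m); exact: mem_head.
have [||||| g gf1 mg] := IH (L `|` [set m]) f1.
- exact: path_sorted sorted_s.
- move=> k k' [Lk'|->] kk'; first by left; exact: Lface kk'.
  by have [->|?] := eqVneq k m; [right|left; exact: m_face].
- move=> k k' k's kk'; have [|?|] := s_face k k' _ kk'; first by rewrite inE k's orbT.
    by left; left.
  by rewrite inE => /orP[/eqP ->|?]; [left; right|right].
- by move=> k ks; apply: fills; rewrite inE ks orbT.
- move=> k k' k's kk' [Lk|-> //].
  apply: (@eq_flag_map _ _ _ _ _ _ f) => [x xk|]; first by rewrite (f1f k).
  by apply: mf kk' Lk; rewrite inE k's orbT.
exists g => [k x Lk xk|k]; first by rewrite (gf1 k) ?(f1f k) //; left.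
rewrite inE => /orP[/eqP ->|]; last exact: mg.
by apply: eq_flag_map mf1 => x xm; rewrite (gf1 m) //; right.
Qed.

End Extension.

End Grid.

Section BoundaryCells.
Variables (R : realType) (n N : nat) (D : {set 'I_n}) (c : 'rV[R]_n) (rho : R).
Hypotheses (rho_gt0 : 0 < rho) (N_gt0 : (0 < N)%N).

Let eta := rho / N%:R.
Let K := N.*2.
Let origin : 'rV[R]_n := \row_i (if i \in D then c ord0 i - rho else c ord0 i).
Local Notation cell := {ffun 'I_n -> 'I_K.+1}.
Implicit Types (k m : cell) (x : 'rV[R]_n).

Let N_neq0 : N%:R != 0 :> R. Proof. by rewrite pnatr_eq0 -lt0n. Qed.

Let eta_gt0 : 0 < eta. Proof. by rewrite divr_gt0 ?ltr0n. Qed.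

Definition boundary_cell m :=
  [forall i, (i \notin D) ==> (m i == 0 :> nat)] &&
  [exists i in D, (m i == 0 :> nat) || (m i == K :> nat)].

Lemma boundary_cell_face k m : boundary_cell m -> face k m -> boundary_cell k.
Proof.
move=> /andP[/forallP mD /existsP[i /andP[iD mi]]] km; apply/andP; split.
  apply/forallP => j; apply/implyP => jD; have /eqP mj := implyP (mD j) jD.
  by have [->|[]] := faceP j km; rewrite mj.
apply/existsP; exists i; rewrite iD /=; have [-> //|[]] := faceP i km.
by case/orP: mi => /eqP ->; rewrite ?odd_double.
Qed.

Lemma boundary_cell_dim m : boundary_cell m -> (#|free_coords m| < #|D|)%N.
Proof.
move=> /andP[/forallP mD /existsP[i /andP[iD mi]]]; apply/proper_card/properP; split.
  by apply/fintype.subsetP => j; rewrite inE; apply: contraTT => /(implyP (mD j))/eqP ->.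
by exists i; rewrite // inE; case/orP: mi => /eqP ->; rewrite ?odd_double.
Qed.

Lemma grid_coord_dist_center x i : i \in D ->
  `|x ord0 i - c ord0 i| = eta * `|grid_coord origin eta x i - N%:R|.
Proof.
move=> iD; rewrite /grid_coord mxE iD -{1}[eta]gtr0_norm // -normrM; congr `|_|.
by rewrite /eta; field; rewrite N_neq0 gt_eqF.
Qed.

Lemma grid_coord_off x i : i \notin D -> x ord0 i = c ord0 i -> grid_coord origin eta x i = 0.
Proof. by move=> /negPf iD xi; rewrite /grid_coord mxE iD xi subrr mul0r. Qed.

Lemma cube_grid_coordP x : cube D c rho x <-> forall i,
  if i \in D then 0 <= grid_coord origin eta x i <= K%:R else x ord0 i == c ord0 i.
Proof.
suff coordE i : (`|x ord0 i - c ord0 i| <= if i \in D then rho else 0) =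
    if i \in D then 0 <= grid_coord origin eta x i <= K%:R else x ord0 i == c ord0 i.
  by split=> [/(cube_coordP _ _ _ (ltW rho_gt0)) xc i|xc]; [rewrite -coordE|
    apply/(cube_coordP _ _ _ (ltW rho_gt0)) => i; rewrite coordE].
case: ifPn => [iD|_]; last by rewrite normr_le0 subr_eq0.
rewrite grid_coord_dist_center // -[leRHS](divfK N_neq0 rho) ler_pM2l // ler_norml.
by rewrite /K -addnn natrD; apply/andP/andP => -[? ?]; split; lra.
Qed.

Lemma boundary_cell_sub m : boundary_cell m ->
  cell_cube origin eta m `<=` cube_boundary D c rho.
Proof.
move=> /andP[/forallP mD /existsP[i /andP[iD mi]]] x /(cell_cubeP origin eta_gt0) xm.
have xc : cube D c rho x.
  apply/cube_grid_coordP => j; have := xm j; case: ifPn => jD.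
    have odd_le : (odd (m j) <= m j)%N by case: (m j : nat) => // p; case: odd.
    have odd_leK : (m j + odd (m j) <= K)%N.
      by move: (ltn_ord (m j)); move: (m j : nat) => p; rewrite /K; case oddp: (odd p) => /=; lia.
    move: odd_le odd_leK; rewrite -!(ler_nat R) natrD ler_norml => ? ? /andP[? ?].
    by apply/andP; split; lra.
  have /eqP -> := implyP (mD j) jD; rewrite subr0 normr_le0 mulf_eq0 invr_eq0 (gt_eqF eta_gt0) orbF.
  by rewrite mxE (negPf jD) subr_eq0.
split=> //; apply/eqP; rewrite eq_le (proj1 xc) /=.
have <- : `|x ord0 i - c ord0 i| = rho.
  have yi : grid_coord origin eta x i = (m i)%:R.
    apply/eqP; rewrite -subr_eq0 -normr_le0; apply: le_trans (xm i) _.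
    by case/orP: mi => /eqP ->; rewrite ?odd_double.
  rewrite grid_coord_dist_center // -[RHS](divfK N_neq0 rho) yi; congr (_ * _).
  case/orP: mi => /eqP ->; first by rewrite sub0r normrN ger0_norm.
  by rewrite /K -addnn natrD addrK ger0_norm.
by have := coord_le_norm (x - c) i; rewrite !mxE.
Qed.

Lemma near_grid_vertex (y : R) : 0 <= y <= K%:R ->
  exists p : 'I_K.+1, `|y - p%:R| <= (odd p)%:R /\ forall q, ~~ odd q -> y = q%:R -> p = q :> nat.
Proof.
move=> /andP[y_ge0 yK]; have /andP[trunc_le] := truncn_itv y_ge0.
move: (Num.truncn y) => j in trunc_le *; rewrite -natr1 => lt_trunc.
have jK : (j < K.+1)%N by rewrite ltnS -(ler_nat R); exact: le_trans yK.
have jq q : y = q%:R -> j = q.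
  by move=> yq; move: trunc_le lt_trunc; rewrite yq natr1 ler_nat ltr_nat; lia.
have [oddj|evenj] := boolP (odd j).
  by exists (Ordinal jK); split=> [|q _ /jq //]; rewrite /= oddj ger0_norm ?subr_ge0 //=; lra.
have [yj|y_neq_j] := eqVneq y j%:R.
  by exists (Ordinal jK); split=> [|q _ /jq //]; rewrite /= yj subrr normr0.
have j_lt_y : j%:R < y by rewrite lt_neqAle eq_sym y_neq_j.
have j1K : (j.+1 < K.+1)%N by rewrite ltnS -(ltr_nat R); exact: lt_le_trans yK.
exists (Ordinal j1K); split=> [|q _ /[dup] /jq <- yj]; last by rewrite yj eqxx in y_neq_j.
by rewrite /= evenj [leRHS]mulr1n -natr1 ler_norml; apply/andP; split; lra.
Qed.

Lemma boundary_cell_cover x : cube_boundary D c rho x ->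
  exists2 m, boundary_cell m & cell_cube origin eta m x.
Proof.
move=> [/cube_grid_coordP xc x_norm]; pose y := grid_coord origin eta x.
have /choice[m mP] i : exists p : 'I_K.+1, `|y i - p%:R| <= (odd p)%:R /\
    forall q, ~~ odd q -> y i = q%:R -> p = q :> nat.
  apply: near_grid_vertex; have := xc i; case: ifPn => // iD xi.
  by move/eqP: xi => xi; rewrite /y grid_coord_off // lexx ler0n.
exists (finfun m); last by apply/(cell_cubeP origin eta_gt0) => i; rewrite ffunE; case: (mP i).
have [|i xi] := @row_norm_attained _ _ (x - c); first by rewrite -normr_eq0 x_norm gt_eqF.
have {}xi : `|x ord0 i - c ord0 i| = rho by rewrite -x_norm -xi !mxE.
have iD : i \in D.
  apply: contraT => iD; have := xc i; rewrite (negPf iD) => /eqP xci.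
  by move: xi; rewrite xci subrr normr0 => rho0; move: rho_gt0; rewrite -rho0 ltxx.
apply/andP; split.
  apply/forallP => j; apply/implyP => jD; rewrite ffunE; apply/eqP; apply: (proj2 (mP j)) => //.
  by apply: grid_coord_off => //; have := xc j; rewrite (negPf jD) => /eqP.
apply/existsP; exists i; rewrite iD ffunE /=.
move: xi; rewrite grid_coord_dist_center // -[X in _ = X](divfK N_neq0 rho).
move=> /(mulfI (lt0r_neq0 eta_gt0))/eqP; rewrite eqr_norml => /andP[yi _].
have even_q q : ~~ odd q -> y i = q%:R -> m i == q :> nat by move=> oq yq; apply/eqP/(proj2 (mP i)).
apply/orP; case/orP: yi => /eqP yi; [right|left]; apply: even_q; rewrite ?odd_double //.
  by rewrite /K -addnn natrD -{1}yi subrK.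
by apply/eqP; rewrite -(subrK N%:R (y i)) yi addrC subrr.
Qed.

Section PushToLink.
Variables (T : eqType) (cmp : rel T) (S0 : set T) (v : T) (f f1 : 'rV[R]_n -> T -> R).
Hypotheses (mf : flag_map cmp (v |` S0) (cube_boundary D c rho) f)
  (mf1 : flag_map cmp (v |` S0) (cube_boundary D c rho) f1)
  (f1_supp : forall x t, cube_boundary D c rho x -> f1 x t != 0 -> f x t != 0)
  (f1_near : forall x y, cube_boundary D c rho x -> cube_boundary D c rho y ->
     `|x - y| <= 2 * eta -> f1 x v != 0 -> f y v != 0).

Let vertex_free : set cell := [set m | forall x, cell_cube origin eta m x -> f1 x v = 0].

Let off_vertex_S0 x t : cube_boundary D c rho x -> f1 x v = 0 -> f1 x t != 0 -> S0 t.
Proof.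
move=> bx f1v f1t; have [ts _ [/(_ x bx)[_ _ f1S _ _] _]] := mf1.
by case: (f1S t f1t) => // tv; rewrite tv f1v eqxx in f1t.
Qed.

Let star_cell m x : boundary_cell m -> ~ vertex_free m -> cell_cube origin eta m x -> f x v != 0.
Proof.
move=> bm nvm xm; have [y [ym f1y]] : exists y, cell_cube origin eta m y /\ f1 y v != 0.
  by apply: contrapT => nex; apply: nvm => y ym; apply: contrapT => /eqP f1y; apply: nex; exists y.
have sub := boundary_cell_sub bm.
exact: f1_near (sub _ ym) (sub _ xm) (cell_cube_dist ym xm) f1y.
Qed.

Let link_face k m : boundary_cell m -> ~ vertex_free m -> face k m -> vertex_free k ->
  flag_map cmp (link cmp S0 v) (cell_cube origin eta k) f1.
Proof.
move=> bm nvm km vk; have sub := face_cell_cube (origin := origin) eta_gt0 km.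
have [ts uts [f1S f1c]] := mf1; exists ts => //; split=> [x xk|t]; last first.
  apply: continuous_subspaceW (f1c t) => x /sub xm; exact: boundary_cell_sub bm _ xm.
have bx := boundary_cell_sub bm (sub _ xk); have [f1_ge0 f10 _ f1cmp f11] := f1S x bx.
split=> // t f1t; split; first exact: off_vertex_S0 (vk _ xk) f1t.
have [ts' _ [/(_ x bx)[_ _ _ fcmp _] _]] := mf.
exact: fcmp (f1_supp bx f1t) (star_cell bm nvm (sub _ xk)).
Qed.

(* Keep [f1] on the grid cells where it avoids [v]. On each of the other cells [f] stays in the open
   star of [v], and [f1] is replaced there by maps to the link, cell by cell. *)
Lemma push_to_link : (forall j, (j < #|D|)%N -> fillable R cmp j (link cmp S0 v)) ->
  exists2 g, flag_map cmp S0 (cube_boundary D c rho) g &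
    forall x, cube_boundary D c rho x -> f1 x <> g x ->
      f x v != 0 /\ forall t, g x t != 0 -> cmp t v.
Proof.
move=> fill_link; pose le_dim := relpre (fun m : cell => #|free_coords m|) leq.
pose L := [set m : cell | boundary_cell m /\ vertex_free m].
pose s := sort le_dim [seq m <- enum {: cell} | boundary_cell m && ~~ `[< vertex_free m >]].
have sP m : m \in s <-> boundary_cell m /\ ~ vertex_free m.
  rewrite mem_sort mem_filter mem_enum andbT; split=> [/andP[bm /asboolP]|[bm nvm]] //.
  by rewrite bm; apply/asboolP.
have [||||||g gf1 mg] := @extend_over_cells _ _ _ origin eta eta_gt0 _ T cmp (link cmp S0 v) s L f1.
- by rewrite odd_double.
- by apply: sort_sorted => ? ?; exact: leq_total.
- move=> k m [bm vm] km; split; first exact: boundary_cell_face km.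
  by move=> x xk; exact/vm/(face_cell_cube eta_gt0 km).
- move=> k m /sP[bm _] km; have bk := boundary_cell_face bm km.
  by have [?|?] := pselect (vertex_free k); [left|right; apply/sP].
- by move=> m /sP[bm _]; exact/fill_link/boundary_cell_dim.
- by move=> k m /sP[bm nvm] km [_ vk]; exact: link_face bm nvm km vk.
exists g => [|x bx f1g].
  apply: (@flag_map_closed_cover _ _ _ _ _ _ _ boundary_cell (@cell_cube _ _ _ origin eta)).
  - by move=> m _; exact: closed_cell_cube.
  - exact: boundary_cell_cover.
  move=> m bm; have [vm|nvm] := pselect (vertex_free m); last first.
    by apply: flag_mapW (mg m _) => [t []//|x []//|]; apply/sP.
  apply: (@eq_flag_map _ _ _ _ _ _ f1) => [x [_ xm]|]; first by rewrite (gf1 m).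
  have [ts uts [f1S f1c]] := mf1; exists ts => //; split=> [x [bx xm]|t].
    have [? ? _ ? ?] := f1S x bx; split=> // t; exact: off_vertex_S0 bx (vm x xm).
  by apply: continuous_subspaceW (f1c t) => x [].
have [m bm xm] := boundary_cell_cover bx.
have [vm|nvm] := pselect (vertex_free m); first by case: f1g; rewrite (gf1 m).
split=> [|t gt]; first exact: star_cell bm nvm xm.
have [|ts _ [/(_ x xm)[_ _ gS _ _] _]] := mg m; first exact/sP.
by have [] := gS t gt.
Qed.

End PushToLink.

End BoundaryCells.

Section Attaching.
Variables (R : realType) (T : eqType) (cmp : rel T).
Hypotheses (cmp_refl : reflexive cmp) (cmp_sym : symmetric cmp).
Implicit Types (S : set T) (v : T).

Section PushOffVertex.
Variables (S : set T) (v : T).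
Implicit Types (ts : seq T) (a : T -> R).

Definition rest_scale a : R := Num.max (1 - a v) 2^-1.

(* Pushes mass away from [v], all of it when [a v <= 2^-1]: the coordinate at [v] becomes
   [max 0 (2 * a v - 1)]. *)
Definition push_off a : T -> R :=
  fun t => if t == v then Num.max 0 (2 * a v - 1) else a t / rest_scale a.

Lemma rest_scale_gt0 a : 0 < rest_scale a.
Proof. by rewrite lt_max invr_gt0 ltr0n orbT. Qed.

Lemma push_off_supp a t : push_off a t != 0 -> a t != 0.
Proof.
rewrite /push_off; case: (eqVneq t v) => [->|_]; apply: contraNneq => ->; last by rewrite mul0r.
by apply/eqP/max_idPl; lra.
Qed.

Lemma push_off_vertex a : push_off a v != 0 -> 2^-1 < a v.
Proof.
by rewrite /push_off eqxx; case: (ltP 0 (2 * a v - 1)) => [? _|_]; [lra|rewrite eqxx].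
Qed.

Lemma push_off_sum ts a : uniq ts -> v \in ts -> \sum_(t <- ts) a t = 1 ->
  \sum_(t <- ts) push_off a t = 1.
Proof.
move=> uts v_ts a1; have rest : \sum_(t <- rem v ts) a t = 1 - a v.
  by move: a1; rewrite (big_rem v) //= => <-; ring.
rewrite (big_rem v) //= {1}/push_off eqxx big_seq (eq_bigr (fun t => a t / rest_scale a)) => [|t].
  rewrite -big_seq -mulr_suml rest /rest_scale; case: (leP (1 - a v) 2^-1) => av.
    by rewrite (max_idPr _) ?invrK; lra.
  by rewrite (max_idPl _) ?divff ?add0r // ?gt_eqF //; lra.
by rewrite mem_rem_uniq // inE /push_off => /andP[/negPf ->].
Qed.

Lemma flag_points_push_off ts a : uniq ts -> v \in ts -> flag_points cmp S ts a ->
  flag_points cmp S ts (push_off a).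
Proof.
move=> uts v_ts [a_ge0 a0 aS acmp a1]; split.
- move=> t; rewrite /push_off; case: eqP => _; first by rewrite le_max lexx.
  by rewrite divr_ge0 // ltW ?rest_scale_gt0.
- by move=> t t_ts; apply/eqP; apply: contraT => /push_off_supp; rewrite a0 ?eqxx.
- by move=> t /push_off_supp/aS.
- by move=> s t /push_off_supp as0 /push_off_supp; exact: acmp.
- exact: push_off_sum.
Qed.

Lemma flag_map_push_off (X : topologicalType) (A : set X) (f : X -> T -> R) :
  flag_map cmp S A f -> flag_map cmp S A (push_off \o f).
Proof.
move=> [ts0 uts0 [fS fc]]; exists (undup (v :: ts0)); first exact: undup_uniq.
have [uts v_ts] : uniq (undup (v :: ts0)) /\ v \in undup (v :: ts0).
  by rewrite undup_uniq mem_undup mem_head.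
split=> [x /fS fx|t x].
  apply: flag_points_push_off => //; apply: flag_pointsW fx => // t t_ts.
  by rewrite mem_undup inE t_ts orbT.
have cst_c (a : R) : {within A, continuous (fun=> a)}.
  by apply: continuous_subspaceT; exact: cst_continuous.
rewrite /push_off /=; case: eqP => _; first apply: within_continuous_max => // y.
  by apply: cvgB (cvg_cst _); apply: cvgM; [exact: cvg_cst|exact: fc].
apply: cvgM; first exact: fc.
apply: cvgV; first by rewrite gt_eqF // rest_scale_gt0.
have : {within A, continuous (rest_scale \o f)}; last exact.
by apply: within_continuous_max => // y; apply: cvgB; [exact: cvg_cst|exact: fc].
Qed.

End PushOffVertex.

Lemma fine_mesh (rho d : R) : 0 < rho -> 0 < d -> exists2 N, (0 < N)%N & 2 * (rho / N%:R) < d.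
Proof.
move=> rho_gt0 d_gt0; exists (Num.bound (2 * rho / d)).+1 => //.
rewrite mulrA ltr_pdivrMr ?ltr0n // [ltRHS]mulrC -ltr_pdivrMr //.
apply: lt_trans (archi_boundP _) _; last by rewrite ltr_nat.
by rewrite divr_ge0 ?mulr_ge0 // ltW.
Qed.

Lemma attach_vertex_fillable N S0 v :
  (forall j, (j < N)%N -> fillable R cmp j (link cmp S0 v)) ->
  (forall j, (j <= N)%N -> fillable R cmp j S0) ->
  forall j, (j <= N)%N -> fillable R cmp j (v |` S0).
Proof.
move=> fill_link fill_S0 j jN n D c rho f Dj rho_gt0 mf.
have mf1 := flag_map_push_off v mf.
have [d d_gt0 unif] : exists2 d : R, 0 < d & forall x y, cube_boundary D c rho x ->
    cube_boundary D c rho y -> `|x - y| < d -> `|f x v - f y v| < 2^-1.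
  have fvc : {within cube_boundary D c rho, continuous (f^~ v : _ -> R^o)}.
    by have [ts _ [_]] := mf; exact.
  have half_gt0 : 0 < 2^-1 :> R by rewrite invr_gt0.
  have [d d_gt0 unif] :=
    compact_uniformly_continuous (@compact_cube_boundary _ _ D c rho) fvc half_gt0.
  by exists d => // x y bx by_ xy; have := unif x y bx by_; rewrite mx_norm_ball => /(_ xy).
have [N' N'_gt0 mesh] := fine_mesh rho_gt0 d_gt0.
have f1_supp x t : cube_boundary D c rho x -> push_off v (f x) t != 0 -> f x t != 0.
  by move=> _; exact: push_off_supp.
have [|j' j'D|g mg f1g] := push_to_link rho_gt0 N'_gt0 mf mf1 f1_supp.
- move=> x y bx by_ xy /push_off_vertex fx.
  have := unif x y bx by_ (le_lt_trans xy mesh); rewrite ltr_norml => /andP[_ fxy].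
  by rewrite gt_eqF //; lra.
- by apply: fill_link; apply: leq_trans j'D _; rewrite Dj.
apply: (extends_linear_homotopy cmp_sym rho_gt0 mf mf1) => [x s t bx fs /(f1_supp x t bx) ft|].
  by have [ts _ [/(_ x bx)[_ _ _ fcmp _] _]] := mf; exact: fcmp.
have S0S : S0 `<=` v |` S0 by move=> t; right.
apply: (extends_in_star cmp_refl cmp_sym rho_gt0 (v := v) (g := g)) => //.
- by left.
- exact: flag_mapW mg.
- move=> x t bx /(f1g x bx)[fv _] /(f1_supp x t bx) ft.
  by have [ts _ [/(_ x bx)[_ _ _ fcmp _] _]] := mf; exact: fcmp.
- by move=> x t bx /(f1g x bx)[_ ]; exact.
- exact: extends_to_cubeW S0S (fill_S0 j jN _ _ _ _ _ Dj rho_gt0 mg).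
Qed.

Lemma attach_vertices_fillable N S0 (vs : seq T) :
  (forall u v, u \in vs -> v \in vs -> cmp u v -> u = v) ->
  (forall v j, v \in vs -> (j < N)%N -> fillable R cmp j (link cmp S0 v)) ->
  (forall j, (j <= N)%N -> fillable R cmp j S0) ->
  forall j, (j <= N)%N -> fillable R cmp j (S0 `|` [set` vs]).
Proof.
move=> anti fill_link fill_S0; elim: vs anti fill_link => [|v vs IH] anti fill_link.
  by have -> : S0 `|` [set` [::]] = S0 by apply/seteqP; split=> t; [case|left].
have {}IH j : (j <= N)%N -> fillable R cmp j (S0 `|` [set` vs]).
  apply: IH => [u w u_vs w_vs|w i w_vs]; first by apply: anti; rewrite inE ?u_vs ?w_vs orbT.
  by apply: fill_link; rewrite inE w_vs orbT.
have -> : S0 `|` [set` v :: vs] = v |` (S0 `|` [set` vs]).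
  apply/seteqP; split=> t /=; rewrite inE.
    by case=> [?|/orP[/eqP ->|?]]; [right; left|left|right; right].
  by case=> [->|[?|->]]; [right; rewrite eqxx|left|right; rewrite orbT].
have [v_vs|v_vs] := boolP (v \in vs).
  have -> : v |` (S0 `|` [set` vs]) = S0 `|` [set` vs]; last exact: IH.
  by apply/seteqP; split=> t; [case=> // ->; right|right].
apply: attach_vertex_fillable => // j jN.
have -> : link cmp (S0 `|` [set` vs]) v = link cmp S0 v; last exact: fill_link (mem_head _ _) jN.
apply/seteqP; split=> t [St tv]; split=> //; last by left.
case: St => // t_vs; have /= tv' : t = v by apply: anti => //; rewrite inE ?eqxx // t_vs orbT.
by move: t_vs; rewrite /= tv' (negPf v_vs).
Qed.

Lemma attach_fillable N S0 S : S0 `<=` S ->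
  (forall u v, S u -> S v -> ~ S0 u -> ~ S0 v -> cmp u v -> u = v) ->
  (forall v j, S v -> ~ S0 v -> (j < N)%N -> fillable R cmp j (link cmp S0 v)) ->
  (forall j, (j <= N)%N -> fillable R cmp j S0) ->
  forall j, (j <= N)%N -> fillable R cmp j S.
Proof.
move=> S0S anti fill_link fill_S0 j jN n D c rho f Dj rho_gt0 [ts uts [fS fc]].
pose vs := [seq t <- ts | `[< S t /\ ~ S0 t >]].
have vsP t : t \in vs -> S t /\ ~ S0 t by rewrite mem_filter => /andP[/asboolP].
have mf : flag_map cmp (S0 `|` [set` vs]) (cube_boundary D c rho) f.
  exists ts => //; split=> // x /fS[f_ge0 f0 fS' fcmp f1]; split=> // t ft.
  have [?|nS0t] := pselect (S0 t); first by left.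
  right=> /=; rewrite mem_filter; apply/andP; split; first by apply/asboolP; split=> //; exact: fS'.
  by apply: contraNT ft => /f0 ->.
apply: (@extends_to_cubeW _ _ _ _ _ _ _ (S0 `|` [set` vs])).
  by move=> t [/S0S|/vsP[]].
apply: (attach_vertices_fillable _ _ fill_S0 jN Dj rho_gt0 mf).
  by move=> u v /vsP[? ?] /vsP[? ?]; exact: anti.
by move=> v i /vsP[? ?]; exact: fill_link.
Qed.

End Attaching.

(** * Spheres in the realization of a poset *)

Section Chains.
Variables (T : eqType) (le : rel T).
Hypotheses (le_refl : reflexive le) (le_trans : transitive le) (le_anti : antisymmetric le).
Implicit Types (S : set T) (c ts : seq T) (a : T -> RR).

Definition comparability : rel T := fun x y => le x y || le y x.

Lemma comparability_refl : reflexive comparability.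
Proof. by move=> x; rewrite /comparability le_refl. Qed.

Lemma comparability_sym : symmetric comparability.
Proof. by move=> x y; rewrite /comparability orbC. Qed.

Lemma plt_trans : transitive (plt le).
Proof.
move=> y x z /andP[xy x_neq_y] /andP[yz _]; rewrite /plt (le_trans xy yz) /=.
by apply: contraNneq x_neq_y => xz; apply/eqP/le_anti; rewrite xy xz yz.
Qed.

Lemma chain_uniq S c : is_chain le S c -> uniq c.
Proof.
move=> [sorted_c _]; apply: sorted_uniq sorted_c; first exact: plt_trans.
by move=> x; rewrite /plt eqxx andbF.
Qed.

Lemma chain_comparable S c x y : is_chain le S c -> x \in c -> y \in c -> comparability x y.
Proof.
move=> [sorted_c _]; elim: c sorted_c => // t c IH /= path_c.
have /allP le_t := order_path_min plt_trans path_c.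
rewrite !inE => /orP[/eqP->|xc] /orP[/eqP->|yc]; first exact: comparability_refl.
- by rewrite /comparability; case/andP: (le_t _ yc) => ->.
- by rewrite /comparability; case/andP: (le_t _ xc) => ->; rewrite orbT.
- by apply: IH => //; exact: path_sorted path_c.
Qed.

Lemma sort_chain S c : uniq c -> (forall t, t \in c -> S t) ->
  (forall s t, s \in c -> t \in c -> comparability s t) -> is_chain le S (sort le c).
Proof.
move=> uc cS ccmp; split; last by move=> t; rewrite mem_sort; exact: cS.
have sorted_le : sorted le (sort le c).
  by apply: (@sort_sorted_in _ (mem c)) => [s t|]; [exact: ccmp|exact/allP].
rewrite (sorted_pairwise plt_trans).
rewrite -[pairwise _ _]/(pairwise [rel x y | le x y && (x != y)] (sort le c)).
by rewrite pairwise_relI -uniq_pairwise sort_uniq uc andbT -(sorted_pairwise le_trans).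
Qed.

Definition supp_chain a ts := sort le [seq t <- ts | a t != 0].

Lemma supp_chain_neq0 a ts t : t \in supp_chain a ts -> a t != 0.
Proof. by rewrite mem_sort mem_filter => /andP[]. Qed.

Section FlagPoint.
Variables (S : set T) (ts : seq T) (a : T -> RR).
Hypotheses (uts : uniq ts) (aS : flag_points comparability S ts a).

Lemma supp_chain_out t : t \notin supp_chain a ts -> a t = 0.
Proof.
have [_ a0 _ _ _] := aS; rewrite mem_sort mem_filter negb_and negbK => /orP[/eqP //|].
exact: a0.
Qed.

Lemma supp_chain_sum : \sum_(t <- supp_chain a ts) a t = 1.
Proof.
have [_ _ _ _ <-] := aS; apply/esym/sum_sub_uniq => // [|t|t /supp_chain_out //].
  by rewrite sort_uniq filter_uniq.
by rewrite mem_sort mem_filter => /andP[].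
Qed.

Lemma supp_chainP : is_chain le S (supp_chain a ts).
Proof.
have [_ _ a_S a_cmp _] := aS; apply: sort_chain; first exact: filter_uniq.
  by move=> t; rewrite mem_filter => /andP[/a_S].
by move=> s t; rewrite !mem_filter => /andP[as_ _] /andP[at_ _]; exact: a_cmp.
Qed.

Lemma flag_points_realization : realization le S a.
Proof.
exists (supp_chain a ts); split; [exact: supp_chainP|exact: supp_chain_out| |exact: supp_chain_sum].
by case: aS.
Qed.

End FlagPoint.

Lemma realization_flag_points S a : realization le S a ->
  exists2 ts, uniq ts & flag_points comparability S ts a.
Proof.
move=> [c [chain_c a_out a_ge0 a1]]; exists c; first exact: chain_uniq chain_c.
have in_c t : a t != 0 -> t \in c by apply: contraNT => /a_out ->.
split=> // [t /in_c|s t /in_c sc /in_c tc]; first exact: (proj2 chain_c).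
exact: chain_comparable chain_c sc tc.
Qed.

End Chains.

Section BarycentricMap.
Variable T : eqType.
Implicit Types (c : seq T) (a : T -> RR).

Definition bary_coords c a : 'rV[RR]_(size c) := \row_(i < size c) a (tnth (in_tuple c) i).

Lemma bary_coordsK c a : uniq c -> (forall t, t \notin c -> a t = 0) -> bary (bary_coords c a) = a.
Proof.
move=> uc a_out; apply/funext => t; rewrite /bary.
under eq_bigr do rewrite mxE.
rewrite (eq_bigl (fun i => tnth (in_tuple c) i == t)) => [|i]; last by rewrite (tnth_nth t).
rewrite -(big_tnth _ _ c (fun s => s == t)) big_mkcond /=.
case: (boolP (t \in c)) => tc; last first.
  rewrite a_out // big_seq big1 // => s sc; case: eqP => // st.
  by rewrite st (negPf tc) in sc.
rewrite (big_rem t) //= eqxx big_seq big1 ?addr0 // => s.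
by rewrite mem_rem_uniq // inE => /andP[/negPf ->].
Qed.

Lemma std_simplex_bary_coords c a :
  (forall t, 0 <= a t) -> \sum_(t <- c) a t = 1 -> std_simplex (bary_coords c a).
Proof.
move=> a_ge0 a1; split=> [i|]; first by rewrite mxE.
by under eq_bigr do rewrite mxE; rewrite -(big_tnth _ _ c xpredT).
Qed.

Lemma bary_coord_continuous c t : continuous (fun l : 'rV[RR]_(size c) => bary l t).
Proof.
exact: (@continuous_sum_coord (RR : realType)).
Qed.

End BarycentricMap.

Section AvoidingPoints.
Variables (T : eqType) (le : rel T).

Lemma coh_open_avoid (S D : set T) (alpha : T -> T -> RR) : (forall t, D t -> alpha t t != 0) ->
  coh_open le S [set a | forall t, D t -> a <> alpha t].
Proof.
move=> alpha_neq0 b _; pose bt := tnth (in_tuple b).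
exists (~` \bigcup_(i in [set i | D (bt i)]) [set l : 'rV_(size b) | bary l = alpha (bt i)]).
split; last first.
  apply/seteqP; split=> l [sl avoid]; split=> //; first by move=> [i Di /= li]; exact: avoid Di li.
  move=> t Dt lt; have /seq_tnthP[i ti] : t \in b.
    have := alpha_neq0 t Dt; apply: contraNT => tb; rewrite -lt /bary big1 // => i /eqP it.
    by rewrite -{1}it mem_nth in tb.
  by apply: avoid; exists i; rewrite /= /bt -ti.
apply: closed_openC; apply: closed_bigcup => [|i _]; first exact: finite_finset.
move: (bt i) => t.
have -> : [set l : 'rV_(size b) | bary l = alpha t] =
    \bigcap_(s in setT) [set l : 'rV_(size b) | bary l s = alpha t s].
  apply/seteqP; split=> [l /= lt s _ /=|l ls]; first by rewrite lt.
  by apply/funext => s; exact: ls.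
apply: closed_bigI => s _.
by apply: (preimage_closed _ (@closed_eq _ (alpha t s))) => l _; exact: bary_coord_continuous.
Qed.

End AvoidingPoints.

Section CoherentContinuity.
Variables (T : eqType) (le : rel T) (X : topologicalType).
Hypotheses (le_trans : transitive le) (le_anti : antisymmetric le).
Implicit Types (S : set T) (K : set X) (f : X -> T -> RR) (O : set (T -> RR)).

Lemma within_continuous_bary_coords K f (c : seq T) : (forall t, {within K, continuous f^~ t}) ->
  {within K, continuous (fun x => bary_coords c (f x))}.
Proof.
move=> fc; apply: within_continuous_row => i.
have -> : (fun x => bary_coords c (f x) ord0 i) = f^~ (tnth (in_tuple c) i); last exact: fc.
by apply/funext => x; rewrite mxE.
Qed.

Lemma coh_open_simplex S O c : is_chain le S c -> coh_open le S O ->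
  exists2 V, open V & forall a : T -> RR, (forall t, 0 <= a t) ->
    (forall t, t \notin c -> a t = 0) -> \sum_(t <- c) a t = 1 -> O a <-> V (bary_coords c a).
Proof.
move=> chain_c /(_ c chain_c)[V [openV OV]]; exists V => // a a_ge0 a_out a1.
have sa := std_simplex_bary_coords a_ge0 a1.
rewrite -{1}(bary_coordsK (chain_uniq le_trans le_anti chain_c) a_out); split=> [Oa|Va].
  by suff [] : (@std_simplex _ `&` V) (bary_coords c a) by []; rewrite -OV.
by suff [] : (@std_simplex _ `&` (@bary _ c @^-1` O)) (bary_coords c a) by []; rewrite OV.
Qed.

Lemma near_same_support S K f ts O x c : uniq ts ->
  (forall y, K y -> flag_points (comparability le) S ts (f y)) ->
  (forall t, {within K, continuous f^~ t}) -> coh_open le S O -> K x -> O (f x) ->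
  \forall y \near x, K y -> supp_chain le (f y) ts = c -> O (f y).
Proof.
move=> uts fS fc openO Kx Ox.
have [chain_c|not_chain] := pselect (is_chain le S c); last first.
  by apply: nearW => y Ky yc; case: not_chain; rewrite -yc; exact: supp_chainP uts (fS y Ky).
have [[t ft tc]|fx_out] := pselect (exists2 t, f x t != 0 & t \notin c).
  have near_neq0 : nbhs (f x t) [set z : RR | z != 0].
    have -> : [set z : RR | z != 0] = ~` [set z | z = 0] by apply/seteqP; split=> z /= /eqP.
    apply: open_nbhs_nbhs; split; [exact/closed_openC/closed_eq|exact/eqP].
  have := within_continuous_near (fc t) Kx near_neq0.
  apply: filterS => y + Ky yc => /(_ Ky) /=.
  by rewrite (supp_chain_out (fS y Ky)) ?yc ?eqxx.
have {}fx_out t : t \notin c -> f x t = 0.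
  by move=> tc; apply: contrapT => /eqP ft; apply: fx_out; exists t.
have [V openV OV] := coh_open_simplex chain_c openO.
have Vx : V (bary_coords c (f x)).
  have [fx_ge0 _ _ _ _] := fS x Kx; apply/OV => //.
  rewrite -(supp_chain_sum uts (fS x Kx)); apply: sum_sub_uniq.
  - by rewrite sort_uniq filter_uniq.
  - exact: chain_uniq chain_c.
  - by move=> t /supp_chain_neq0; apply: contraNT => /fx_out ->.
  - by move=> t; exact: supp_chain_out (fS x Kx) t.
have nbhsV := open_nbhs_nbhs (conj openV Vx).
have := within_continuous_near (within_continuous_bary_coords fc) Kx nbhsV.
apply: filterS => y + Ky yc => /(_ Ky) Vy; apply/OV => //; first by case: (fS y Ky).
  by move=> t; rewrite -yc; exact: supp_chain_out (fS y Ky) t.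
by rewrite -yc; exact: supp_chain_sum uts (fS y Ky).
Qed.

Lemma flag_map_coh_continuous S K f O x : flag_map (comparability le) S K f ->
  coh_open le S O -> K x -> O (f x) -> \forall y \near x, K y -> O (f y).
Proof.
move=> [ts uts [fS fc]] openO Kx Ox; have : \forall y \near x, forall b : (size ts).-tuple bool,
    K y -> supp_chain le (f y) ts = sort le (mask b ts) -> O (f y).
  by apply: filter_forall => b; exact: near_same_support uts fS fc openO Kx Ox.
apply: filterS => y Oy Ky; apply: (Oy (map_tuple (fun t => f y t != 0) (in_tuple ts)) Ky).
by rewrite /supp_chain filter_mask.
Qed.

End CoherentContinuity.

Section FlagMapsOfRows.
Variables (T : eqType) (le : rel T) (m : nat).
Hypotheses (le_refl : reflexive le) (le_trans : transitive le) (le_anti : antisymmetric le).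
Implicit Types (S : set T) (K : set 'rV[RR]_m) (f : 'rV[RR]_m -> T -> RR).

Lemma flag_map_cont_into S K f : flag_map (comparability le) S K f -> cont_into le S K f.
Proof.
move=> mf; split=> [x Kx|O openO].
  by have [ts uts [fS _]] := mf; exact: flag_points_realization uts (fS x Kx).
exists (interior [set y | K y -> O (f y)]); split; first exact: open_interior.
apply/seteqP; split=> y [Ky Oy]; split=> //.
  exact (flag_map_coh_continuous le_trans le_anti mf openO Ky Oy).
exact: nbhs_singleton Oy Ky.
Qed.

Lemma cont_into_coord S K f t : cont_into le S K f -> {within K, continuous f^~ t}.
Proof.
move=> [_ fc]; apply/subspace_continuousP => x Kx V fxV.
have [|V' [openV' fV']] := fc [set a | (interior V) (a t)].
  move=> c _; exists ((fun l : 'rV_(size c) => bary l t) @^-1` interior V); split=> //.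
  by apply: open_comp (open_interior _) => l _; exact: bary_coord_continuous.
have /= sub y : K y -> V' y -> V (f y t).
  move=> Ky V'y; apply: interior_subset.
  by have : (K `&` V') y by []; rewrite -fV' => -[].
have : nbhs x V'.
  apply: open_nbhs_nbhs; split=> //.
  by have : (K `&` f @^-1` [set a | (interior V) (a t)]) x by []; rewrite fV' => -[].
by apply: filterS => y V'y Ky; exact: sub.
Qed.

(* Choose for every vertex [t] in use a point [x t] of [K] whose image involves [t]. Discarding
   the [f (x t)] with [t] outside a finite set leaves an open set of the realization, and these
   open sets cover it. *)
Lemma compact_finite_support S K f : compact K -> cont_into le S K f ->
  exists ts : seq T, forall x t, K x -> f x t != 0 -> t \in ts.
Proof.
rewrite compact_cover => compactK [fS fc].
pose used t := exists2 x, K x & f x t != 0.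
have /choice[x xP] t : exists x, used t -> K x /\ f x t != 0.
  by have [[x Kx ft]|?] := pselect (used t); [exists x|exists 0].
pose unused_out (c : seq T) := [set t | used t /\ t \notin c].
pose O (c : seq T) : set (T -> RR) := [set a | forall t, unused_out c t -> a <> f (x t)].
have openO c : coh_open le S (O c) by apply: coh_open_avoid => t [/xP[]].
have /choice[c cP] y : exists c : seq T, K y -> forall t, f y t != 0 -> t \in c.
  have [Ky|?] := pselect (K y); last by exists [::].
  by have [c [_ y_out _ _]] := fS y Ky; exists c => _ t; apply: contraNT => /y_out ->.
have /choice[V VP] y : exists V, open V /\ K `&` f @^-1` O (c y) = K `&` V by exact: fc.
have fO y : K y -> O (c y) (f y).
  move=> Ky t [/xP[_ fxt] tc] yt; move: fxt; rewrite -yt => /(cP y Ky) tc'.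
  by rewrite tc' in tc.
have [|y Ky|ys ysK cover] := compactK _ K V; first by move=> y _; exact: (proj1 (VP y)).
  exists y => //; have : (K `&` f @^-1` O (c y)) y by split=> //; exact: fO.
  by rewrite (proj2 (VP y)) => -[].
exists (flatten [seq c y | y <- finmap.enum_fset ys]) => y t Ky ft; have ut : used t by exists y.
have [Kx _] := xP t ut; have [z zys Vz] := cover _ Kx.
have : (K `&` f @^-1` O (c z)) (x t) by rewrite (proj2 (VP z)); split.
move=> [_ /(_ t) Oz]; apply: contraT => tc; case: Oz => //; split=> //.
apply: contra tc => tc; apply/flattenP; exists (c z) => //.
by apply: map_f.
Qed.

Lemma cont_into_flag_map S K f : compact K -> cont_into le S K f ->
  flag_map (comparability le) S K f.
Proof.
move=> compactK fc; have [ts tsP] := compact_finite_support compactK fc.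
exists (undup ts); first exact: undup_uniq.
split=> [x Kx|t]; last exact: cont_into_coord fc.
have [ts' uts' [f_ge0 f0 f_S f_cmp f1]] :=
  realization_flag_points le_refl le_trans le_anti (proj1 fc x Kx).
have f_out t : t \notin undup ts -> f x t = 0.
  by rewrite mem_undup => tts; apply: contrapT => /eqP /(tsP x t Kx); exact/negP.
split=> //; rewrite -f1.
have sub1 : {subset undup ts <= undup (ts ++ ts')}.
  by move=> t; rewrite !mem_undup mem_cat => ->.
have sub2 : {subset ts' <= undup (ts ++ ts')}.
  by move=> t t_ts'; rewrite mem_undup mem_cat t_ts' orbT.
rewrite -(sum_sub_uniq (undup_uniq ts) (undup_uniq _) sub1 f_out).
exact: sum_sub_uniq (undup_uniq _) sub2 f0.
Qed.

End FlagMapsOfRows.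

Section SphereToCube.
Variables (R : realType) (n : nat).
Implicit Types x : 'rV[R]_n.+1.

Definition sqnorm x : R := \sum_(i < n.+1) x ord0 i ^+ 2.

Definition normalize x := (Num.sqrt (sqnorm x))^-1 *: x.

(* The lower bound [n.+1%:R^-1] keeps the map continuous at [0]; it is irrelevant on the unit
   sphere, all of whose points have a coordinate of absolute value at least [n.+1%:R^-1]. *)
Definition inflate x := (Num.max `|x| n.+1%:R^-1)^-1 *: x.

Lemma continuous_sqnorm : continuous sqnorm.
Proof.
apply: continuous_big => [|i _]; first exact: add_continuous.
have coord_c : continuous (fun y : 'rV[R]_n.+1 => y ord0 i) by exact: coord_continuous.
by move=> x; exact: continuousM (coord_c x) (coord_c x).
Qed.

Lemma sqnorm_ge0 x : 0 <= sqnorm x.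
Proof. by apply: sumr_ge0 => i _; exact: sqr_ge0. Qed.

Lemma sqnormZ a x : sqnorm (a *: x) = a ^+ 2 * sqnorm x.
Proof. by rewrite /sqnorm mulr_sumr; apply: eq_bigr => i _; rewrite mxE exprMn. Qed.

Lemma sqnorm_gt0 x : x != 0 -> 0 < sqnorm x.
Proof.
move=> x0; have [i xi] := row_norm_attained x0; rewrite /sqnorm (bigD1 i) //=.
apply: ltr_wpDr; first by apply: sumr_ge0 => j _; exact: sqr_ge0.
by rewrite -(real_normK (num_real _)) xi exprn_gt0 // normr_gt0.
Qed.

Lemma continuous_normalize x : x != 0 -> {for x, continuous normalize}.
Proof.
move=> x0; apply: (@continuousZ _ _ _ (fun y => (Num.sqrt (sqnorm y))^-1) id _ _ cvg_id).
apply: continuousV; first by rewrite sqrtr_eq0 -ltNge sqnorm_gt0.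
by apply: continuous_comp; [exact: continuous_sqnorm|exact: sqrt_continuous].
Qed.

Lemma sqnorm_normalize x : x != 0 -> sqnorm (normalize x) = 1.
Proof.
by move=> x0; rewrite sqnormZ exprVn sqr_sqrtr ?sqnorm_ge0 // mulVf // gt_eqF ?sqnorm_gt0.
Qed.

Lemma normalize_scale a x : 0 < a -> sqnorm x = 1 -> normalize (a *: x) = x.
Proof.
move=> a_gt0 x1; rewrite /normalize sqnormZ x1 mulr1 sqrtr_sqr gtr0_norm //.
by rewrite scalerA mulVf ?scale1r // gt_eqF.
Qed.

Lemma inflate_factor_gt0 x : 0 < (Num.max `|x| n.+1%:R^-1)^-1.
Proof. by rewrite invr_gt0 lt_max invr_gt0 ltr0Sn orbT. Qed.

Lemma continuous_inflate : continuous inflate.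
Proof.
move=> x; apply: (@continuousZ _ _ _ (fun y => (Num.max `|y| n.+1%:R^-1)^-1) id _ _ cvg_id).
apply: continuousV; first by rewrite gt_eqF // -invr_gt0 inflate_factor_gt0.
by apply: continuous_max; [exact: norm_continuous|exact: cst_continuous].
Qed.

Lemma inflate_cube x : cube [set: 'I_n.+1]%SET 0 1 (inflate x).
Proof.
split=> [|i]; last by rewrite inE.
have max_gt0 : 0 < Num.max `|x| n.+1%:R^-1 by rewrite -invr_gt0 inflate_factor_gt0.
rewrite subr0 normrZ (gtr0_norm (inflate_factor_gt0 x)) mulrC ler_pdivrMr // mul1r.
by rewrite le_max lexx.
Qed.

Lemma sqnorm_le x : sqnorm x <= n.+1%:R * `|x| ^+ 2.
Proof.
have -> : n.+1%:R * `|x| ^+ 2 = \sum_(i < n.+1) `|x| ^+ 2 by rewrite sumr_const card_ord mulr_natl.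
apply: ler_sum => i _.
by rewrite -(real_normK (num_real _)) lerXn2r ?nnegrE ?normr_ge0 // coord_le_norm.
Qed.

Lemma sphere_norm_ge x : sqnorm x = 1 -> n.+1%:R^-1 <= `|x|.
Proof.
move=> x1; rewrite leNgt; apply/negP => x_lt; have := sqnorm_le x; rewrite x1 leNgt => /negP[].
have n_gt0 : 0 < n.+1%:R :> R by rewrite ltr0Sn.
have n_ge1 : 1 <= n.+1%:R :> R by rewrite ler1n.
have nx : n.+1%:R * `|x| < 1 by rewrite -ltr_pdivlMl // mulr1.
have := normr_ge0 x; nra.
Qed.

Lemma inflate_boundary x : sqnorm x = 1 -> cube_boundary [set: 'I_n.+1]%SET 0 1 (inflate x).
Proof.
move=> x1; split; first exact: inflate_cube.
have x_ge := sphere_norm_ge x1.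
rewrite subr0 /inflate (max_idPl x_ge) normrZ normfV normr_id mulVf //.
by rewrite gt_eqF // (lt_le_trans _ x_ge) // invr_gt0 ltr0Sn.
Qed.

End SphereToCube.

Lemma compact_sphere n : compact (@sphere n).
Proof.
apply: bounded_closed_compact.
  exists 1; split; first exact: num_real.
  move=> r r_gt1 x x1 /=; apply: row_norm_le => [|i]; first by lra.
  apply: le_trans (ltW r_gt1); rewrite -(@ler_pXn2r _ 2) ?nnegrE ?normr_ge0 // expr1n.
  rewrite (real_normK (num_real _)) -{1}x1 (bigD1 i) //= lerDl.
  by apply: sumr_ge0 => j _; exact: sqr_ge0.
exact: preimage_closed (fun x _ => @continuous_sqnorm (RR : realType) n x) (@closed_eq _ _).
Qed.

Section ConnectedOfFillable.
Variables (T : eqType) (le : rel T).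
Hypotheses (le_refl : reflexive le) (le_trans : transitive le) (le_anti : antisymmetric le).

Lemma fillable_realization S : fillable RR (comparability le) 0 S ->
  exists a, realization le S a.
Proof.
move=> fill; have /= [|g [ts uts [gS _]] _] :=
  fill 0%N (finset.set0 : {set 'I_0}) 0 1 (fun=> fun=> 0) (cards0 _) ltr01.
  exists [::] => //; split=> [x [_ x1]|t]; last exact/continuous_subspaceT/cst_continuous.
  by have := oner_neq0 RR; rewrite -x1 (thinmx0 (x - 0)) normr0 eqxx.
exists (g 0); apply: (flag_points_realization le_trans le_anti uts).
by apply: gS; apply: cube_center.
Qed.

Lemma fillable_extends_sphere S n f : fillable RR (comparability le) n.+1 S ->
  cont_into le S (@sphere n) f ->
  exists g, cont_into le S (@ball_closed n) g /\ forall x, sphere x -> g x = f x.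
Proof.
move=> fill /(cont_into_flag_map le_refl le_trans le_anti (@compact_sphere n)) mf.
have boundary_neq0 x : cube_boundary [set: 'I_n.+1]%SET (0 : 'rV[RR]_n.+1) 1 x -> x != 0.
  by move=> [_]; rewrite subr0 -normr_eq0 => ->; rewrite oner_neq0.
have [||g mg gf] := fill _ [set: 'I_n.+1]%SET 0 1 (f \o @normalize (RR : realType) n) _ ltr01.
- by rewrite cardsT card_ord.
- apply: flag_map_comp mf => [x /boundary_neq0/sqnorm_normalize //|].
  by apply: continuous_in_subspaceT => x /set_mem/boundary_neq0; exact: continuous_normalize.
exists (g \o @inflate (RR : realType) n); split=> [|x x1].
  apply: flag_map_cont_into => //; apply: flag_map_comp mg => [x _|]; first exact: inflate_cube.
  exact/continuous_subspaceT/continuous_inflate.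
rewrite /= gf; last exact: inflate_boundary.
by rewrite /= normalize_scale // inflate_factor_gt0.
Qed.

Lemma fillable_k_connected S N :
  (forall j, (j < N)%N -> fillable RR (comparability le) j S) -> k_connected le S (N%:Z - 2).
Proof.
move=> fill; split=> [N_ge1|n n_le f fc].
  by apply: fillable_realization; apply: fill; lia.
by apply: fillable_extends_sphere => //; apply: fill; lia.
Qed.

End ConnectedOfFillable.

(** * Constructible complexes *)

Section Constructible.
Variables (T : eqType) (cmp : rel T).
Hypotheses (cmp_refl : reflexive cmp) (cmp_sym : symmetric cmp).
Implicit Types (S : set T) (N : nat).

(* [constructible N S] certifies that the flag complex of [S] is [(N - 2)]-connected; when [S] is
   spherical, [N] is the number of elements of a maximal chain. *)
Inductive constructible : nat -> set T -> Prop :=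
| constructible_zero S : constructible 0 S
| constructible_cone N S v : S v -> (forall s, S s -> cmp s v) -> constructible N S
| constructible_attach N S0 S : S0 `<=` S ->
    (forall u v, S u -> S v -> ~ S0 u -> ~ S0 v -> cmp u v -> u = v) ->
    constructible N S0 ->
    (forall v, S v -> ~ S0 v -> constructible N.-1 (link cmp S0 v)) -> constructible N S.

Lemma constructible_fillable (R : realType) N S : constructible N S ->
  forall j, (j < N)%N -> fillable R cmp j S.
Proof.
elim=> {N S} [//|N S v Sv S_v j _|[|N] S0 S S0S anti _ IH0 _ IHlink j //].
  exact: cone_fillable Sv S_v.
rewrite ltnS; apply: (attach_fillable cmp_refl cmp_sym S0S anti _ IH0) => v i Sv S0v.
exact: IHlink.
Qed.

Lemma constructible_leq N N' S : (N' <= N)%N -> constructible N S -> constructible N' S.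
Proof.
move=> + con_S; elim: con_S N' => {N S} [S|N S v Sv S_v|N S0 S S0S anti _ IH0 _ IHlink] N' N'N.
- by move: N'N; rewrite leqn0 => /eqP ->; exact: constructible_zero.
- exact: constructible_cone Sv S_v.
- apply: (constructible_attach S0S anti); first exact: IH0.
  by move=> v Sv S0v; apply: IHlink => //; lia.
Qed.

Lemma constructible_inhabited N S : (0 < N)%N -> constructible N S -> exists v, S v.
Proof.
move=> + con_S; elim: con_S => {N S} // [N S v Sv _ _|N S0 S S0S _ _ IH _ _ /IH[v S0v]].
  by exists v.
by exists v; exact: S0S.
Qed.

Section AttachByRank.
Variables (rk : T -> nat) (B : nat).
Hypothesis rk_bound : forall v, (rk v <= B)%N.
Hypothesis rk_inj : forall u v, cmp u v -> rk u = rk v -> u = v.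

Lemma attach_by_rank N S0 S : S0 `<=` S -> constructible N S0 ->
  (forall v, S v -> ~ S0 v ->
    constructible N.-1 (link cmp [set s | S s /\ (S0 s \/ (rk s < rk v)%N)] v)) ->
  constructible N S.
Proof.
move=> S0S con_S0 con_link.
suff con_below b : constructible N [set s | S s /\ (S0 s \/ (rk s < b)%N)].
  have -> : S = [set s | S s /\ (S0 s \/ (rk s < B.+1)%N)]; last exact: con_below.
  by apply/seteqP; split=> [s Ss|s []//]; split=> //; right; exact: rk_bound.
elim: b => [|b IH].
  have -> : [set s | S s /\ (S0 s \/ (rk s < 0)%N)] = S0; last exact: con_S0.
  by apply/seteqP; split=> [s [_ []]//|s S0s]; split; [exact: S0S|left].
have new_rk v : S v /\ (S0 v \/ (rk v < b.+1)%N) -> ~ (S v /\ (S0 v \/ (rk v < b)%N)) ->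
    [/\ S v, ~ S0 v & rk v = b].
  move=> [Sv v_b] not_b; have S0v : ~ S0 v by move=> S0v; apply: not_b; split=> //; left.
  split=> //; apply/eqP; rewrite eqn_leq -ltnS; case: v_b => // ->; rewrite leqNgt.
  by apply/negP => rv; apply: not_b; split=> //; right.
apply: constructible_attach IH _.
- by move=> s [Ss S0s_b]; split=> //; case: S0s_b => [|rs]; [left|right; exact: leq_trans rs _].
- move=> u v Su Sv /(new_rk u Su)[_ _ ru] /(new_rk v Sv)[_ _ rv] uv.
  by apply: rk_inj uv _; rewrite ru.
- by move=> v Sv /(new_rk v Sv)[{}Sv S0v <-]; exact: con_link.
Qed.

Lemma constructible_join_any N S S' : (forall u v, S u -> S' v -> cmp u v) ->
  constructible N S' -> constructible N (S `|` S').
Proof.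
move=> SS' con_S'; suff joined n : forall S, (forall u v, S u -> S' v -> cmp u v) ->
    (forall u, S u -> (rk u < n)%N) -> constructible N (S `|` S').
  by apply: (joined B.+1) => // u _; exact: rk_bound.
elim: n => [|n IH] {SS'} {}S SS' rk_S.
  have -> : S `|` S' = S'; last by [].
  by apply/seteqP; split=> u; [case=> // /rk_S|right].
apply: (attach_by_rank _ con_S') => [u|v [Sv|//] _]; first by right.
apply: (constructible_leq (leq_pred N)).
have -> : link cmp [set s | (S `|` S') s /\ (S' s \/ (rk s < rk v)%N)] v =
    link cmp [set s | S s /\ (rk s < rk v)%N] v `|` S'.
  apply/seteqP; split=> s /=.
    by move=> [[[Ss|S's] [?|?]] sv]; by [right|left].
  move=> [[[Ss ?] sv]|S's]; split=> //; [by split; [left|right]|by split; [right|left]|].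
  by rewrite cmp_sym; exact: SS'.
apply: IH => [u w [[Su _] _]|u [[Su ru] _]]; first exact: SS'.
by apply: leq_trans ru _; rewrite -ltnS rk_S.
Qed.

Lemma constructible_join N N' S S' : (forall u v, S u -> S' v -> cmp u v) ->
  constructible N S -> constructible N' S' -> constructible (N + N') (S `|` S').
Proof.
move=> + con_S con_S'.
elim: con_S => {N S} [S|N S v Sv S_v|N S0 S S0S anti _ IH0 _ IHlink] SS'.
- exact: constructible_join_any.
- apply: (@constructible_cone _ _ v); first by left.
  by move=> s [/S_v//|S's]; rewrite cmp_sym; exact: SS'.
apply: (@constructible_attach _ (S0 `|` S')).
- by move=> u [/S0S|]; [left|right].
- move=> u v [Su|Su] [Sv|Sv] nu nv; try by [case: nu; right|case: nv; right].
  by apply: anti => // S0_; [apply: nu|apply: nv]; left.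
- by apply: IH0 => u v /S0S; exact: SS'.
move=> v [Sv|Sv] nv; last by case: nv; right.
have S0v : ~ S0 v by move=> S0v; apply: nv; left.
have -> : link cmp (S0 `|` S') v = link cmp S0 v `|` S'.
  apply/seteqP; split=> s /=.
    by move=> [[Ss|Ss] sv]; [left|right].
  by move=> [[Ss sv]|Ss]; [split=> //; left|split; [right|rewrite cmp_sym; exact: SS']].
apply: (constructible_leq _ (IHlink v Sv S0v _)); first by lia.
by move=> u w [/S0S Su _]; exact: SS'.
Qed.

End AttachByRank.

End Constructible.

Section RankedPoset.
Variable T : eqType.

Definition ranked (le : rel T) (rk : T -> nat) (B : nat) : Prop :=
  [/\ reflexive le, transitive le, forall x y, plt le x y -> (rk x < rk y)%N &
      forall x, (rk x <= B)%N].

Variables (le : rel T) (rk : T -> nat) (B : nat).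
Hypothesis le_ranked : ranked le rk B.
Implicit Types (S : set T) (x y : T) (N : nat).

Let le_refl : reflexive le. Proof. by case: le_ranked. Qed.
Let le_trans : transitive le. Proof. by case: le_ranked. Qed.
Let rk_lt x y : plt le x y -> (rk x < rk y)%N. Proof. by case: le_ranked => _ _ + _; exact. Qed.
Let rk_bound x : (rk x <= B)%N. Proof. by case: le_ranked. Qed.

Lemma ranked_antisymmetric : antisymmetric le.
Proof.
move=> x y /andP[xy yx]; case: (eqVneq x y) => // x_neq_y.
have := @rk_lt x y; have := @rk_lt y x; rewrite /plt xy yx (eq_sym y) x_neq_y /=.
by move=> /(_ isT)/ltnW; rewrite leqNgt => /negPf -> /(_ isT).
Qed.

Lemma ranked_dual : ranked (fun x y => le y x) (fun x => B - rk x)%N B.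
Proof.
split=> [|y x z yx zy|x y|x]; [exact: le_refl|exact: le_trans zy yx| |exact: leq_subr].
rewrite /plt eq_sym => /rk_lt yx; rewrite ltn_sub2l //; exact: leq_trans yx (rk_bound x).
Qed.

Local Notation con := (constructible (comparability le)).

Definition lower_part S x := [set y | S y /\ plt le y x].
Definition upper_part S x := [set y | S y /\ plt le x y].

Lemma comparable_rk_inj x y : comparability le x y -> rk x = rk y -> x = y.
Proof.
move=> + rxy; case: (eqVneq x y) => // x_neq_y /orP[] le_xy.
  by have := @rk_lt x y; rewrite /plt le_xy x_neq_y rxy ltnn => /(_ isT).
by have := @rk_lt y x; rewrite /plt le_xy eq_sym x_neq_y rxy ltnn => /(_ isT).
Qed.

Lemma constructible_least N S x : S x -> (forall y, S y -> le x y) -> con N S.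
Proof.
move=> Sx x_le; apply: constructible_cone Sx _ => y /x_le.
by rewrite /comparability orbC => ->.
Qed.

Lemma constructible_greatest N S x : S x -> (forall y, S y -> le y x) -> con N S.
Proof.
by move=> Sx le_x; apply: constructible_cone Sx _ => y /le_x; rewrite /comparability => ->.
Qed.

Lemma attach_increasing N S0 S : S0 `<=` S -> con N S0 ->
  (forall x, S x -> ~ S0 x -> exists a b, [/\ (N <= (a + b).+1)%N,
    con a (lower_part S x) & con b (upper_part S0 x)]) ->
  con N S.
Proof.
move=> S0S con_S0 con_parts; apply: (attach_by_rank rk_bound comparable_rk_inj S0S con_S0).
move=> x Sx S0x; have [a [b [ab con_a con_b]]] := con_parts x Sx S0x.
have -> : link (comparability le) [set y | S y /\ (S0 y \/ (rk y < rk x)%N)] x =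
    lower_part S x `|` upper_part S0 x.
  apply/seteqP; split=> y /=.
    move=> [[Sy y_old] yx]; have y_neq_x : y != x.
      by apply/eqP => eyx; case: y_old; rewrite eyx ?ltnn.
    case/orP: yx => yx; first by left; split=> //; rewrite /plt yx.
    have x_lt_y : plt le x y by rewrite /plt yx eq_sym.
    by right; split=> //; case: y_old => // ry; have := rk_lt x_lt_y; rewrite ltnNge (ltnW ry).
  move=> [[Sy yx]|[S0y xy]]; split.
  - by split=> //; right; exact: rk_lt.
  - by case/andP: yx => yx _; apply/orP; left.
  - by split; [exact: S0S|left].
  - by case/andP: xy => xy _; apply/orP; right.
have N_le : (N.-1 <= a + b)%N by lia.
apply: (constructible_leq N_le).
apply: (constructible_join (@comparability_sym _ le) rk_bound comparable_rk_inj _ con_a con_b).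
by move=> y z [_ /andP[yx _]] [_ /andP[xz _]]; rewrite /comparability (le_trans yx xz).
Qed.

(* Attach the [x] outside [S0] by increasing rank: the [y < x] contract conically to [phi x]. *)
Lemma constructible_lower_retract N S0 S (phi : T -> T) : S0 `<=` S ->
  (forall x, S x -> S0 (phi x) /\ le (phi x) x) ->
  (forall x y, S x -> S y -> le x y -> le (phi x) (phi y)) ->
  con N S0 -> con N S.
Proof.
suff bounded n : forall N S0 S (phi : T -> T), (forall x, S x -> (rk x < n)%N) -> S0 `<=` S ->
    (forall x, S x -> S0 (phi x) /\ le (phi x) x) ->
    (forall x y, S x -> S y -> le x y -> le (phi x) (phi y)) -> con N S0 -> con N S.
  by apply: (bounded B.+1) => x _; exact: rk_bound.
elim: n => [|n IH] {}N {}S0 {}S {}phi rk_S S0S phiS phi_mono con_S0.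
  have -> : S = S0; last exact: con_S0.
  by apply/seteqP; split=> // x /rk_S.
apply: (attach_increasing S0S con_S0) => x Sx S0x.
have [S0_phix phix_le] := phiS x Sx.
have phi_lt y : S y -> le y x -> plt le (phi y) x.
  move=> Sy yx; have [S0_phiy phiy_le] := phiS y Sy.
  rewrite /plt (le_trans phiy_le yx) /=.
  by apply/eqP => e; apply: S0x; rewrite -e.
exists N, 0%N; split; [by rewrite addn0| |exact: constructible_zero].
apply: (IH _ [set y | lower_part S x y /\ le y (phi x)] _ phi).
- by move=> y [Sy /rk_lt yx]; apply: leq_trans yx _; rewrite -ltnS rk_S.
- by move=> y [].
- move=> y [Sy /andP[yx _]]; have [S0_phiy phiy_le] := phiS y Sy; split=> //; split.
    by split; [exact: S0S|exact: phi_lt].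
  exact: phi_mono.
- by move=> y z [Sy _] [Sz _]; exact: phi_mono.
apply: (@constructible_greatest _ _ (phi x)) => [|y []//].
by split; [split; [exact: S0S|exact: phi_lt]|exact: le_refl].
Qed.

Lemma constructible_lower_conical N S x (phi : T -> T) : S x ->
  (forall y, S y -> [/\ S (phi y), le (phi y) y & le (phi y) x]) ->
  (forall y z, S y -> S z -> le y z -> le (phi y) (phi z)) -> con N S.
Proof.
move=> Sx phiS phi_mono.
apply: (@constructible_lower_retract N [set y | S y /\ le y x] S phi) => //.
- by move=> y [].
- by move=> y /phiS[].
- by apply: (@constructible_greatest _ _ x) => [|y []].
Qed.

End RankedPoset.

Section DualRankedPoset.
Variables (T : eqType) (le : rel T) (rk : T -> nat) (B : nat).
Hypothesis le_ranked : ranked le rk B.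
Implicit Types (S : set T) (x y : T) (N : nat).

Local Notation con := (constructible (comparability le)).
Local Notation ge := (fun x y => le y x).

Let ge_ranked : ranked ge (fun x => B - rk x)%N B. Proof. exact: ranked_dual. Qed.

Lemma comparability_dual : comparability ge = comparability le.
Proof. by apply/funext => x; apply/funext => y; rewrite /comparability orbC. Qed.

Lemma lower_part_dual S x : lower_part ge S x = upper_part le S x.
Proof. by apply/seteqP; split=> y [Sy]; rewrite /plt eq_sym. Qed.

Lemma upper_part_dual S x : upper_part ge S x = lower_part le S x.
Proof. by apply/seteqP; split=> y [Sy]; rewrite /plt eq_sym. Qed.

Lemma attach_decreasing N S0 S : S0 `<=` S -> con N S0 ->
  (forall x, S x -> ~ S0 x -> exists a b, [/\ (N <= (a + b).+1)%N,
    con a (lower_part le S0 x) & con b (upper_part le S x)]) ->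
  con N S.
Proof.
rewrite -comparability_dual => S0S con_S0 con_parts.
apply: (attach_increasing ge_ranked S0S con_S0) => x Sx S0x.
have [a [b [ab con_a con_b]]] := con_parts x Sx S0x.
by exists b, a; rewrite lower_part_dual upper_part_dual addnC.
Qed.

Lemma constructible_upper_retract N S0 S (phi : T -> T) : S0 `<=` S ->
  (forall x, S x -> S0 (phi x) /\ le x (phi x)) ->
  (forall x y, S x -> S y -> le x y -> le (phi x) (phi y)) ->
  con N S0 -> con N S.
Proof.
rewrite -comparability_dual => S0S phiS phi_mono.
apply: (constructible_lower_retract ge_ranked S0S phiS).
by move=> x y Sx Sy; exact: phi_mono.
Qed.

Lemma constructible_upper_conical N S x (phi : T -> T) : S x ->
  (forall y, S y -> [/\ S (phi y), le y (phi y) & le x (phi y)]) ->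
  (forall y z, S y -> S z -> le y z -> le (phi y) (phi z)) -> con N S.
Proof.
rewrite -comparability_dual => Sx phiS phi_mono.
apply: (constructible_lower_conical ge_ranked N Sx phiS).
by move=> y z Sy Sz; exact: phi_mono.
Qed.

End DualRankedPoset.

(** * Graded posets with constructible intervals *)

Section ConstructibleIntervals.
Variables (T : eqType) (le : rel T) (S : set T) (rk : T -> nat) (B lo hi : nat).
Hypothesis le_ranked : ranked le rk B.
Hypotheses (rk_range : forall a, S a -> (lo <= rk a <= hi)%N) (lo_hi : (lo <= hi.+1)%N).
Implicit Types (x y : ext T) (a b : T) (c : seq T).

Let le_refl : reflexive le. Proof. by case: le_ranked. Qed.
Let le_trans : transitive le. Proof. by case: le_ranked. Qed.
Let le_anti : antisymmetric le. Proof. exact: ranked_antisymmetric le_ranked. Qed.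

(* Shifted by one on [Mid], so that the value at [Bot] does not underflow when [lo = 0]. *)
Definition ext_rank x : nat :=
  match x with Bot => lo | Mid a => (rk a).+1 | Top => hi.+2 end.

Lemma ext_lt_Mid a b : ext_lt le (Mid a) (Mid b) <-> plt le a b.
Proof.
split=> [[ab a_neq_b]|/andP[ab a_neq_b]]; last by split=> // -[]; exact/eqP.
by apply/andP; split=> //; apply/eqP => e; apply: a_neq_b; rewrite e.
Qed.

Lemma ext_lt_trans x a y : ext_lt le x (Mid a) -> ext_lt le (Mid a) y -> ext_lt le x y.
Proof.
case: x => [|b|]; case: y => [|d|] //=; try by [move=> _ []|move=> []].
by rewrite !ext_lt_Mid; exact: plt_trans.
Qed.

Lemma ext_rank_lt x y : in_ext S x -> in_ext S y -> ext_lt le x y -> (ext_rank x < ext_rank y)%N.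
Proof.
case: x => [|a|]; case: y => [|b|] //=; try by [move=> _ _ []|move=> _ _ [_ /(_ erefl)]].
- by move=> _ /rk_range; lia.
- by move=> _ _ /ext_lt_Mid; case: le_ranked => _ _ + _; exact.
- by move=> /rk_range; lia.
Qed.

Lemma open_interval_split x y a b : open_interval le S x y a -> open_interval le S (Mid a) y b ->
  open_interval le S x y b.
Proof. by move=> [Sa [xa ay]] [Sb [ab by_]]; split=> //; split=> //; exact: ext_lt_trans xa ab. Qed.

Lemma chain_behead x y a c : is_chain le (open_interval le S x y) (a :: c) ->
  is_chain le (open_interval le S (Mid a) y) c.
Proof.
move=> [sorted_ac ac]; split; first exact: path_sorted sorted_ac.
have /allP a_lt := order_path_min (plt_trans le_trans le_anti) sorted_ac.
move=> b bc; have [Sb [_ by_]] : open_interval le S x y b by apply: ac; rewrite inE bc orbT.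
by split=> //; split=> //; apply/ext_lt_Mid; exact: a_lt.
Qed.

Lemma chain_cons x y a c : open_interval le S x y a ->
  is_chain le (open_interval le S (Mid a) y) c -> is_chain le (open_interval le S x y) (a :: c).
Proof.
move=> xay [sorted_c cS]; split=> [|b].
  case: c sorted_c cS => //= b c -> /(_ b (mem_head _ _))[_ [/ext_lt_Mid -> _]] //.
by rewrite inE => /predU1P[-> //|/cS]; exact: open_interval_split.
Qed.

Lemma chain_size x y c : in_ext S x -> in_ext S y -> ext_lt le x y ->
  is_chain le (open_interval le S x y) c -> (size c <= ext_rank y - (ext_rank x).+1)%N.
Proof.
move=> + Sy; elim: c x => [|a c IH] x Sx xy chain_ac; first by [].
have [Sa [xa ay]] := proj2 chain_ac a (mem_head _ _).
have := IH (Mid a) Sa ay (chain_behead chain_ac); have := @ext_rank_lt x (Mid a) Sx Sa xa.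
by have := @ext_rank_lt (Mid a) y Sa Sy ay; rewrite /=; lia.
Qed.

Lemma maxchain_not_cons (I : set T) a c : is_maxchain le I c -> ~ is_chain le I (a :: c).
Proof.
move=> [_ max_c] chain_ac; have /andP[/negP a_c _] := chain_uniq le_trans le_anti chain_ac.
apply: a_c; apply: (max_c _ chain_ac); last exact: mem_head.
by move=> b bc; rewrite inE bc orbT.
Qed.

Lemma maxchain_behead x y a c : is_maxchain le (open_interval le S x y) (a :: c) ->
  is_maxchain le (open_interval le S (Mid a) y) c.
Proof.
move=> [chain_ac max_ac]; split=> [|c' chain_c' cc' b bc']; first exact: chain_behead chain_ac.
have chain_ac' := chain_cons (proj2 chain_ac a (mem_head _ _)) chain_c'.
have : b \in a :: c.
  apply: (max_ac _ chain_ac'); last by rewrite inE bc' orbT.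
  by move=> d; rewrite !inE => /predU1P[->|/cc' ->]; rewrite ?eqxx ?orbT.
rewrite inE => /predU1P[ba|//]; have /andP[/negP[]] := chain_uniq le_trans le_anti chain_ac'.
by rewrite -ba.
Qed.

Hypothesis con_interval : forall x y, in_ext S x -> in_ext S y -> ext_lt le x y ->
  constructible (comparability le) (ext_rank y - (ext_rank x).+1) (open_interval le S x y).

(* Maximal chains have no gaps because [con_interval] makes every interval of larger rank
   difference inhabited. *)
Lemma maxchain_size x y c : in_ext S x -> in_ext S y -> ext_lt le x y ->
  is_maxchain le (open_interval le S x y) c -> size c = (ext_rank y - (ext_rank x).+1)%N.
Proof.
move=> + Sy; elim: c x => [|a c IH] x Sx xy max_c.
  apply/esym/eqP; rewrite -leqn0 leqNgt; apply/negP => gap.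
  have [a xay] := constructible_inhabited gap (con_interval Sx Sy xy).
  by apply: (maxchain_not_cons max_c) (chain_cons xay _).
have chain_ac := proj1 max_c; have [Sa [xa ay]] := proj2 chain_ac a (mem_head _ _).
rewrite /= (IH (Mid a) Sa ay (maxchain_behead max_c)).
have := @ext_rank_lt x (Mid a) Sx Sa xa; have := @ext_rank_lt (Mid a) y Sa Sy ay.
suff : (ext_rank (Mid a) <= (ext_rank x).+1)%N by rewrite /=; clear; lia.
rewrite leqNgt; apply/negP => gap.
have [|b [Sb [xb ba]]] := constructible_inhabited _ (@con_interval x (Mid a) Sx Sa xa).
  by rewrite subn_gt0.
apply: (maxchain_not_cons max_c (a := b)).
apply: chain_cons; first by split=> //; split=> //; exact: ext_lt_trans ba ay.
exact: chain_cons (chain_behead chain_ac).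
Qed.

Lemma maxchain_exists x y : in_ext S x -> in_ext S y -> ext_lt le x y ->
  exists c, is_maxchain le (open_interval le S x y) c.
Proof.
move=> Sx Sy xy; set I := open_interval le S x y.
pose has_chain n := `[< exists2 c, is_chain le I c & size c = n >].
have ex_chain : exists n, has_chain n by exists 0%N; apply/asboolP; exists [::].
have chain_le n : has_chain n -> (n <= ext_rank y - (ext_rank x).+1)%N.
  by move=> /asboolP[c chain_c <-]; exact: chain_size Sx Sy xy chain_c.
case: (ex_maxnP ex_chain chain_le) => _ /asboolP[c chain_c <-] max_c.
exists c; split=> // c' chain_c' cc' b; have uc := chain_uniq le_trans le_anti chain_c.
have c'_le : (size c' <= size c)%N by apply: max_c; apply/asboolP; exists c'.
by rewrite (uniq_min_size uc cc' c'_le).2.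
Qed.

Lemma open_interval_has_dim x y : in_ext S x -> in_ext S y -> ext_lt le x y ->
  has_dim le (open_interval le S x y) ((ext_rank y - (ext_rank x).+1)%N%:Z - 1).
Proof.
move=> Sx Sy xy; split=> [|c chain_c]; last by rewrite subrK lez_nat; exact: chain_size chain_c.
have [c max_c] := maxchain_exists Sx Sy xy.
by exists c; split; [case: max_c|rewrite subrK (maxchain_size Sx Sy xy max_c)].
Qed.

Lemma open_interval_Bot_Top : open_interval le S (Bot T) (Top T) = S.
Proof. by apply/seteqP; split=> a; [case|]. Qed.

Lemma open_interval_empty x : open_interval le S x x = set0.
Proof.
apply/seteqP; split=> // a [_ [xa ax]].
by have [_] := ext_lt_trans xa ax; apply.
Qed.

Lemma constructible_cohen_macaulay : cohen_macaulay le S.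
Proof.
have Bot_Top : ext_lt le (Bot T) (Top T) by [].
split.
  exists ((ext_rank (Top T) - (ext_rank (Bot T)).+1)%N%:Z - 1); rewrite -open_interval_Bot_Top.
  split; first exact: open_interval_has_dim.
  by move=> c /maxchain_size -> //; rewrite subrK.
move=> x y Sx Sy x_le_y; have [<-{y Sy x_le_y}|x_neq_y] := pselect (x = y).
  rewrite open_interval_empty; exists (-1); split; last by split=> // n.
  by split=> [|c [_ c0]]; [exists [::]|case: c c0 => // a c /(_ a (mem_head _ _))].
have xy : ext_lt le x y by split.
eexists; split; first exact: open_interval_has_dim Sx Sy xy.
rewrite -addrA -opprD; apply: fillable_k_connected => // j.
apply: constructible_fillable; [exact: comparability_refl|exact: comparability_sym|].
exact: con_interval.
Qed.

End ConstructibleIntervals.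

(** * Posets of subspaces *)

Section Subspaces.
Variables (F : fieldType) (E : vectType F).
Implicit Types (A H K V W X : {vspace E}) (v y z : E).

Lemma plt_vsubE W V : plt (@vsub_le F E) W V = (W <= V)%VS && ~~ (V <= W)%VS.
Proof. by rewrite /plt /vsub_le eqEsubv; case: (W <= V)%VS. Qed.

Lemma plt_vsubW W V : plt (@vsub_le F E) W V -> (W <= V)%VS.
Proof. by case/andP. Qed.

Lemma plt_vsub_dim W V : plt (@vsub_le F E) W V -> (\dim W < \dim V)%N.
Proof. by rewrite plt_vsubE => /andP[WV VW]; rewrite (ltn_leqif (dimv_leqif_sup WV)). Qed.

Lemma vsub_ranked : ranked (@vsub_le F E) (fun W => \dim W) (\dim {:E}).
Proof.
split=> [|||W]; [exact: subvv|exact: subv_trans|exact: plt_vsub_dim|exact/dimvS/subvf].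
Qed.

Lemma memv_addv_line W v : v \in (W + <[v]>)%VS.
Proof. exact: (subvP (addvSr W _)) (memv_line v). Qed.

Lemma plt_addv_line W v : v \notin W -> plt (@vsub_le F E) W (W + <[v]>)%VS.
Proof. by move=> vW; rewrite plt_vsubE addvSl subv_add subvv -memvE. Qed.

Lemma dim_addv_line_le W v : (\dim (W + <[v]>) <= (\dim W).+1)%N.
Proof. by have := dimv_sum_cap W <[v]>%VS; rewrite dim_vline; case: (v != 0); clear; lia. Qed.

Lemma dim_addv_line W v : v \notin W -> \dim (W + <[v]>) = (\dim W).+1.
Proof.
by move=> /plt_addv_line/plt_vsub_dim lt; apply/eqP; rewrite eqn_leq dim_addv_line_le.
Qed.

Definition hyperplane V H := (H <= V)%VS && (\dim V == (\dim H).+1).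

Lemma hyperplane_addv_line V H v : hyperplane V H -> v \in V -> v \notin H -> (H + <[v]>)%VS = V.
Proof.
move=> /andP[HV /eqP dV] vV vH; apply/eqP.
by rewrite eqEdim subv_add HV -memvE vV dim_addv_line // dV /=.
Qed.

Lemma hyperplane_avoiding A V y : (A <= V)%VS -> y \in V -> y \notin A ->
  exists H, [/\ (A <= H)%VS, hyperplane V H & y \notin H].
Proof.
move=> AV yV yA; pose C := (V :\: (A + <[y]>))%VS; pose H := (A + C)%VS.
have HV : (H <= V)%VS by rewrite subv_add AV diffvSl.
have yH : y \notin H.
  apply: contra yA => /memv_addP[a aA [c cC y_ac]].
  have : c \in (C :&: (A + <[y]>))%VS.
    rewrite memv_cap cC -[c](addKr a) -y_ac rpredD ?memv_addv_line // rpredN.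
    exact: (subvP (addvSl _ _)).
  by rewrite capv_diff memv0 => /eqP c0; rewrite y_ac c0 addr0.
exists H; split=> //; first exact: addvSl.
rewrite /hyperplane HV -(dim_addv_line yH); apply/eqP; congr (\dim _).
rewrite -addvA (addvC C) addvA addvC addv_diff; apply/esym/addv_idPl.
by rewrite subv_add AV -memvE.
Qed.

Lemma hyperplane_avoiding2 A V y z : (A <= V)%VS -> y \in V -> y \notin A -> z \notin A ->
  exists H, [/\ (A <= H)%VS, hyperplane V H, y \notin H & z \notin H].
Proof.
move=> AV yV yA zA; have [zV|zV] := boolP (z \in V); last first.
  have [H [AH HV yH]] := hyperplane_avoiding AV yV yA; exists H; split=> //.
  by case/andP: HV => /subvP HV _; apply: contra zV; exact: HV.
have [|yAyz] := boolP (y \in (A + <[y - z]>)%VS).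
  move=> /memv_addP[a aA [_ /vlineP[c ->] y_ac]].
  have c0 : c != 0 by apply: contraNneq yA => c0; rewrite y_ac c0 scale0r addr0.
  have [H [AH HV zH]] := hyperplane_avoiding AV zV zA; exists H; split=> //.
  apply: contra zH => yH; rewrite -(subKr y z) rpredB //.
  have : c *: (y - z) \in H by rewrite -(addKr a (c *: _)) -y_ac rpredD // rpredN (subvP AH).
  by rewrite rpredZeq (negPf c0).
have [|H [AyzH HV yH]] := hyperplane_avoiding _ yV yAyz.
  by rewrite subv_add AV -memvE rpredB.
exists H; split=> //; first exact: subv_trans (addvSl _ _) AyzH.
apply: contra yH => zH; rewrite -(subrK z y) rpredD //.
exact: subvP AyzH _ (memv_addv_line _ _).
Qed.

Lemma hyperplane_cap_supplement V H X K : hyperplane V H -> (X <= V)%VS -> (K <= V)%VS ->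
  (X + K)%VS = V -> ~~ (X <= H)%VS -> ((X :&: H) + K == V)%VS = ~~ (X :&: K <= H)%VS.
Proof.
move=> hyp XV KV XK /subvPn[w wX wH]; apply/eqP/idP => [XHK|/subvPn[k]].
  apply: contra wH => XKH; have := subvP XV _ wX; rewrite -XHK => /memv_addP[s].
  rewrite memv_cap => /andP[sX sH] [k kK w_sk]; rewrite w_sk rpredD //.
  by apply: (subvP XKH); rewrite memv_cap kK andbT -(addKr s k) -w_sk rpredD ?rpredN.
rewrite memv_cap => /andP[kX kK] kH; have kV := subvP XV _ kX.
have -> : K = (<[k]> + K)%VS by apply/esym/addv_idPr; rewrite -memvE.
rewrite addvA (addvC _ <[k]>%VS) capvC vspace_modl -?memvE // (addvC <[k]>%VS).
by rewrite (hyperplane_addv_line hyp kV kH) (capv_idPr XV).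
Qed.

End Subspaces.

Section LinearComplexes.
Variables (F : fieldType) (E : vectType F).
Implicit Types (A H K L V W X : {vspace E}) (S : set {vspace E}).

Local Notation con := (constructible (comparability (@vsub_le F E))).
Local Notation lower_part := (lower_part (@vsub_le F E)).
Local Notation upper_part := (upper_part (@vsub_le F E)).

Definition supplements A V K L : set {vspace E} :=
  [set W | [/\ (A <= W)%VS, plt (@vsub_le F E) W V, (W + K)%VS = V & ~~ (L <= W)%VS]].

Lemma supplements_lower_part A V K L W : supplements A V K L W ->
  lower_part (supplements A V K L) W = supplements A W (W :&: K)%VS L.
Proof.
move=> [AW WV WK LW]; apply/seteqP; split=> X /=.
  move=> [[AX XV XK LX] XW]; split=> //; case/andP: XW => XW _.
  by rewrite capvC vspace_modl // XK; apply/capv_idPr; case/andP: WV.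
move=> [AX XW XK LX]; split=> //; split=> //.
  exact: plt_trans (@subv_trans _ _) (@subv_anti _ _) _ _ _ XW WV.
by rewrite -{1}(addv_idPr (capvSr W K)) addvA XK.
Qed.

Section HyperplaneInduction.
Variables (A V K L H : {vspace E}).
Hypotheses (AK : (A <= K)%VS) (KV : (K <= V)%VS).
Hypotheses (AH : (A <= H)%VS) (hyp : hyperplane V H) (KH : ~~ (K <= H)%VS) (LH : ~~ (L <= H)%VS).

Let S := supplements A V K L.
Let S0 : set {vspace E} := [set W | S W /\ ((W :&: H) + K)%VS = V].

Lemma hyperplane_supplement : S H.
Proof.
have [HV dV] := andP hyp; have /subvPn[k kK kH] := KH.
have eV := hyperplane_addv_line hyp (subvP KV _ kK) kH.
split=> //; first by rewrite plt_vsubE HV; apply: contra kH => /subvP; apply; exact: subvP KV _ kK.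
by apply/eqP; rewrite eqEsubv subv_add HV KV -{1}eV addvS // -memvE.
Qed.

Lemma constructible_cap_supplements N : con N S0.
Proof.
have SH := hyperplane_supplement; have [_ HV HK _] := SH.
apply: (constructible_lower_conical (vsub_ranked E) N (x := H) (phi := fun W => (W :&: H)%VS)).
- by split=> //; rewrite capvv.
- move=> W [[AW WV _ _] WHK]; split; [|exact: capvSl|exact: capvSr].
  split; last by rewrite -capvA capvv.
  split=> //; first by rewrite subv_cap AW AH.
    rewrite /plt /vsub_le (subv_trans (capvSl _ _) (plt_vsubW WV)).
    apply: contraNneq KH => WH_V; apply: subv_trans KV _; rewrite -WH_V; exact: capvSr.
  by apply: contra LH => LW; apply: subv_trans LW (capvSr _ _).
- by move=> W X _ _ WX; exact: capvS.
Qed.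

Section NotSupplement.
Variable W : {vspace E}.
Hypotheses (SW : S W) (S0W : ~ S0 W).

Lemma not_sub_hyperplane : ~~ (W <= H)%VS.
Proof. by apply/negP => WH; apply: S0W; split=> //; rewrite (capv_idPl WH); case: SW. Qed.

Lemma cap_sub_hyperplane : (W :&: K <= H)%VS.
Proof.
have [_ /andP[WV _] WK _] := SW; apply/negPn; rewrite -(hyperplane_cap_supplement hyp) //.
  by apply/eqP => WHK; apply: S0W.
exact: not_sub_hyperplane.
Qed.

Lemma supplements_upper_part :
  upper_part S0 W = supplements W V (W + (H :&: K))%VS L.
Proof.
have [AW WV WK LW] := SW; have W_le_V := plt_vsubW WV; have WH := not_sub_hyperplane.
have swap X : (W <= X)%VS -> (X <= V)%VS -> (X + K)%VS = V ->
    ((X :&: H) + K == V)%VS = (X + (W + (H :&: K)) == V)%VS.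
  move=> WX XV XK; have XH : ~~ (X <= H)%VS by apply: contra WH; exact: subv_trans.
  rewrite addvA (addv_idPl WX) hyperplane_cap_supplement // capvC.
  by rewrite (addvC X) (capvC H) hyperplane_cap_supplement // addvC.
apply/seteqP; split=> X /=.
  move=> [[[AX XV XK LX] XHK] /andP[WX _]]; split=> //; apply/eqP.
  by rewrite -swap ?XHK //; case/andP: XV.
move=> [WX XV XWHK LX]; have X_le_V := plt_vsubW XV.
have XK : (X + K)%VS = V.
  by apply/eqP; rewrite eqEsubv subv_add X_le_V KV -{1}WK addvS.
have X0 : S0 X by split; [split=> //; exact: subv_trans WX|apply/eqP; rewrite swap ?XWHK].
split=> //; rewrite /plt /vsub_le WX; apply: contra_not_neq S0W => ->; exact: X0.
Qed.

Lemma supplements_dim : (\dim K - \dim A <=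
  (\dim (W :&: K) - \dim A + (\dim (W + (H :&: K)) - \dim W)).+1)%N.
Proof.
have [AW /andP[WV _] _ _] := SW; have [HV /eqP dV] := andP hyp.
have dHK : (\dim K <= (\dim (H :&: K)).+1)%N.
  have := dimv_sum_cap H K; have : (\dim (H + K) <= \dim V)%N by rewrite dimvS // subv_add HV.
  by rewrite dV; clear; lia.
have := dimv_sum_cap W (H :&: K)%VS; rewrite capvA (capvC W) -capvA (capv_idPr cap_sub_hyperplane).
have : (\dim A <= \dim (W :&: K))%N by rewrite dimvS // subv_cap AW.
by have := dimvS (addvSl W (H :&: K)); move: dHK; clear; lia.
Qed.

End NotSupplement.

End HyperplaneInduction.

(* Those [W] with [(W :&: H) + K = V] contract conically to a hyperplane [H] of [V] through [A]
   containing neither [K] nor [L]; the other [W] are attached by increasing dimension, along joins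
   of smaller instances. *)
Lemma constructible_supplements A V K L : (A <= K)%VS -> (K <= V)%VS -> ~~ (L <= A)%VS ->
  con (\dim K - \dim A) (supplements A V K L).
Proof.
have [n] := ubnP (\dim V - \dim A)%N; elim: n A V K L => // n IH A V K L dAV AK KV LA.
have AV := subv_trans AK KV; have [KA|KA] := boolP (K <= A)%VS.
  by have /eqP -> : (\dim K - \dim A == 0)%N; [rewrite subn_eq0 dimvS|exact: constructible_zero].
have [K_V|K_neq_V] := eqVneq K V.
  apply: (constructible_least _ (x := A)) => [|W []//].
  by split=> //; [rewrite plt_vsubE AV -K_V|rewrite K_V; exact/addv_idPr].
have /subvPn[y yK yA] := KA; have /subvPn[z zL zA] := LA.
have [H [AH hyp yH zH]] := hyperplane_avoiding2 AV (subvP KV _ yK) yA zA.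
have KH : ~~ (K <= H)%VS by apply/subvPn; exists y.
have LH : ~~ (L <= H)%VS by apply/subvPn; exists z.
have con_S0 := constructible_cap_supplements KV AH hyp KH LH (\dim K - \dim A).
apply: (attach_increasing (vsub_ranked E) _ con_S0) => [W []//|W SW S0W].
 have [AW WV WK LW] := SW; have W_le_V := plt_vsubW WV.
have AWlt : plt (@vsub_le F E) A W.
  rewrite /plt /vsub_le AW; apply: contraNneq K_neq_V => A_W.
  by rewrite -WK -A_W; exact/eqP/esym/addv_idPr.
have dAW := plt_vsub_dim AWlt; have dWV := plt_vsub_dim WV.
exists (\dim (W :&: K) - \dim A)%N, (\dim (W + (H :&: K)) - \dim W)%N; split.
- exact (supplements_dim AK KV hyp SW S0W).
- rewrite supplements_lower_part //; apply: IH => //; [|by rewrite subv_cap AW|exact: capvSl].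
  by move: dAV dAW dWV; clear; lia.
rewrite (supplements_upper_part KV hyp KH SW S0W); apply: IH => //; [|exact: addvSl|].
  by move: dAV dAW dWV; clear; lia.
by rewrite subv_add W_le_V (subv_trans (capvSr _ _)).
Qed.

Definition between A V : set {vspace E} :=
  [set W | plt (@vsub_le F E) A W /\ plt (@vsub_le F E) W V].

Lemma between_lower_part A V W : between A V W -> lower_part (between A V) W = between A W.
Proof.
move=> [AW WV]; apply/seteqP; split=> X [] => [[AX _]|AX] XW; split=> //; split=> //.
exact: (plt_trans (@subv_trans _ _) (@subv_anti _ _) XW WV).
Qed.

Lemma constructible_between A V : (A <= V)%VS -> con (\dim V - \dim A).-1 (between A V).
Proof.
have [n] := ubnP (\dim V); elim: n V => // n IH V dV AV.
have [VA|] := boolP (V <= A)%VS.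
  by have := dimvS VA; rewrite -subn_eq0 => /eqP ->; exact: constructible_zero.
move=> /subvPn[y yV yA].
pose S0 := [set W | between A V W /\ (W + <[y]>)%VS <> V].
have A_lt W : (A <= W)%VS -> plt (@vsub_le F E) A (W + <[y]>)%VS.
  move=> AW; rewrite plt_vsubE (subv_trans AW (addvSl _ _)).
  by apply: contra yA => WA; exact: subvP WA _ (memv_addv_line _ _).
have [Ay_V|Ay_neq_V] := eqVneq (A + <[y]>)%VS V.
  have -> : (\dim V - \dim A).-1 = 0%N by rewrite -Ay_V dim_addv_line // subSnn.
  exact: constructible_zero.
have S0_add W : (A <= W)%VS -> (W <= V)%VS -> (W + <[y]>)%VS <> V -> S0 (W + <[y]>)%VS.
  move=> AW WV WyV; split; last by rewrite -addvA addvv.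
  by split; [exact: A_lt|rewrite /plt /vsub_le subv_add WV -memvE yV; exact/eqP].
apply: (attach_increasing (vsub_ranked E) (S0 := S0)) => [W []//||W bW S0W].
  apply: (constructible_upper_conical (vsub_ranked E) _ (x := (A + <[y]>)%VS)
    (phi := fun W => (W + <[y]>)%VS)).
  - by apply: S0_add => //; exact/eqP.
  - move=> W [[/andP[AW _] /andP[WV _]] WyV].
    by split; [exact: S0_add|exact: addvSl|exact: addvS].
  - by move=> W X _ _ WX; exact: addvS.
have [/andP[AW _] WV] := bW; have Wy_V : (W + <[y]>)%VS = V.
  by apply: contrapT => Wy_V; apply: S0W.
exists (\dim W - \dim A).-1, 0%N; split; last exact: constructible_zero.
  by have := dim_addv_line_le W y; rewrite Wy_V; clear; lia.
rewrite between_lower_part //; apply: IH => //.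
by have := plt_vsub_dim WV; move: dV; clear; lia.
Qed.

End LinearComplexes.

(** * Formed spaces *)

Section Forms.
Variables (F : fieldType) (E : vectType F).
Variables (sigma : {rmorphism F -> F}) (eps : F) (Lambda : pred F) (q : E -> E -> F).
Hypotheses (params : form_parameters sigma eps Lambda) (sesq : sesquilinear sigma q).
Implicit Types (A M U V W X Y Z : {vspace E}) (u v w x y z : E) (N : nat).

Local Notation omega := (omega sigma eps q).
Local Notation Qzero := (Qzero Lambda q).
Local Notation isotropic := (isotropic sigma eps Lambda q).

(* [Lambda] need not be stable under [c |-> sigma a * c * a], so [Qzero v] does not imply
   [Qzero (a *: v)]. *)
Definition singular v : Prop := forall a, Qzero (a *: v).

Lemma omegaC v w : omega w v = eps * sigma (omega v w).
Proof.
have [sigmaK eps1 _ _ _] := params.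
by rewrite /Defs.omega rmorphD rmorphM sigmaK mulrDr mulrA eps1 mul1r addrC.
Qed.

Lemma omega_eq0C v w : omega v w = 0 -> omega w v = 0.
Proof. by move=> vw0; rewrite omegaC vw0 rmorph0 mulr0. Qed.

Lemma omegaDr u v w : omega u (v + w) = omega u v + omega u w.
Proof.
by have [qDl qDr _] := sesq; rewrite /Defs.omega qDl qDr rmorphD mulrDr addrACA.
Qed.

Lemma omegaZr u a v : omega u (a *: v) = omega u v * a.
Proof.
have [_ _ qZ] := sesq; have [sigmaK _ _ _ _] := params.
rewrite /Defs.omega -{1 2}(scale1r u) !qZ rmorph1 mul1r mulr1 rmorphM sigmaK.
by rewrite mulrDl (mulrC a) mulrA.
Qed.

Lemma omegaDl u v w : omega (u + v) w = omega u w + omega v w.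
Proof. by rewrite omegaC omegaDr rmorphD mulrDr -!omegaC. Qed.

Lemma omegaZl a u v : omega (a *: u) v = sigma a * omega u v.
Proof. by rewrite omegaC omegaZr rmorphM mulrA -omegaC mulrC. Qed.

Lemma omegaBr u v w : omega u (v - w) = omega u v - omega u w.
Proof. by rewrite omegaDr -scaleN1r omegaZr mulrN1. Qed.

Lemma omegaBl u v w : omega (u - v) w = omega u w - omega v w.
Proof. by rewrite omegaDl -scaleN1r omegaZl rmorphN1 mulN1r. Qed.

Lemma omega0l v : omega 0 v = 0.
Proof. by rewrite -(scale0r 0) omegaZl rmorph0 mul0r. Qed.

Lemma singular_omega v : singular v -> omega v v = 0.
Proof. by have [_ _ _ _ Lambda_sub] := params => /(_ 1); rewrite scale1r => /Lambda_sub. Qed.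

Lemma singularZ a v : singular v -> singular (a *: v).
Proof. by move=> sv b; rewrite scalerA. Qed.

Lemma LambdaD a b : a \in Lambda -> b \in Lambda -> a + b \in Lambda.
Proof.
have [_ _ LambdaB Lambda_sup _] := params => La Lb.
have L0 : 0 \in Lambda by have := Lambda_sup 0; rewrite rmorph0 mulr0 subrr.
by rewrite -(opprK b) LambdaB // -sub0r LambdaB.
Qed.

Lemma QzeroD u v : omega u v = 0 -> Qzero u -> Qzero v -> Qzero (u + v).
Proof.
have [qDl qDr _] := sesq; have [_ _ _ Lambda_sup _] := params.
rewrite /Defs.omega /Defs.Qzero => uv0 Qu Qv; rewrite qDl !qDr.
have -> : q u u + q u v + (q v u + q v v) = (q u u + q v v) + (q v u - eps * sigma (q v u)).
  by have -> : q u v = - (eps * sigma (q v u)); [apply/eqP; rewrite -addr_eq0 uv0|ring].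
by apply: LambdaD; [exact: LambdaD|].
Qed.

Lemma singularD u v : omega u v = 0 -> singular u -> singular v -> singular (u + v).
Proof.
by move=> uv0 su sv a; rewrite scalerDr; apply: QzeroD; rewrite // omegaZl omegaZr uv0 mul0r mulr0.
Qed.

(* Solves [q (v + c *: u) (v + c *: u) = 0] modulo [Lambda], which is linear in [sigma c]. *)
Lemma singular_translate u v : singular u -> omega u v != 0 -> exists c, singular (v + c *: u).
Proof.
have [qDl qDr qZ] := sesq; have [sigmaK _ _ Lambda_sup _] := params.
move=> su uv; have [d vd0] : exists d, q v v + d * omega u v = 0.
  by exists (- q v v / omega u v); rewrite divfK // subrr.
exists (sigma d) => a.
have qZr b x y : q x (b *: y) = q x y * b by rewrite -{1}(scale1r x) qZ rmorph1 mul1r.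
have qZl b x y : q (b *: x) y = sigma b * q x y by rewrite -{1}(scale1r y) qZ mulr1.
pose X := sigma a * (q v u * sigma d) * a.
have := su (a * sigma d); rewrite /Defs.Qzero scalerDr scalerA qDl !qDr => Qadu.
have -> : q (a *: v) (a *: v) + q (a *: v) ((a * sigma d) *: u) +
    (q ((a * sigma d) *: u) (a *: v) + q ((a * sigma d) *: u) ((a * sigma d) *: u)) =
  sigma a * (q v v + d * omega u v) * a + (X - eps * sigma X) +
    q ((a * sigma d) *: u) ((a * sigma d) *: u).
  by rewrite !qZl !qZr /X /Defs.omega !rmorphM !sigmaK; ring.
by rewrite vd0 mulr0 mul0r add0r; exact: LambdaD.
Qed.

Section OrthogonalComplement.
Variable U : {vspace E}.

Definition pairing v : 'rV[F]_(\dim U) := \row_i omega (vbasis U)`_i v.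

Lemma pairing_linear : linear pairing.
Proof. by move=> a v w; apply/rowP => i; rewrite !mxE omegaDr omegaZr mulrC. Qed.

HB.instance Definition _ := GRing.isLinear.Build F E 'rV[F]_(\dim U) _ pairing pairing_linear.

Definition orth : {vspace E} := lker (linfun pairing).

Lemma orthP v : v \in orth <-> forall u, u \in U -> omega u v = 0.
Proof.
rewrite memv_ker lfunE /=; split=> [/eqP v0 u uU|v0].
  rewrite (coord_vbasis uU); elim/big_ind: _ => [|x y x0 y0|i _]; first exact: omega0l.
    by rewrite omegaDl x0 y0 addr0.
  have := congr1 (fun r : 'rV_(\dim U) => r ord0 i) v0; rewrite !mxE omegaZl => ->.
  exact: mulr0.
apply/eqP/rowP => i; rewrite !mxE; apply: v0; apply: vbasis_mem.
by apply: mem_nth; rewrite size_tuple.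
Qed.

Lemma dim_cap_orth M : (\dim M <= \dim (M :&: orth) + \dim U)%N.
Proof.
rewrite -(limg_ker_dim (linfun pairing) M) leq_add2l.
by apply: leq_trans (dimvS (subvf _)) _; rewrite dimvf /dim /= mul1n.
Qed.

End OrthogonalComplement.

Lemma orth_omega U u v : v \in orth U -> u \in U -> omega u v = 0.
Proof. by move/orthP; apply. Qed.

Lemma orth_omegaC U u v : v \in orth U -> u \in U -> omega v u = 0.
Proof. by move=> vU uU; apply: omega_eq0C; exact: orth_omega vU uU. Qed.

Lemma orthS U V : (U <= V)%VS -> (orth V <= orth U)%VS.
Proof. by move=> /subvP UV; apply/subvP => v /orthP vV; apply/orthP => u /UV/vV. Qed.

Lemma sub_orthC U V : (U <= orth V)%VS = (V <= orth U)%VS.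
Proof.
suff imp X Y : (X <= orth Y)%VS -> (Y <= orth X)%VS by apply/idP/idP; exact: imp.
by move=> /subvP XY; apply/subvP => v vY; apply/orthP => u /XY uY; exact: orth_omegaC uY vY.
Qed.

Lemma mem_orth_line z v : v \in orth <[z]>%VS <-> omega z v = 0.
Proof.
split=> [/orthP|zv]; first by apply; exact: memv_line.
by apply/orthP => _ /vlineP[c ->]; rewrite omegaZl zv mulr0.
Qed.

Lemma sub_orth_line z W : (W <= orth <[z]>)%VS = (z \in orth W).
Proof. by rewrite sub_orthC -memvE. Qed.

Lemma orth_addv U V : orth (U + V) = (orth U :&: orth V)%VS.
Proof.
apply/eqP; rewrite eqEsubv subv_cap !orthS ?addvSl ?addvSr //=.
apply/subvP => v; rewrite memv_cap => /andP[vU vV]; apply/orthP => _ /memv_addP[a aU [b bV ->]].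
by rewrite omegaDl (orth_omega vU) // (orth_omega vV) // addr0.
Qed.

Lemma orth_dim_exchange M W :
  (\dim M + \dim (W :&: orth M) = \dim W + \dim (M :&: orth W))%N.
Proof.
suff half X Y : (\dim X + \dim (Y :&: orth X) <= \dim Y + \dim (X :&: orth Y))%N.
  by apply/eqP; rewrite eqn_leq !half.
pose C := (Y :\: orth X)%VS; have dC := dimv_cap_compl Y (orth X); rewrite -/C in dC.
have -> : (X :&: orth Y = X :&: orth C)%VS.
  rewrite -{1}(addv_diff_cap Y (orth X)) orth_addv capvA; apply/capv_idPl.
  by apply: subv_trans (capvSl _ _) _; rewrite sub_orthC capvSr.
by have := dim_cap_orth C X; move: dC; clear; lia.
Qed.

Definition kernel : {vspace E} := orth fullv.

Lemma kernel_omega u v : v \in kernel -> omega u v = 0.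
Proof. by move=> vK; apply: orth_omega vK _; exact: memvf. Qed.

Lemma kernelP v : v \in kernel <-> Kset sigma eps q v.
Proof. by split=> [vK u|vK]; [exact: kernel_omega|apply/orthP => u _; exact: vK]. Qed.

Lemma kernel_sub_orth U : (kernel <= orth U)%VS.
Proof. by apply: orthS; exact: subvf. Qed.

Lemma double_orth X : orth (orth X) = (X + kernel)%VS.
Proof.
apply/esym/eqP; rewrite eqEdim subv_add kernel_sub_orth andbT sub_orthC subvv /=.
have := orth_dim_exchange fullv X; have := orth_dim_exchange fullv (orth X).
rewrite !capfv -!/kernel (capv_idPr (kernel_sub_orth X)).
by have := dimv_sum_cap X kernel; clear; lia.
Qed.

Lemma orth_separates X u : u \notin (X + kernel)%VS -> exists2 v, v \in orth X & omega u v != 0.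
Proof.
move=> uX; apply: contrapT => not_sep; case/negP: uX; rewrite -double_orth; apply/orthP => v vX.
by apply: omega_eq0C; apply: contrapT => /eqP uv; apply: not_sep; exists v.
Qed.

Lemma dim_cap_orth_line M z : (\dim M <= (\dim (M :&: orth <[z]>)).+1)%N.
Proof. by have := dim_cap_orth <[z]>%VS M; rewrite dim_vline; case: (z != 0); clear; lia. Qed.

Lemma orth_cap_orth_line W w x : x \in orth (W :&: orth <[w]>) -> exists c, x - c *: w \in orth W.
Proof.
have [sigmaK _ _ _ _] := params; move=> xo.
have [Wo|/subvPn[v0 v0W v0o]] := boolP (W <= orth <[w]>)%VS.
  by exists 0; rewrite scale0r subr0 -(capv_idPl Wo).
have wv0 : omega w v0 != 0 by apply: contra v0o => /eqP ?; apply/mem_orth_line.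
exists (sigma (omega x v0 / omega w v0)); apply/orthP => v vW; apply: omega_eq0C.
have : omega x (v - (omega w v / omega w v0) *: v0) = 0.
  apply: orth_omegaC xo _; rewrite memv_cap rpredB ?memvZ //=; apply/mem_orth_line.
  by rewrite omegaBr omegaZr mulrC divfK // subrr.
rewrite omegaBr omegaZr => /eqP; rewrite subr_eq0 => /eqP xv.
by rewrite omegaBl omegaZl sigmaK xv; field.
Qed.

Lemma isotropicP W : isotropic W <->
  (forall v w, v \in W -> w \in W -> omega v w = 0) /\ (forall v, v \in W -> singular v).
Proof.
split=> -[W0 WQ]; split=> // v vW; first by move=> a; apply: WQ; rewrite memvZ.
by have := WQ v vW 1; rewrite scale1r.
Qed.

Lemma isotropic_singular W v : isotropic W -> v \in W -> singular v.
Proof. by move=> /isotropicP[_]; apply. Qed.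

Lemma isotropicS W V : (W <= V)%VS -> isotropic V -> isotropic W.
Proof.
by move=> /subvP WV [V0 VQ]; split=> [v w /WV vV /WV|v /WV]; [exact: V0|exact: VQ].
Qed.

Lemma isotropic_sub_orth W : isotropic W -> (W <= orth W)%VS.
Proof. by move=> [W0 _]; apply/subvP => v vW; apply/orthP => u uW; exact: W0. Qed.

Lemma isotropic_addv V W : isotropic V -> isotropic W -> (W <= orth V)%VS -> isotropic (V + W).
Proof.
move=> isoV isoW /subvP WV; have [V0 _] := isoV; have [W0 _] := isoW; apply/isotropicP; split.
  move=> _ _ /memv_addP[a aV [b bW ->]] /memv_addP[c cV [d dW ->]].
  rewrite omegaDl !omegaDr [omega a c]V0 // [omega b d]W0 //.
  by rewrite (orth_omega (WV _ dW)) // (orth_omegaC (WV _ bW)) // !addr0.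
move=> _ /memv_addP[a aV [b bW ->]].
apply: singularD (orth_omega (WV _ bW) aV) _ _; first exact: isotropic_singular isoV aV.
exact: isotropic_singular isoW bW.
Qed.

Lemma isotropic_line v : singular v -> isotropic <[v]>.
Proof.
move=> sv; apply/isotropicP; split; last by move=> _ /vlineP[a ->]; exact: singularZ.
by move=> _ _ /vlineP[a ->] /vlineP[b ->]; rewrite omegaZl omegaZr singular_omega // mul0r mulr0.
Qed.

Lemma isotropic_addv_line W v : isotropic W -> singular v -> v \in orth W -> isotropic (W + <[v]>).
Proof. by move=> isoW sv vW; apply: isotropic_addv; rewrite -?memvE //; exact: isotropic_line. Qed.

Lemma isotropic_extend W M : isotropic W -> isotropic M -> (\dim W < \dim M)%N ->
  exists v, [/\ v \in orth W, singular v & v \notin W].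
Proof.
move=> isoW isoM dWM; have /subvPn[v] : ~~ (M :&: orth W <= W)%VS.
  apply/negP => MW; have := orth_dim_exchange M W.
  have : (\dim (M :&: orth W) <= \dim (W :&: orth M))%N.
    by rewrite dimvS // subv_cap MW (subv_trans (capvSl _ _)) // isotropic_sub_orth.
  by move: dWM; clear; lia.
by rewrite memv_cap => /andP[vM vW] v_notin_W; exists v; split=> //; exact: isotropic_singular vM.
Qed.

Local Notation le := (@vsub_le F E).
Local Notation con := (constructible (comparability le)).
Local Notation lower_part := (lower_part le).
Local Notation upper_part := (upper_part le).

Definition opposite A Z : set {vspace E} :=
  [set W | [/\ isotropic W, (A <= W)%VS & (Z :&: orth W)%VS = 0%VS]].

Lemma cap0_sub Z X Y : (X <= Y)%VS -> (Z :&: Y)%VS = 0%VS -> (Z :&: X)%VS = 0%VS.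
Proof. by move=> XY ZY; apply/eqP; rewrite -subv0 -ZY capvS. Qed.

Lemma opposite_upward A Z V W : opposite A Z V -> isotropic W -> (V <= W)%VS -> opposite A Z W.
Proof.
move=> [_ AV ZV] isoW VW; split=> //; first exact: subv_trans VW.
by apply: cap0_sub ZV; exact: orthS.
Qed.

Lemma opposite_dim A Z V : opposite A Z V -> (\dim (V :&: orth Z) + \dim Z = \dim V)%N.
Proof.
by move=> [_ _ ZV]; have := orth_dim_exchange Z V; rewrite ZV dimv0 addn0 addnC.
Qed.

Lemma opposite_lower_part A Z V : (Z <= orth A)%VS -> opposite A Z V ->
  lower_part (opposite A Z) V = supplements A V (V :&: orth Z)%VS V.
Proof.
move=> ZA oppV; have [isoV AV ZV] := oppV; apply/seteqP; split=> W /=.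
  move=> [oppW W_lt]; have [_ AW _] := oppW; have WV := plt_vsubW W_lt; split=> //.
    apply/eqP; rewrite eqEdim subv_add WV capvSl /=.
    have := dimv_sum_cap W (V :&: orth Z)%VS; rewrite capvA (capv_idPl WV).
    by have := opposite_dim oppW; have := opposite_dim oppV; clear; lia.
  by move: W_lt; rewrite plt_vsubE WV.
move=> [AW W_lt WZ _]; have WV := plt_vsubW W_lt; split=> //; split=> //.
  exact: isotropicS WV isoV.
apply/eqP; rewrite -subv0 -ZV subv_cap capvSl /= -WZ orth_addv subv_cap capvSr /=.
by rewrite sub_orthC; exact: subv_trans (capvSr _ _) (orthS (capvSl _ _)).
Qed.

Lemma mem_opposite_line A z W : z != 0 ->
  opposite A <[z]> W <-> [/\ isotropic W, (A <= W)%VS & z \notin orth W].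
Proof.
move=> z0; split=> [[isoW AW zW]|[isoW AW zW]]; split=> //.
  apply: contra z0 => z_orth; rewrite -memv0 -zW memv_cap memv_line; exact: z_orth.
apply/eqP; rewrite -subv0; apply/subvP => x; rewrite memv_cap => /andP[/vlineP[c ->]].
by rewrite rpredZeq (negPf zW) orbF => /eqP ->; rewrite scale0r mem0v.
Qed.

Section MaximalIsotropic.
Variable M : {vspace E}.
Hypotheses (isoM : isotropic M) (maxM : forall W, isotropic W -> (\dim W <= \dim M)%N).

Definition isotropic_above A : set {vspace E} := [set W | isotropic W /\ plt le A W].

Section AboveStep.
Variables (A : {vspace E}) (v : E).
Hypotheses (isoA : isotropic A) (sv : singular v) (vA : v \in orth A) (v_notin_A : v \notin A).

Let o := orth <[v]>%VS.
Let S0 : set {vspace E} := [set W | isotropic_above A W /\ ~~ (W :&: o <= A)%VS].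

Let vo : v \in o. Proof. by apply/mem_orth_line; exact: singular_omega. Qed.
Let Ao : (A <= o)%VS. Proof. by rewrite sub_orth_line. Qed.

Lemma constructible_isotropic_above_in_orth N : con N [set W | isotropic_above A W /\ (W <= o)%VS].
Proof.
have above_addv W : isotropic W -> (A <= W)%VS -> (W <= o)%VS ->
    isotropic_above A (W + <[v]>)%VS /\ (W + <[v]> <= o)%VS.
  move=> isoW AW Wo; split; last by rewrite subv_add Wo -memvE.
  split; first by apply: isotropic_addv_line; rewrite -?sub_orth_line.
  rewrite plt_vsubE (subv_trans AW (addvSl _ _)); apply: contra v_notin_A => WA.
  exact: subvP WA _ (memv_addv_line _ _).
apply: (constructible_upper_conical (vsub_ranked E) N (x := (A + <[v]>)%VS)
  (phi := fun W => (W + <[v]>)%VS)).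
- exact: above_addv.
- move=> W [[isoW /plt_vsubW AW] Wo].
  by split; [exact: above_addv|exact: addvSl|exact: addvS].
- by move=> W X _ _ WX; exact: addvS.
Qed.

Lemma constructible_isotropic_above_cap N : con N S0.
Proof.
have con_in_orth := constructible_isotropic_above_in_orth N.
apply: (constructible_lower_retract (vsub_ranked E) (phi := fun W => (W :&: o)%VS)) con_in_orth.
- move=> W [aW Wo]; split=> //; rewrite (capv_idPl Wo).
  by case: aW => _; rewrite plt_vsubE => /andP[].
- move=> W [[isoW /plt_vsubW AW] WoA]; split; last exact: capvSl.
  split; last exact: capvSr.
  by split; [exact: isotropicS (capvSl _ _) isoW|rewrite plt_vsubE subv_cap AW Ao].
- by move=> W X _ _ WX; exact: capvS.
Qed.

Lemma isotropic_above_dim V : isotropic_above A V -> ~ S0 V -> \dim V = (\dim A).+1.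
Proof.
move=> aV S0V; have VoA : (V :&: o <= A)%VS by apply: contrapT => /negP VoA; apply: S0V.
have := dim_cap_orth_line V v; have := dimvS VoA.
by case: aV => _ /plt_vsub_dim; rewrite -/o; clear; lia.
Qed.

Lemma isotropic_above_upper_part V : isotropic_above A V -> ~ S0 V ->
  upper_part S0 V = isotropic_above V.
Proof.
move=> aV S0V; have dV := isotropic_above_dim aV S0V; have [_ AV] := aV.
apply/seteqP; split=> W /=; first by move=> [[[isoW _] _] VW].
move=> [isoW VW]; split=> //; split.
  split=> //; exact: (plt_trans (@subv_trans _ _) (@subv_anti _ _) AV VW).
apply/negP => /dimvS; have := dim_cap_orth_line W v; have := plt_vsub_dim VW; rewrite dV -/o.
by clear; lia.
Qed.

End AboveStep.

Lemma constructible_isotropic_above A N : isotropic A -> (N + \dim A <= \dim M)%N ->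
  con N (isotropic_above A).
Proof.
elim: N A => [|N IH] A isoA dA; first exact: constructible_zero.
have [|v [vA sv v_notin_A]] := isotropic_extend isoA isoM; first by move: dA; clear; lia.
have con_S0 := constructible_isotropic_above_cap isoA sv vA v_notin_A N.+1.
apply: (attach_increasing (vsub_ranked E) _ con_S0) => [W []//|V aV S0V].
exists 0%N, N; split; [exact: leqnn|exact: constructible_zero|].
rewrite (isotropic_above_upper_part aV S0V); apply: IH; first by case: aV.
by rewrite (isotropic_above_dim aV S0V); move: dA; clear; lia.
Qed.

Definition radical : {vspace E} := (M :&: kernel)%VS.

Lemma memv_radical v : v \in radical <-> v \in kernel /\ singular v.
Proof.
rewrite memv_cap; split=> [/andP[vM vK]|[vK sv]]; first by split=> //; exact: isotropic_singular vM.
rewrite vK andbT; apply/negPn/negP => vM.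
have := maxM (isotropic_addv_line isoM sv (subvP (kernel_sub_orth M) _ vK)).
by rewrite dim_addv_line // ltnn.
Qed.

Section OppositeStep.
Variables (A Z Z' : {vspace E}) (z w : E).
Hypotheses (radA : (radical <= A)%VS) (ZA : (Z <= orth A)%VS) (Z'zE : (Z' + <[z]>)%VS = Z).
Hypotheses (ZZ' : (Z <= orth Z')%VS) (wA : w \in orth A) (wZ' : w \in orth Z').
Hypotheses (sw : singular w) (zw : omega z w != 0).

Let S := opposite A Z.
Let o := orth <[w]>%VS.
Let Scap : set {vspace E} := [set W | S W /\ S (W :&: o)%VS].

Let wo : w \in o. Proof. by apply/mem_orth_line; exact: singular_omega. Qed.
Let Ao : (A <= o)%VS. Proof. by rewrite sub_orth_line. Qed.

Lemma opposite_containing : [set W | S W /\ w \in W] = opposite (A + <[w]>) Z'.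
Proof.
apply/seteqP; split=> W /=.
  move=> [[isoW AW ZW] wW]; split=> //; first by rewrite subv_add AW -memvE.
  by apply/eqP; rewrite -subv0 -ZW capvS // -Z'zE addvSl.
move=> [isoW]; rewrite subv_add -memvE => /andP[AW wW] Z'W; split=> //; split=> //.
apply/eqP; rewrite -subv0; apply/subvP => x; rewrite memv_cap => /andP[xZ xW].
rewrite -Z'W memv_cap xW andbT; move: (xZ).
rewrite -Z'zE => /memv_addP[z' z'Z' [_ /vlineP[c ->] x_sum]].
have := orth_omegaC xW wW; rewrite x_sum omegaDl omegaZl (orth_omega wZ' z'Z').
rewrite add0r => /eqP; rewrite mulf_eq0 (negPf zw) orbF fmorph_eq0 => /eqP ->.
by rewrite scale0r addr0.
Qed.

Lemma constructible_opposite_in_orth N :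
  con N (opposite (A + <[w]>) Z') -> con N [set W | S W /\ (W <= o)%VS].
Proof.
rewrite -opposite_containing.
apply: (constructible_upper_retract (vsub_ranked E) (phi := fun W => (W + <[w]>)%VS)).
- move=> W [SW wW]; split=> //; rewrite sub_orth_line.
  by case: SW => /isotropic_sub_orth/subvP/(_ w wW).
- move=> W [SW Wo]; split; last exact: addvSl; split; last exact: memv_addv_line.
  apply: (opposite_upward SW); last exact: addvSl.
  by apply: isotropic_addv_line; rewrite -?sub_orth_line //; case: SW.
- by move=> W X _ _ WX; exact: addvS.
Qed.

Lemma constructible_opposite_cap N : con N (opposite (A + <[w]>) Z') -> con N Scap.
Proof.
move=> /constructible_opposite_in_orth.
apply: (constructible_lower_retract (vsub_ranked E) (phi := fun W => (W :&: o)%VS)).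
- by move=> W [SW Wo]; split=> //; rewrite (capv_idPl Wo).
- by move=> W [SW SWo]; split; [split=> //; exact: capvSr|exact: capvSl].
- by move=> W X _ _ WX; exact: capvS.
Qed.

Definition offset W x := [/\ x \in Z, x != 0 & w - x \in orth W].

Lemma offsetS V W x : (W <= V)%VS -> offset V x -> offset W x.
Proof. by move=> WV [xZ x0 xV]; split=> //; move: xV; apply: subvP; exact: orthS. Qed.

Lemma offset_unique W x y : S W -> offset W x -> offset W y -> x = y.
Proof.
move=> [_ _ ZW] [xZ _ xW] [yZ _ yW]; apply/eqP; rewrite -subr_eq0 -memv0 -ZW memv_cap rpredB //=.
by have -> : x - y = (w - y) - (w - x); [rewrite opprB [RHS]addrC addrA subrK|exact: rpredB].
Qed.

Lemma offset_not_cap V x : offset V x -> ~ Scap V.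
Proof.
move=> [xZ x0 xV] [_ [_ _ ZVo]]; case/negP: x0; rewrite -memv0 -ZVo memv_cap xZ /=.
apply/orthP => v; rewrite memv_cap => /andP[vV /mem_orth_line wv].
have := orth_omega xV vV; rewrite omegaBr (omega_eq0C wv) sub0r => /eqP.
by rewrite oppr_eq0 => /eqP.
Qed.

Lemma offset_exists V : S V -> ~ Scap V -> exists x, offset V x.
Proof.
move=> SV not_cap; have [isoV AV ZV] := SV.
have [x0 [x0Z x00 x0o]] : exists x0, [/\ x0 \in Z, x0 != 0 & x0 \in orth (V :&: o)].
  apply: contrapT => no_x0; apply: not_cap; split=> //; split.
  - exact: isotropicS (capvSl _ _) isoV.
  - by rewrite subv_cap AV.
  - apply/eqP; rewrite -subv0; apply/subvP => x; rewrite memv_cap memv0 => /andP[xZ xo].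
    by apply: contrapT => /negP x0; apply: no_x0; exists x.
have [c x0cw] := orth_cap_orth_line x0o.
have c0 : c != 0.
  apply: contraNneq x00 => c0; rewrite -memv0 -ZV memv_cap x0Z /=.
  by move: x0cw; rewrite c0 scale0r subr0.
exists (c^-1 *: x0); split; first by rewrite memvZ.
  by rewrite scaler_eq0 invr_eq0 negb_or c0.
have -> : w - c^-1 *: x0 = - (c^-1 *: (x0 - c *: w)).
  by rewrite scalerBr scalerA mulVf // scale1r opprB.
by rewrite rpredN memvZ.
Qed.

Lemma first_round_upper_part V x : S V -> offset V x -> w - x != 0 ->
  upper_part Scap V = opposite V <[w - x]>.
Proof.
move=> SV offV y0; have [xZ x0 _] := offV; apply/seteqP; split=> W /=.
  move=> [capW /plt_vsubW VW]; apply/mem_opposite_line => //.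
  split=> //; first by case: capW => -[].
  by apply/negP => yW; apply: (@offset_not_cap W x) capW.
move=> /(mem_opposite_line _ _ y0)[isoW VW yW]; have SW := opposite_upward SV isoW VW; split.
  apply: contrapT => /(offset_exists SW)[x' offW]; case/negP: yW.
  by rewrite (offset_unique SV offV (offsetS VW offW)); case: offW.
rewrite /plt /vsub_le VW; apply: contraNneq yW => <-.
by case: offV.
Qed.

(* The members of [opposite A Z] present after the first round of attachments; those outside [Scap]
   are the ones with an offset. *)
Let Sfirst : set {vspace E} :=
  [set W | S W /\ forall x, offset W x -> w - x \notin (W + kernel)%VS].

Lemma cap_sub_first_round : Scap `<=` Sfirst.
Proof. by move=> W capW; split=> [|x /offset_not_cap]; [case: capW|]. Qed.

Lemma first_round_lower_part V x : Sfirst V -> offset V x -> lower_part Sfirst V = lower_part S V.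
Proof.
move=> [SV offV] Vx; apply/seteqP; split=> W [SW W_lt]; first by split=> //; case: SW.
have WV := plt_vsubW W_lt; split=> //; split=> // y Wy.
rewrite (offset_unique SW Wy (offsetS WV Vx)).
by apply: contra (offV x Vx); apply: subvP; exact: addvS.
Qed.

Lemma constructible_opposite_below V L : S V -> ~~ (L <= A)%VS ->
  con (\dim (V :&: orth Z) - \dim A) (supplements A V (V :&: orth Z)%VS L).
Proof.
move=> [_ AV _] LA; apply: constructible_supplements LA; last exact: capvSl.
by rewrite subv_cap AV sub_orthC.
Qed.

Lemma opposite_step_dim N V : (N + \dim A + \dim Z <= (\dim M).+1)%N -> S V ->
  (N <= ((\dim (V :&: orth Z) - \dim A) + (\dim M - \dim V)).+1)%N.
Proof.
move=> dN SV; have [isoV AV _] := SV; have := opposite_dim SV; have := maxM isoV.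
have : (\dim A <= \dim (V :&: orth Z))%N by rewrite dimvS // subv_cap AV sub_orthC.
by move: dN; clear; lia.
Qed.

Lemma opposite_not_below V : S V -> ~~ (V <= A)%VS.
Proof.
move=> [_ AV ZV]; apply/negP => VA; case/eqP: zw.
have zZ : z \in Z by rewrite -Z'zE memv_addv_line.
have : z \in (Z :&: orth V)%VS by rewrite memv_cap zZ (subvP (orthS VA)) // (subvP ZA).
by rewrite ZV memv0 => /eqP ->; exact: omega0l.
Qed.

Section OffsetInKernel.
Variables (V : {vspace E}) (x t k : E).
Hypotheses (SV : S V) (offV : offset V x).
Hypotheses (tV : t \in V) (kK : k \in kernel) (wxE : w - x = t + k).

Lemma offset_notin : t \notin A.
Proof.
apply/negP => tA; have [xZ _ _] := offV; have zZ : z \in Z by rewrite -Z'zE memv_addv_line.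
have omega_tk y : omega y t = 0 -> omega y w = omega y x.
  by move=> yt; apply/eqP; rewrite -subr_eq0 -omegaBr wxE omegaDr yt kernel_omega ?addr0.
have wz0 : omega w z != 0 by apply: contra zw => /eqP wz; apply/eqP; exact: omega_eq0C.
have := omega_tk w (orth_omegaC wA tA); rewrite singular_omega //; move: xZ omega_tk.
rewrite -{1}Z'zE => /memv_addP[z' z'Z' [_ /vlineP[c ->] ->]] omega_tk.
rewrite omegaDr omegaZr (orth_omegaC wZ' z'Z') add0r => /esym/eqP.
rewrite mulf_eq0 (negPf wz0) /= => /eqP c0; case/eqP: zw.
rewrite omega_tk; last exact: omega_eq0C (orth_omega (subvP ZA _ zZ) tA).
by rewrite c0 scale0r addr0; exact: orth_omegaC (subvP ZZ' _ zZ) z'Z'.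
Qed.

Lemma first_round_notin W : S W -> (W <= V)%VS -> Sfirst W <-> t \notin W.
Proof.
move=> SW WV; have offW := offsetS WV offV; split=> [[_ /(_ x offW)]|tW].
  by rewrite wxE; apply: contra => tW; exact: memv_add.
split=> // y offWy; rewrite (offset_unique SW offWy offW) wxE; apply: contra tW.
move=> /memv_addP[s sW [k' k'K tk_sk]].
have tsK : t - s \in kernel.
  suff -> : t - s = k' - k by rewrite rpredB.
  by apply/eqP; rewrite subr_eq addrAC eq_sym subr_eq addrC -tk_sk.
have ts_rad : t - s \in radical.
  apply/memv_radical; split=> //; have [isoV _ _] := SV.
  by apply: (isotropic_singular isoV); rewrite rpredB // (subvP WV).
have [_ AW _] := SW.
by rewrite -(subrK s t) rpredD // (subvP (subv_trans radA AW)).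
Qed.

Lemma second_round_lower_part :
  lower_part Sfirst V = supplements A V (V :&: orth Z)%VS <[t]>%VS.
Proof.
have lowE := opposite_lower_part ZA SV; apply/seteqP; split=> W /=.
  move=> [offW W_lt]; have SW : S W by case: offW.
  have [AW _ WZ _] : supplements A V (V :&: orth Z)%VS V W by rewrite -lowE.
  by split=> //; rewrite -memvE; apply/first_round_notin => //; exact: plt_vsubW.
move=> [AW W_lt WZ]; rewrite -memvE => tW; have WV := plt_vsubW W_lt.
have [SW _] : lower_part S V W by rewrite lowE; split=> //; move: W_lt; rewrite plt_vsubE WV.
by split=> //; apply/first_round_notin.
Qed.

End OffsetInKernel.

Lemma second_round_upper_part V : S V -> upper_part S V = isotropic_above V.
Proof.
move=> SV; apply/seteqP; split=> W /=; first by move=> [[isoW _ _] VW].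
by move=> [isoW VW]; split=> //; exact: opposite_upward SV isoW (plt_vsubW VW).
Qed.

Hypothesis con_line : forall V y N, isotropic V -> (A <= V)%VS -> (\dim A < \dim V)%N ->
  y \in orth V -> y \notin (V + kernel)%VS -> (N + \dim V <= \dim M)%N ->
  con N (opposite V <[y]>).

Lemma constructible_first_round N : (N + \dim A + \dim Z <= (\dim M).+1)%N ->
  con N (opposite (A + <[w]>) Z') -> con N Sfirst.
Proof.
move=> dN /constructible_opposite_cap con_cap.
apply: (attach_increasing (vsub_ranked E) cap_sub_first_round con_cap) => V offV capV.
have SV : S V by case: offV.
have [x Vx] := offset_exists SV capV; have yV := proj2 offV x Vx.
exists (\dim (V :&: orth Z) - \dim A)%N, (\dim M - \dim V)%N; split.
- exact: opposite_step_dim.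
- rewrite (first_round_lower_part offV Vx) opposite_lower_part //.
  by apply: constructible_opposite_below (opposite_not_below SV).
have y0 : w - x != 0 by apply: contraNneq yV => ->; exact: mem0v.
rewrite (first_round_upper_part SV Vx y0); have [isoV AV _] := SV; apply: con_line => //.
- by rewrite plt_vsub_dim // plt_vsubE AV opposite_not_below.
- by case: Vx.
- by rewrite subnK // maxM.
Qed.

Lemma constructible_opposite_step N : (N + \dim A + \dim Z <= (\dim M).+1)%N ->
  con N (opposite (A + <[w]>) Z') -> con N (opposite A Z).
Proof.
move=> dN con_w; have con_first := constructible_first_round dN con_w.
apply: (attach_decreasing (vsub_ranked E) _ con_first) => [W []//|V SV offV].
have [x Vx yV] : exists2 x, offset V x & w - x \in (V + kernel)%VS.
  apply: contrapT => no_x; apply: offV; split=> // x Vx; apply/negP => yV.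
  by apply: no_x; exists x.
have /memv_addP[t tV [k kK wxE]] := yV.
exists (\dim (V :&: orth Z) - \dim A)%N, (\dim M - \dim V)%N; split.
- exact: opposite_step_dim.
- rewrite (second_round_lower_part SV Vx tV kK wxE); apply: constructible_opposite_below => //.
  by rewrite -memvE; exact: offset_notin Vx kK wxE.
rewrite second_round_upper_part //; have [isoV _ _] := SV.
by apply: constructible_isotropic_above; rewrite // subnK // maxM.
Qed.

End OppositeStep.

Lemma isotropic_radical : isotropic radical.
Proof. exact: isotropicS (capvSl _ _) isoM. Qed.

Lemma singular_off_orth A z : isotropic A -> (radical <= A)%VS -> (\dim A < \dim M)%N ->
  z \in orth A -> z \notin (A + kernel)%VS ->
  exists w, [/\ w \in orth A, singular w & omega z w != 0].
Proof.
move=> isoA radA dA zA z_notin.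
have [p [pA sp p_notin_A]] := isotropic_extend isoA isoM dA.
have [zp|zp] := eqVneq (omega z p) 0; last by exists p.
have p_notin : p \notin (A + kernel)%VS.
  apply: contra p_notin_A => /memv_addP[a aA [k kK p_ak]].
  have -> : p = a + (p - a) by rewrite addrC subrK.
  rewrite rpredD // (subvP radA) //; apply/memv_radical; split; first by rewrite p_ak addrC addKr.
  rewrite -scaleN1r; apply: singularD => //; last exact/singularZ/(isotropic_singular isoA).
  by rewrite omegaZr (orth_omegaC pA) // mul0r.
have [v vA zv] := orth_separates z_notin; have [u uA pu] := orth_separates p_notin.
have [y [yA zy py]] : exists y, [/\ y \in orth A, omega z y != 0 & omega p y != 0].
  have [zu|zu] := eqVneq (omega z u) 0; last by exists u.
  have [pv|pv] := eqVneq (omega p v) 0; last by exists v.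
  by exists (v + u); split; [rewrite rpredD|rewrite omegaDr zu addr0|rewrite omegaDr pv add0r].
have [c sy] := singular_translate sp py.
by exists (y + c *: p); split; [rewrite rpredD ?memvZ| |rewrite omegaDr omegaZr zp mul0r addr0].
Qed.

Lemma constructible_opposite0 A N : isotropic A -> con N (opposite A 0%VS).
Proof.
move=> isoA; apply: (constructible_least _ (x := A)) => [|W []//].
by split=> //; exact: cap0v.
Qed.

Lemma orth0 : orth 0%VS = fullv.
Proof.
apply/vspaceP => v; rewrite memvf; apply/orthP => u; rewrite memv0 => /eqP ->.
exact: omega0l.
Qed.

Lemma constructible_opposite_line A z N : isotropic A -> (radical <= A)%VS -> z \in orth A ->
  z \notin (A + kernel)%VS -> (N + \dim A <= \dim M)%N -> con N (opposite A <[z]>).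
Proof.
have [n] := ubnP (\dim M - \dim A)%N; elim: n A z N => // n IH A z [|N] dMA isoA radA zA z_notin dN.
  exact: constructible_zero.
have dA : (\dim A < \dim M)%N by move: dN; clear; lia.
have [w [wA sw zw]] := singular_off_orth isoA radA dA zA z_notin.
apply: (@constructible_opposite_step A <[z]> 0%VS z w) => //.
- by rewrite add0v.
- by rewrite orth0 subvf.
- by rewrite orth0 memvf.
- move=> V y N' isoV AV dAV yV y_notin dN'; apply: IH => //; last exact: subv_trans AV.
  by move: dMA dAV dA; clear; lia.
- by rewrite dim_vline; case: (z != 0); move: dN; clear; lia.
- by apply: constructible_opposite0; exact: isotropic_addv_line.
Qed.

Section HyperbolicPartner.
Variables (A Z Z' : {vspace E}) (z : E).
Hypotheses (isoZ : isotropic Z) (ZA : (Z <= orth A)%VS) (ZAK : (Z :&: (A + kernel))%VS = 0%VS).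
Hypotheses (hypZ' : hyperplane Z Z') (zZ : z \in Z) (z_notin : z \notin Z').

Let Z'Z : (Z' <= Z)%VS. Proof. by case/andP: hypZ'. Qed.

Lemma hyperbolic_partner :
  exists w, [/\ w \in orth A, w \in orth Z', singular w & omega z w != 0].
Proof.
have z_notin_sum : z \notin (A + Z' + kernel)%VS.
  apply: contra z_notin => /memv_addP[_ /memv_addP[a aA [z' z'Z' ->]] [k kK z_sum]].
  have : z - z' \in (Z :&: (A + kernel))%VS.
    have z'Z := subvP Z'Z _ z'Z'.
    by rewrite memv_cap rpredB //= z_sum addrAC addrK memv_add.
  by rewrite ZAK memv0 subr_eq0 => /eqP ->.
have [v] := orth_separates z_notin_sum; rewrite orth_addv memv_cap => /andP[vA vZ'] zv.
have sz := isotropic_singular isoZ zZ; have [c sw] := singular_translate sz zv.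
have zZ' : z \in orth Z' := subvP (subv_trans (isotropic_sub_orth isoZ) (orthS Z'Z)) _ zZ.
exists (v + c *: z); split=> //.
- by rewrite rpredD ?memvZ // (subvP ZA).
- by rewrite rpredD ?memvZ.
- by rewrite omegaDr omegaZr singular_omega // mul0r addr0.
Qed.

Lemma partner_cap_kernel w : omega z w != 0 -> (Z' :&: (A + <[w]> + kernel))%VS = 0%VS.
Proof.
move=> zw; apply/eqP; rewrite -subv0; apply/subvP => x; rewrite memv_cap => /andP[xZ'].
move=> /memv_addP[_ /memv_addP[a aA [_ /vlineP[d ->] ->]] [k kK x_sum]].
have xZ := subvP Z'Z _ xZ'; have : omega z x = 0 by case: isoZ => + _; exact.
rewrite x_sum !omegaDr omegaZr (kernel_omega _ kK) addr0 (orth_omegaC (subvP ZA _ zZ) aA) add0r.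
move=> /eqP; rewrite mulf_eq0 (negPf zw) /= => /eqP d0.
by rewrite -x_sum -ZAK memv_cap xZ x_sum d0 scale0r addr0 memv_add.
Qed.

End HyperbolicPartner.

Lemma constructible_opposite A Z N : isotropic A -> (radical <= A)%VS -> isotropic Z ->
  (Z <= orth A)%VS -> (Z :&: (A + kernel))%VS = 0%VS -> (N + \dim A + \dim Z <= (\dim M).+1)%N ->
  con N (opposite A Z).
Proof.
have [n] := ubnP (\dim Z); elim: n A Z N => // n IH A Z N dZ isoA radA isoZ ZA ZAK dN.
have [->|Z0] := eqVneq Z 0%VS; first exact: constructible_opposite0.
have /subvPn[z zZ z0] : ~~ (Z <= 0)%VS by rewrite subv0.
have [Z' [_ hypZ' z_notin]] := hyperplane_avoiding (sub0v Z) zZ z0.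
have [w [wA wZ' sw zw]] := hyperbolic_partner isoZ ZA ZAK hypZ' zZ z_notin.
have [Z'Z /eqP dZ'] := andP hypZ'.
apply: (@constructible_opposite_step A Z Z' z w) => //.
- exact: hyperplane_addv_line.
- exact: subv_trans (isotropic_sub_orth isoZ) (orthS Z'Z).
- move=> V y N' isoV AV _ yV y_notin dN'; apply: constructible_opposite_line => //.
  exact: subv_trans AV.
apply: IH.
- by rewrite -ltnS -dZ'.
- exact: isotropic_addv_line.
- exact: subv_trans (addvSl _ _).
- exact: isotropicS isoZ.
- by rewrite orth_addv subv_cap (subv_trans Z'Z) //= sub_orth_line.
- exact: partner_cap_kernel isoZ ZA ZAK hypZ' zZ _ zw.
- by have := dim_addv_line_le A w; move: dN; rewrite dZ'; clear; lia.
Qed.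

Section OppositeCohenMacaulay.
Variable Z : {vspace E}.
Hypotheses (isoZ : isotropic Z) (ZK : (Z :&: kernel)%VS = 0%VS).

Let Rad := radical.
Let S := opposite Rad Z.
Let lo := (\dim Rad + \dim Z)%N.

Let RadK : (Rad <= kernel)%VS. Proof. exact: capvSr. Qed.
Let ZRad : (Z <= orth Rad)%VS.
Proof. by rewrite sub_orthC; exact: subv_trans RadK (kernel_sub_orth Z). Qed.

Lemma radical_dim_le : (lo <= \dim M)%N.
Proof.
have isoRZ : isotropic (Rad + Z) by apply: isotropic_addv ZRad; first exact: isotropic_radical.
by rewrite /lo -dimv_disjoint_sum ?maxM // capvC; exact: cap0_sub RadK ZK.
Qed.

Lemma opposite_dim_range W : S W -> (lo <= \dim W <= \dim M)%N.
Proof.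
move=> SW; have [isoW RadW _] := SW.
by rewrite maxM // -(opposite_dim SW) leq_add2r dimvS // subv_cap RadW sub_orthC.
Qed.

Let rank : ext {vspace E} -> nat := ext_rank (fun W => \dim W) lo (\dim M).

Lemma constructible_opposite_interval (x y : ext {vspace E}) :
  in_ext S x -> in_ext S y -> ext_lt le x y -> con (rank y - (rank x).+1)
    (open_interval le S x y).
Proof.
case: x => [|a|]; case: y => [|b|] //=; try by [move=> _ _ []|move=> _ _ [_ /(_ erefl)]].
- move=> _ Sb _; have -> : open_interval le S (Bot _) (Mid b) = lower_part S b.
    by apply/seteqP; split=> W; [case=> SW [_ /ext_lt_Mid]|case=> SW /ext_lt_Mid].
  rewrite opposite_lower_part //; have [_ Rb _] := Sb.
  have -> : ((\dim b).+1 - lo.+1)%N = (\dim (b :&: orth Z) - \dim Rad)%N.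
    by rewrite subSS -(opposite_dim Sb) /lo subnDr.
  have [bR|bR] := boolP (b <= Rad)%VS.
    have -> : (\dim (b :&: orth Z) - \dim Rad = 0)%N.
      by apply/eqP; rewrite subn_eq0 dimvS // (subv_trans (capvSl _ _)).
    exact: constructible_zero.
  by apply: constructible_supplements bR; [rewrite subv_cap Rb sub_orthC|exact: capvSl].
- move=> _ _ _; rewrite open_interval_Bot_Top; apply: constructible_opposite => //.
  + exact: isotropic_radical.
  + by rewrite (addv_idPr RadK).
  + by have := radical_dim_le; rewrite /lo; clear; lia.
- move=> Sa Sb /ext_lt_Mid ab; have -> : open_interval le S (Mid a) (Mid b) = between a b.
    apply/seteqP; split=> W; first by case=> _ [/ext_lt_Mid ? /ext_lt_Mid].
    move=> [aW Wb]; split; last by split; apply/ext_lt_Mid.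
    apply: opposite_upward Sa _ (plt_vsubW aW); have [isob _ _] := Sb.
    exact: isotropicS (plt_vsubW Wb) isob.
  by rewrite subSS subnS; exact/constructible_between/plt_vsubW.
- move=> Sa _ _; have -> : open_interval le S (Mid a) (Top _) = isotropic_above a.
    apply/seteqP; split=> W; first by case=> -[isoW _ _] [/ext_lt_Mid].
    move=> [isoW aW]; split; first exact: opposite_upward Sa isoW (plt_vsubW aW).
    by split; [apply/ext_lt_Mid|].
  have [isoa _ _] := Sa; apply: constructible_isotropic_above => //.
  by rewrite subSS subSS subnK // maxM.
Qed.

Lemma opposite_cohen_macaulay : cohen_macaulay le S.
Proof.
apply: (constructible_cohen_macaulay (vsub_ranked E) opposite_dim_range (leqW radical_dim_le)).
exact: constructible_opposite_interval.
Qed.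

End OppositeCohenMacaulay.

Section RelativePoset.
Variable U : {vspace E}.
Hypothesis PU : Pomega sigma eps Lambda q U.

Let Z := (U :\: radical)%VS.
Let isoU : isotropic U. Proof. by case: PU. Qed.
Let ZU : (Z <= U)%VS. Proof. exact: diffvSl. Qed.

Lemma memv_radicalE v : v \in radical <-> Rad sigma eps Lambda q v.
Proof.
split=> [/memv_radical[/kernelP Kv sv]|Rv]; first by split=> //; have := sv 1; rewrite scale1r.
apply/memv_radical; split; first by apply/kernelP; case: Rv.
by apply: (isotropic_singular isoU); case: PU => _ + _ _; exact.
Qed.

Lemma isotropic_diff_radical : isotropic Z.
Proof. exact: isotropicS ZU isoU. Qed.

Lemma diff_radical_cap_kernel : (Z :&: kernel)%VS = 0%VS.
Proof.
apply/eqP; rewrite -subv0 -(capv_diff U radical) subv_cap capvSl /=; apply/subvP => v.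
rewrite memv_cap => /andP[vZ vK]; apply/memv_radical; split=> //.
exact: isotropic_singular isoU (subvP ZU _ vZ).
Qed.

Lemma diff_radical_not_sub_kernel : ~~ (Z <= kernel)%VS.
Proof.
apply/negP => ZK; have [_ _ [u uU nRu] _] := PU; apply: nRu; apply/memv_radicalE.
move: uU; rewrite -{1}(addv_diff_cap U radical) -/Z -(capv_idPl ZK) diff_radical_cap_kernel add0v.
by rewrite memv_cap => /andP[].
Qed.

Lemma opposite_supplement W : opposite radical Z W -> (W + orth Z)%VS = fullv.
Proof.
move=> oppW; apply/eqP; rewrite eqEdim subvf /=.
have := opposite_dim oppW; have := dim_cap_orth Z fullv; have := dimv_sum_cap W (orth Z).
by rewrite capfv; clear; lia.
Qed.

Lemma perp_orth x : perp sigma eps q U x <-> x \in orth U.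
Proof.
by split=> [Ux|Ux u uU]; [apply/orthP => u uU; exact/omega_eq0C/Ux|exact: orth_omegaC Ux uU].
Qed.

Lemma orth_diff_radical : orth Z = orth U.
Proof.
rewrite -[in RHS](addv_diff_cap U radical) orth_addv -/Z; apply/esym/capv_idPl.
by rewrite sub_orthC; apply: subv_trans (capvSr _ _) (subv_trans (capvSr _ _) (kernel_sub_orth _)).
Qed.

Lemma PomegaU_opposite : PomegaU sigma eps Lambda q U = opposite radical Z.
Proof.
apply/seteqP; split=> W.
  move=> [[isoW RW _ _] WU]; split=> //; first by apply/subvP => v /memv_radicalE/RW.
  apply/eqP; rewrite -subv0 -diff_radical_cap_kernel subv_cap capvSl /=; apply/subvP => x.
  rewrite memv_cap => /andP[xZ xW]; apply/kernelP => e; have [w [y [wW /perp_orth yU ->]]] := WU e.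
  by rewrite omegaDl (orth_omega xW wW) add0r (orth_omegaC yU) // (subvP ZU).
move=> oppW; have [isoW RW ZW] := oppW; split; last first.
  move=> e; have : e \in (W + orth Z)%VS by rewrite opposite_supplement // memvf.
  rewrite orth_diff_radical => /memv_addP[w wW [x xU ->]].
  by exists w, x; split=> //; apply/perp_orth.
have ZW_full : ~~ (Z <= orth W)%VS.
  apply: contra diff_radical_not_sub_kernel => /capv_idPl; rewrite ZW => <-; exact: sub0v.
split=> //; first by move=> v /memv_radicalE; exact: subvP RW v.
- have /subvPn[w wW wK] : ~~ (W <= kernel)%VS.
    apply: contra ZW_full => WK; rewrite sub_orthC; exact: subv_trans WK (kernel_sub_orth _).
  by exists w => // -[/kernelP Kw _]; rewrite Kw in wK.
- move=> W_full; case/negP: ZW_full; apply: subv_trans (subvf Z) _.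
  by rewrite -W_full; exact: isotropic_sub_orth.
Qed.

End RelativePoset.

End MaximalIsotropic.

End Forms.

Lemma exists_max_dim (F : fieldType) (E : vectType F) (P : {vspace E} -> Prop) U : P U ->
  exists2 M, P M & forall W, P W -> (\dim W <= \dim M)%N.
Proof.
move=> PU; pose has_dimension n := `[< exists2 W, P W & \dim W = n >].
have ex_dim : exists n, has_dimension n by exists (\dim U); apply/asboolP; exists U.
have dim_le n : has_dimension n -> (n <= \dim {:E})%N.
  by move=> /asboolP[W _ <-]; exact/dimvS/subvf.
case: (ex_maxnP ex_dim dim_le) => _ /asboolP[M PM <-] maxM; exists M => // W PW.
by apply: maxM; apply/asboolP; exists W.
Qed.

Theorem theorem4p7 (F : fieldType) (E : vectType F)
    (sigma : {rmorphism F -> F}) (eps : F) (Lambda : pred F)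
    (q : E -> E -> F) :
  form_parameters sigma eps Lambda ->
  sesquilinear sigma q ->
  forall U : {vspace E}, Pomega sigma eps Lambda q U ->
    cohen_macaulay (@vsub_le F E) (PomegaU sigma eps Lambda q U).
Proof.
move=> params sesq U PU; have [isoU _ _ _] := PU.
have [M isoM maxM] := exists_max_dim isoU.
rewrite (PomegaU_opposite params sesq isoM maxM PU).
apply: opposite_cohen_macaulay => //; first exact: isotropic_diff_radical PU.
exact: diff_radical_cap_kernel PU.
Qed.
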